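(* Let $n\ge 1$, $0<s<1$, and let $\Omega\subset\mathbb{R}^n$ be a bounded open set with Lipschitz continuous boundary. Let $$D(\mathfrak a_N):=\{u\in L^2(\Omega):\ u_N\in W^{s,2}_\Omega\},\qquad \mathfrak a_N(u,v):=\mathcal E(u_N,v_N)\quad (u,v\in D(\mathfrak a_N)).$$ Then $\mathfrak a_N$ is a closed, symmetric and densely defined bilinear form on $L^2(\Omega)$. The selfadjoint operator $A_N$ on $L^2(\Omega)$ associated with $\mathfrak a_N$ is given by $$D(A_N)=\{u\in L^2(\Omega):\ u_N\in W^{s,2}_\Omega \text{ and there exists } f\in L^2(\Omega) \text{ such that } u_N \text{ is a weak solution of the Neumann problem with right hand side } f\},\qquad A_Nu=f.$$
   Context: Functions are real-valued and identified when equal almost everywhere. $C_{n,s}:=\frac{s2^{2s}\Gamma(\frac{2s+n}{2})}{\pi^{n/2}\Gamma(1-s)}$. The space $W^{s,2}_\Omega$ consists of all measurable $u:\mathbb{R}^n\to\mathbb{R}$ with $\|u\|_{W^{s,2}_\Omega}^2:=\int_\Omega|u|^2dx+\iint_{\mathbb{R}^{2n}\setminus(\mathbb{R}^n\setminus\Omega)^2}\frac{|u(x)-u(y)|^2}{|x-y|^{n+2s}}dxdy<\infty$. For $u,v\in W^{s,2}_\Omega$, $$\mathcal E(u,v):=\frac{C_{n,s}}{2}\int_\Omega\int_\Omega\frac{(u(x)-u(y))(v(x)-v(y))}{|x-y|^{n+2s}}dydx+C_{n,s}\int_\Omega\int_{\mathbb{R}^n\setminus\Omega}\frac{(u(x)-u(y))(v(x)-v(y))}{|x-y|^{n+2s}}dydx.$$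 Neumann extension: with $\rho(x):=\int_\Omega\frac{dy}{|x-y|^{n+2s}}$ for $x\in\mathbb{R}^n\setminus\overline\Omega$, for $u\in L^2(\Omega)$ put $u_N(x):=u(x)$ if $x\in\Omega$ and $u_N(x):=\frac{1}{\rho(x)}\int_\Omega\frac{u(y)}{|x-y|^{n+2s}}dy$ if $x\in\mathbb{R}^n\setminus\overline\Omega$ (this defines $u_N$ a.e., since $\partial\Omega$ is a null set). Neumann problem with right hand side $f\in L^2(\Omega)$: $(-\Delta)^su=f$ in $\Omega$, $\mathcal N^su=0$ in $\mathbb{R}^n\setminus\overline\Omega$, where $\mathcal N^su(x)=C_{n,s}\int_\Omega\frac{u(x)-u(y)}{|x-y|^{n+2s}}dy$. A weak solution is a function $u\in W^{s,2}_\Omega$ such that $\mathcal E(u,v)=\int_\Omega fv\,dx$ for every $v\in W^{s,2}_\Omega$. A symmetric non-negative bilinear form $\mathfrak a$ on $D(\mathfrak a)\subset L^2(\Omega)$ is closed if $D(\mathfrak a)$ is complete for the norm $(\mathfrak a(u,u)+\|u\|_{L^2(\Omega)}^2)^{1/2}$. The operator $A$ associated with $\mathfrak a$ is $D(A)=\{u\in D(\mathfrak a):\exists f\in L^2(\Omega)\ \mathfrak a(u,v)=(f,v)_{L^2(\Omega)}\ \forall v\in D(\mathfrak a)\}$, $Au=f$. *)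

(* Defs.v *)
From HB Require Import structures.
From mathcomp Require Import all_boot all_order all_algebra.
From mathcomp Require Import all_classical all_reals all_analysis measurable_realfun.

Set Implicit Arguments.
Unset Strict Implicit.
Unset Printing Implicit Defensive.

Import Order.TTheory GRing.Theory Num.Theory.
Import numFieldNormedType.Exports.

Local Open Scope classical_set_scope.
Local Open Scope ring_scope.

Definition rV_display : measure_display -> measure_display.
Proof. exact. Qed.

Section measurable_rV.
Context (R : realType) (n : nat).

Let coors : 'I_n -> 'rV[R]_n -> measurableTypeR R := fun i x => x ord0 i.

Let rV_set0 : g_sigma_preimage coors set0.
Proof. exact: sigma_algebra0. Qed.

Let rV_setC A : g_sigma_preimage coors A -> g_sigma_preimage coors (~` A).
Proof. exact: sigma_algebraC. Qed.

Let rV_bigcup (F : _^nat) : (forall i, g_sigma_preimage coors (F i)) ->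
  g_sigma_preimage coors (\bigcup_i (F i)).
Proof. exact: sigma_algebra_bigcup. Qed.

HB.instance Definition _ := @isMeasurable.Build
  (rV_display default_measure_display)
  'rV[R]_n (g_sigma_preimage coors) rV_set0 rV_setC rV_bigcup.

Lemma measurable_coord_rV (i : 'I_n) :
  measurable_fun [set: 'rV[R]_n] (fun x : 'rV[R]_n => x ord0 i).
Proof.
move=> _ A mA; rewrite setTI; apply: sub_sigma_algebra.
by rewrite (bigD1 i)//=; left; exists A => //; rewrite setTI.
Qed.

Lemma measurable_fun_rVP d (T : measurableType d) (f : T -> 'rV[R]_n) :
  (forall i, measurable_fun setT (fun x => f x ord0 i)) ->
  measurable_fun setT f.
Proof.
move=> mf.
suff sf : preimage_set_system setT f (g_sigma_preimage coors) `<=` measurable.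
  by move=> _ A mA; apply: sf; exists A.
rewrite -g_sigma_preimage_comp.
apply: smallest_sub; first exact: sigma_algebra_measurable.
elim/big_ind: _ => [//|X Y XM YM|i _]; first by rewrite subUset.
by move=> A [B mB <-]; exact: mf.
Qed.

Lemma open_measurable_rV (U : set 'rV[R]_n) : open U -> measurable U.
Proof.
move=> oU.
pose box (p : 'rV[rat]_n * nat) : set 'rV[R]_n :=
  \big[setI/setT]_(i < n)
    ((fun x : 'rV[R]_n => x ord0 i) @^-1`
       ball (ratr (p.1 ord0 i) : R) (p.2.+1%:R^-1)).
have boxE p x : box p x <->
    forall i, ball (ratr (p.1 ord0 i) : R) (p.2.+1%:R^-1) (x ord0 i).
  rewrite /box; split=> [+ i|H]; first by rewrite (bigD1 i)//= => -[].
  by apply: (big_ind (fun B : set 'rV[R]_n => B x)) => // i _; exact: H.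
have mbox p : measurable (box p).
  apply: bigsetI_measurable => i _.
  rewrite -[X in measurable X]setTI; apply: measurable_coord_rV => //.
  exact: measurable_ball.
pose F k : set 'rV[R]_n :=
  if unpickle k is Some p then (if `[< box p `<=` U >] then box p else set0)
  else set0.
have -> : U = \bigcup_k F k.
  apply/seteqP; split=> [x Ux|x [k _]]; last first.
    by rewrite /F; case: unpickle => // p; case: ifPn => // /asboolP; apply.
  have : nbhs x U by exact: open_nbhs_nbhs.
  move=> /nbhs_ballP[e /= e0 eU].
  have [m m0 me] : exists2 m : nat, True & m.+1%:R^-1 < e / 2.
    have e20 : 0 < e / 2 by rewrite divr_gt0.
    exists (Num.truncn (e / 2)^-1) => //.
    by rewrite invf_plt ?posrE// truncnS_gt.
  have q_ i : exists q : rat, ball (ratr q : R) (m.+1%:R^-1) (x ord0 i).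
    have : x ord0 i - m.+1%:R^-1 < x ord0 i + m.+1%:R^-1.
      by rewrite ltrD2l gtrN// invr_gt0.
    move=> /rat_in_itvoo[q /itvP qe]; exists q.
    by rewrite /ball/= ltr_distl !qe.
  have [q0 q0P] := choice q_; pose q : 'rV[rat]_n := \row_i q0 i.
  have qP i : ball (ratr (q ord0 i) : R) (m.+1%:R^-1) (x ord0 i).
    by rewrite mxE.
  exists (pickle (q, m)) => //; rewrite /F pickleK.
  case: ifPn => [_|/asboolP[]]; first exact/boxE.
  move=> y /boxE yq; apply: eU; split => // i j.
  rewrite (ord1 i); have := qP j; have := yq j; rewrite /ball/= => h1 h2.
  rewrite (le_lt_trans (ler_distD (ratr (q ord0 j)) _ _))//.
  rewrite (splitr e) ltrD//; last exact: lt_trans h1 me.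
  by rewrite distrC; exact: lt_trans h2 me.
apply: bigcupT_measurable => k; rewrite /F.
by case: unpickle => // p; case: ifP.
Qed.

End measurable_rV.

Section lebesgue_measure_rV.
Context (R : realType).

Definition cons_rV n (p : measurableTypeR R * 'rV[R]_n) : 'rV[R]_n.+1 :=
  row_mx (const_mx p.1 : 'rV[R]_1) p.2.

Lemma cons_rV0 n p : @cons_rV n p ord0 ord0 = p.1.
Proof.
rewrite /cons_rV (_ : ord0 = lshift n (ord0 : 'I_1)); last exact/val_inj.
by rewrite (row_mxEl (const_mx _ : 'rV_1)) mxE.
Qed.

Lemma cons_rVS n p i : @cons_rV n p ord0 (lift ord0 i) = p.2 ord0 i.
Proof.
rewrite /cons_rV (_ : lift ord0 i = rshift 1 i); last exact/val_inj.
by rewrite (row_mxEr (const_mx _ : 'rV_1)).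
Qed.

Lemma measurable_cons_rV n : measurable_fun setT (@cons_rV n).
Proof.
apply/measurable_fun_rVP => i; case: (unliftP ord0 i) => [j|] ->.
  under eq_fun do rewrite cons_rVS.
  apply: (measurableT_comp (@measurable_coord_rV R n j)); exact: measurable_snd.
under eq_fun do rewrite cons_rV0; exact: measurable_fst.
Qed.

Definition uncons_rV n (x : 'rV[R]_n.+1) : measurableTypeR R * 'rV[R]_n :=
  (x ord0 ord0, \row_i x ord0 (lift ord0 i)).

Lemma cons_rVK n : cancel (@cons_rV n) (@uncons_rV n).
Proof.
move=> [a v]; rewrite /uncons_rV cons_rV0; congr pair.
by apply/rowP => i; rewrite mxE cons_rVS.
Qed.

Lemma measurable_uncons_rV n : measurable_fun setT (@uncons_rV n).
Proof.
apply: measurable_fun_pair; first exact: (@measurable_coord_rV R n.+1 ord0).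
apply/measurable_fun_rVP => i; under eq_fun do rewrite mxE.
exact: (@measurable_coord_rV R n.+1 (lift ord0 i)).
Qed.

Section step.
Variables (n : nat) (mu : {sigma_finite_measure set 'rV[R]_n -> \bar R}).

Definition lebesgue_rV_step : set 'rV[R]_n.+1 -> \bar R :=
  pushforward (lebesgue_measure \x mu)%E (@cons_rV n).

Let step0 : lebesgue_rV_step set0 = 0%E.
Proof. by rewrite /lebesgue_rV_step /pushforward preimage_set0 measure0. Qed.

Let step_ge0 A : (0 <= lebesgue_rV_step A)%E.
Proof. by apply: (@measure_ge0 _ _ _ (lebesgue_measure \x mu)%E). Qed.

Let step_semi_sigma_additive : semi_sigma_additive lebesgue_rV_step.
Proof.
have mc A : measurable A -> measurable (@cons_rV n @^-1` A).
  by move=> mA; rewrite -[X in measurable X]setTI; exact: measurable_cons_rV.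
move=> F mF tF mUF; rewrite /lebesgue_rV_step /pushforward preimage_bigcup.
apply: measure_semi_sigma_additive => [i||].
- exact: mc.
- apply/trivIsetP => /= i j _ _ ij; rewrite -preimage_setI.
  by move/trivIsetP : tF => /(_ _ _ _ _ ij) ->//; rewrite preimage_set0.
- by rewrite -preimage_bigcup; exact: mc.
Qed.

HB.instance Definition _ := isMeasure.Build _ _ _ lebesgue_rV_step
  step0 step_ge0 step_semi_sigma_additive.

Let step_sigma_finite : sigma_finite setT lebesgue_rV_step.
Proof.
have /sigma_finiteP[F [TF ndF Foo]] :=
  @sigma_finiteT _ _ _ (@lebesgue_measure R).
have /sigma_finiteP[G [TG ndG Goo]] := @sigma_finiteT _ _ _ mu.
exists (fun k => @uncons_rV n @^-1` (F k `*` G k)).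
  rewrite -preimage_bigcup (_ : \bigcup_k _ = setT) ?preimage_setT//.
  rewrite -setXTT TF TG; apply/seteqP; split=> [[x y]|[x y]].
    by move=> [k _ [Fx Gy]]; split; exists k.
  move=> [[i _ /= Fx] [j _ /= Gy]]; exists (maxn i j) => //; split.
  - by move: x Fx; exact/subsetPset/ndF/leq_maxl.
  - by move: y Gy; exact/subsetPset/ndG/leq_maxr.
move=> k; have [mF Fk] := Foo k; have [mG Gk] := Goo k.
have mFG : measurable (F k `*` G k) by exact: measurableX.
split; first by rewrite -[X in measurable X]setTI; exact: measurable_uncons_rV.
rewrite /lebesgue_rV_step /pushforward -comp_preimage.
rewrite (_ : _ \o _ = id); last by apply/funext => x; exact: cons_rVK.
by rewrite preimage_id product_measure1E// lte_mul_pinfty// ge0_fin_numE.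
Qed.

HB.instance Definition _ := Measure_isSigmaFinite.Build _ _ _ lebesgue_rV_step
  step_sigma_finite.

End step.

Fixpoint lebesgue_rV n : {sigma_finite_measure set 'rV[R]_n -> \bar R} :=
  match n with
  | 0 => \d_(0 : 'rV[R]_0)
  | n'.+1 => lebesgue_rV_step (lebesgue_rV n')
  end.

Lemma lebesgue_rV_box n (A : 'I_n -> set (measurableTypeR R)) :
  (forall i, measurable (A i)) ->
  lebesgue_rV n [set x | forall i, A i (x ord0 i)] =
  (\prod_(i < n) lebesgue_measure (A i))%E.
Proof.
elim: n A => [A _|n IH A mA].
  rewrite big_ord0 /= diracE mem_set//; by case.
have mB : measurable
    [set x : 'rV[R]_n | forall i, A (lift ord0 i) (x ord0 i)].
  rewrite (_ : [set _ | _] = \bigcap_(i in [set: 'I_n])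
      (fun x : 'rV[R]_n => x ord0 i) @^-1` A (lift ord0 i)).
    apply: fin_bigcap_measurable => // i _.
    by rewrite -[X in measurable X]setTI; apply: measurable_coord_rV => //; exact: mA.
  by apply/seteqP; split=> [x H i _|x H i]; exact: H.
rewrite big_ord_recl -IH//= /lebesgue_rV_step /pushforward.
rewrite -product_measure1E//; congr (_ _).
apply/seteqP; split=> [[a v] /= H|[a v] [/= H0 H] i].
  split=> [|i] /=; first by have := H ord0; rewrite cons_rV0.
  by have := H (lift ord0 i); rewrite cons_rVS.
by case: (unliftP ord0 i) => [j|] ->; rewrite ?cons_rVS ?cons_rV0.
Qed.

End lebesgue_measure_rV.

Notation L2 mu := (LfunType mu (lee1n 2)).

(* Elements of [L2 mu] are representatives: equality in the Hilbert space L^2 is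
   [_ = _ %[ae mu]]. *)
Section forms.
Context d (T : measurableType d) (R : realType).
Variable mu : {measure set T -> \bar R}.
Implicit Types (u v w f g : L2 mu) (D : set (L2 mu)) (a : L2 mu -> L2 mu -> R)
  (A : L2 mu -> L2 mu -> Prop).

Definition L2_inner f g : R := \int[mu]_x (f x * g x).

Definition L2_norm f : R := fine 'N[mu]_2%:R%:E[EFin \o f].

Definition ae_invariant_form D a := forall u v, u = v %[ae mu] -> D u ->
  D v /\ forall w, D w -> a u w = a v w /\ a w u = a w v.

Definition bilinear_on D a :=
  [/\ D 0,
      (forall (c : R) u v, D u -> D v -> D (c *: u + v)),
      (forall (c : R) u v w, D u -> D v -> D w ->
        a (c *: u + v) w = c * a u w + a v w) &
      (forall (c : R) u v w, D u -> D v -> D w ->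
        a w (c *: u + v) = c * a w u + a w v)].

Definition symmetric_on D a := forall u v, D u -> D v -> a u v = a v u.

Definition nonneg_on D a := forall u, D u -> 0 <= a u u.

Definition densely_defined D :=
  forall f (e : R), 0 < e -> exists2 u, D u & L2_norm (f - u) < e.

Definition form_norm a u : R := Num.sqrt (a u u + L2_norm u ^+ 2).

Definition closed_form D a := forall w_ : nat -> L2 mu, (forall k, D (w_ k)) ->
  (forall e : R, 0 < e -> exists N, forall i j, (N <= i)%N -> (N <= j)%N ->
    form_norm a (w_ i - w_ j) < e) ->
  exists2 u, D u & form_norm a (w_ k - u) @[k --> \oo] --> 0.

Definition associated_operator D a : L2 mu -> L2 mu -> Prop :=
  fun u f => D u /\ forall v, D v -> a u v = L2_inner f v.

Definition operator_domain A : set (L2 mu) := [set u | exists f, A u f].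

Definition adjoint A : L2 mu -> L2 mu -> Prop :=
  fun v g => forall u f, A u f -> L2_inner f v = L2_inner u g.

Definition selfadjoint A :=
  [/\ densely_defined (operator_domain A),
      (forall u f g, A u f -> A u g -> f = g %[ae mu]) &
      (forall u f, A u f <-> adjoint A u f)].

End forms.

Section neumann.
Context (R : realType) (n : nat).
Implicit Types (x y : 'rV[R]_n) (u v f : 'rV[R]_n -> R) (Om : set 'rV[R]_n).

Local Notation leb := (lebesgue_rV R n).

Definition dotv x y : R := \sum_(i < n) x ord0 i * y ord0 i.

(* The library norm of ['rV_n] is the sup norm. *)
Definition enorm x : R := Num.sqrt (dotv x x).

(* Near each boundary point, [Om] is the strict epigraph, in the direction of a
   unit vector [e], of a Lipschitz function [g] on the hyperplane orthogonal to
   [e]; [x - dotv x e *: e] is the orthogonal projection of [x] on it. *)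
Definition lipschitz_boundary Om := forall p, (closure Om `\` Om°) p ->
  exists (r L : R) (e : 'rV[R]_n) (g : 'rV[R]_n -> R),
    [/\ 0 < r, enorm e = 1,
        (forall y z, dotv y e = 0 -> dotv z e = 0 ->
          `|g y - g z| <= L * enorm (y - z)) &
        (forall x, enorm (x - p) < r ->
          (Om x <-> g (x - dotv x e *: e) < dotv x e))].

Definition Gamma (t : R) : R :=
  \int[@lebesgue_measure R]_(r in `]0, +oo[) (r `^ (t - 1) * expR (- r)).

Variable s : R.

Definition Cns : R :=
  s * 2 `^ (2 * s) * Gamma ((2 * s + n%:R) / 2) /
  (pi `^ (n%:R / 2) * Gamma (1 - s)).

Definition frac_kernel x y : R := (enorm (x - y) `^ (n%:R + 2 * s))^-1.

Definition sobolev_Om Om : set ('rV[R]_n -> R) := [set u : 'rV[R]_n -> R |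
  measurable_fun setT u /\
  (\int[leb]_(x in Om) (u x ^+ 2)%:E +
   \int[leb \x leb]_(z in ~` (~` Om `*` ~` Om))
     ((u z.1 - u z.2) ^+ 2 * frac_kernel z.1 z.2)%:E < +oo)%E].

Definition energy Om u v : R :=
  Cns / 2 * (\int[leb]_(x in Om) \int[leb]_(y in Om)
    ((u x - u y) * (v x - v y) * frac_kernel x y)) +
  Cns * (\int[leb]_(x in Om) \int[leb]_(y in ~` Om)
    ((u x - u y) * (v x - v y) * frac_kernel x y)).

(* The value 0 on the boundary of [Om] is arbitrary. *)
Definition neumann_ext Om u : 'rV[R]_n -> R := fun x =>
  if x \in Om then u x
  else if x \in closure Om then 0
  else (\int[leb]_(y in Om) frac_kernel x y)^-1 *
       \int[leb]_(y in Om) (u y * frac_kernel x y).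

(* The condition N^s u = 0 is encoded in testing against all [v] in
   [sobolev_Om Om], with no restriction on [v] outside [Om]. *)
Definition neumann_weak_solution Om f u :=
  sobolev_Om Om u /\
  forall v, sobolev_Om Om v -> energy Om u v = \int[leb]_(x in Om) (f x * v x).

Variables (Om : set 'rV[R]_n) (mOm : measurable Om).

Definition lebesgue_on : {measure set 'rV[R]_n -> \bar R} := mrestr leb mOm.

Definition neumann_domain : set (L2 lebesgue_on) :=
  [set u | sobolev_Om Om (neumann_ext Om u)].

Definition neumann_form (u v : L2 lebesgue_on) : R :=
  energy Om (neumann_ext Om u) (neumann_ext Om v).

End neumann.

Arguments neumann_domain {R n} s {Om} mOm _ : assert.
Arguments neumann_form {R n} s {Om} mOm _ _ : assert.

(* Main.v *)
Require Import Defs.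
From mathcomp Require Import all_boot all_order all_algebra.
From mathcomp Require Import all_classical all_reals all_analysis.
From mathcomp Require Import measurable_realfun ring lra.

(* Every energy is a constant times the weighted L^2 product
   [B(u, v) = \iint_Z (u x - u y)(v x - v y)|x - y|^(-n-2s)], where [Z] is the set
   of pairs meeting [Om]; the boundary of [Om], having infinitely many disjoint
   small translates locally, is negligible and can be ignored.  At each
   [x] outside the closure of [Om], the value [u_N x] is the weighted mean of [u]
   over [Om].  Hence it minimises the energy between [x] and [Om], so that [u_N] is
   in [W] whenever some extension of [u] is, and the flux [N^s u_N] vanishes, so
   that [B(u_N, h) = 0] for every [h] in [W] vanishing on [Om].  By the latter, in
   the weak formulation a test function [v] may be replaced by [(v|Om)_N], which is
   the description of [A_N].  The form is closed because [u |-> u_N] is continuous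
   pointwise almost everywhere along subsequences, which allows to apply Fatou's
   lemma to [B], and densely defined because bounded Lipschitz functions are in
   [W].  The operator of a closed densely defined form is selfadjoint because the
   minimiser of [lam a(v, v) + |v - f|^2] solves [lam A v + v = f]. *)

Import Order.TTheory GRing.Theory Num.Theory.
Import numFieldNormedType.Exports.

Local Open Scope classical_set_scope.
Local Open Scope ring_scope.

Set Implicit Arguments.
Unset Strict Implicit.
Unset Printing Implicit Defensive.

(** * The space L^2 *)

Section square_integrable.
Context d (T : measurableType d) (R : realType).
Variable mu : {measure set T -> \bar R}.

Lemma integrable_mul_weight (D : set T) (f g w : T -> R) : measurable D ->
  measurable_fun D f -> measurable_fun D g -> measurable_fun D w ->
  (forall x, D x -> 0 <= w x) ->
  (\int[mu]_(x in D) (f x ^+ 2 * w x)%:E < +oo)%E ->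
  (\int[mu]_(x in D) (g x ^+ 2 * w x)%:E < +oo)%E ->
  mu.-integrable D (fun x => (f x * g x * w x)%:E).
Proof.
move=> mD mf mg mw w0 f2 g2.
have mh (h : T -> R) : measurable_fun D h ->
    measurable_fun D (fun x => (h x ^+ 2 * w x)%:E).
  by move=> mh; apply/measurable_EFinP; apply: measurable_funM => //; exact: measurable_funX.
have h0 (h : T -> R) x : D x -> (0 <= (h x ^+ 2 * w x)%:E)%E.
  by move=> Dx; rewrite lee_fin mulr_ge0// ?sqr_ge0// w0.
have mfg : measurable_fun D (fun x => (f x * g x * w x)%:E).
  by apply/measurable_EFinP; do 2 apply: measurable_funM => //.
apply/integrableP; split => //.
apply: (@le_lt_trans _ _
  (\int[mu]_(x in D) ((f x ^+ 2 * w x)%:E + (g x ^+ 2 * w x)%:E))%E).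
  apply: ge0_le_integral => //.
  - exact: measurableT_comp.
  - by apply: emeasurable_funD; exact: mh.
  - move=> x Dx; rewrite -EFinD /= lee_fin.
    rewrite -mulrDl normrM (ger0_norm (w0 x Dx)) ler_wpM2r ?w0// ler_norml.
    by have := sqr_ge0 (f x + g x); have := sqr_ge0 (f x - g x); nra.
rewrite ge0_integralD//; [|exact: h0|exact: mh|exact: h0|exact: mh].
by rewrite lte_add_pinfty.
Qed.

Lemma integrable_mul (D : set T) (f g : T -> R) : measurable D ->
  measurable_fun D f -> measurable_fun D g ->
  (\int[mu]_(x in D) (f x ^+ 2)%:E < +oo)%E ->
  (\int[mu]_(x in D) (g x ^+ 2)%:E < +oo)%E ->
  mu.-integrable D (fun x => (f x * g x)%:E).
Proof.
move=> mD mf mg f2 g2.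
have E : (fun x => (f x * g x)%:E) = (fun x => (f x * g x * 1)%:E).
  by apply/funext => x; rewrite mulr1.
rewrite E; apply: (@integrable_mul_weight _ _ _ (cst 1)) => //.
- by under eq_integral do rewrite mulr1.
- by under eq_integral do rewrite mulr1.
Qed.

Lemma L2_measurable (u : L2 mu) : measurable_fun setT u.
Proof. by []. Qed.

Lemma L2_sqr_lty (u : L2 mu) : (\int[mu]_x (u x ^+ 2)%:E < +oo)%E.
Proof.
have /integrableP[_] := Lfun2_integrable_sqr (LfunP u).
by under eq_integral do rewrite /= ger0_norm ?sqr_ge0//.
Qed.

Lemma L2_integrable (u v : L2 mu) : mu.-integrable setT (fun x => (u x * v x)%:E).
Proof. by apply: integrable_mul => //; exact: L2_sqr_lty. Qed.

Lemma L2_mk (f : T -> R) : measurable_fun setT f ->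
  (\int[mu]_x (f x ^+ 2)%:E < +oo)%E -> exists u : L2 mu, u = f :> (T -> R).
Proof.
move=> mf f2.
suff H : f \in Lfun mu 2%:E by exists (Lfun_Sub (lee1n 2) H).
apply/andP; rewrite !inE/=; split => //.
rewrite /finite_norm unlock /Lnorm poweR_lty//.
under eq_integral do rewrite /= powR_mulrn// -normrX ger0_norm ?sqr_ge0//.
exact: f2.
Qed.

Lemma L2_norm_sqr (u : L2 mu) : L2_norm u ^+ 2 = L2_inner u u.
Proof.
rewrite /L2_norm /L2_inner /Rintegral -powR_mulrn ?fine_ge0 ?Lnorm_ge0//.
rewrite -fine_poweR powR_Lnorm ?pnatr_eq0//; congr fine.
by apply: eq_integral => x _; rewrite /= powR_mulrn// -expr2 real_normK// num_real.
Qed.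

Lemma L2_norm_ge0 (u : L2 mu) : 0 <= L2_norm u.
Proof. by rewrite fine_ge0// Lnorm_ge0. Qed.

Lemma L2_innerC (u v : L2 mu) : L2_inner u v = L2_inner v u.
Proof. by apply: eq_Rintegral => x _; rewrite mulrC. Qed.

Lemma L2_inner_linearl c (u v w : L2 mu) :
  L2_inner (c *: u + v) w = c * L2_inner u w + L2_inner v w.
Proof.
rewrite /L2_inner -RintegralZl//; last exact: L2_integrable.
rewrite -RintegralD//; last exact: L2_integrable.
  by apply: eq_Rintegral => x _; rewrite mulrDl mulrA.
exact: (integrableZl measurableT c (L2_integrable u w)).
Qed.

Lemma L2_inner_linearr c (u v w : L2 mu) :
  L2_inner w (c *: u + v) = c * L2_inner w u + L2_inner w v.
Proof. by rewrite L2_innerC L2_inner_linearl !(L2_innerC w). Qed.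

Lemma L2_inner_ge0 (u : L2 mu) : 0 <= L2_inner u u.
Proof. by rewrite -L2_norm_sqr sqr_ge0. Qed.

Lemma L2_inner_eq0 (u : L2 mu) : L2_inner u u = 0 -> u = 0 %[ae mu].
Proof.
move/eqP; rewrite -L2_norm_sqr sqrf_eq0 => /eqP; exact: fine_Lnormr_eq0.
Qed.

Lemma L2_inner_ae (u v w : L2 mu) : u = v %[ae mu] -> L2_inner u w = L2_inner v w.
Proof.
move=> uv; congr fine; apply: ae_eq_integral => //.
- exact: (measurable_int _ (L2_integrable u w)).
- exact: (measurable_int _ (L2_integrable v w)).
- by apply: filterS uv => x uvx Tx; rewrite uvx.
Qed.

Lemma L2_inner_diag (u : L2 mu) : (L2_inner u u)%:E = (\int[mu]_x (u x ^+ 2)%:E)%E.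
Proof.
rewrite /L2_inner /Rintegral fineK.
  by apply: eq_integral => x _; rewrite expr2.
exact: integrable_fin_num (L2_integrable u u).
Qed.

End square_integrable.

Lemma nneseries_geometric_lty (R : realType) (a : (\bar R)^nat) (K q : R) :
  0 <= q -> q < 1 -> (forall n, 0 <= a n)%E -> (forall n, a n <= (K * q ^+ n)%:E)%E ->
  (\sum_(0 <= n <oo) a n < +oo)%E.
Proof.
move=> q0 q1 a0 aK.
apply: (@le_lt_trans _ _ (\sum_(0 <= n <oo) (K * q ^+ n)%:E)%E).
  by apply: lee_nneseries => n _ //; exact: a0.
have c : (\sum_(0 <= k < n) (K * q ^+ k)%:E)%E @[n --> \oo] --> (K * (1 - q)^-1)%:E.
  under eq_fun do rewrite sumEFin.
  apply: cvg_EFin; first exact: nearW.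
  by apply: cvg_geometric_series; rewrite ger0_norm.
by rewrite (cvg_lim _ c)// ltry.
Qed.

Lemma cvg_weighted_increments (R : realType) (g : R ^nat) :
  (\sum_(0 <= m <oo) (4 ^+ m * (g m.+1 - g m) ^+ 2)%:E < +oo)%E -> cvgn g.
Proof.
set S := (\sum_(0 <= m <oo) _)%E => Soo.
have w0 m : 0 <= 4 ^+ m * (g m.+1 - g m) ^+ 2 by rewrite mulr_ge0 ?sqr_ge0// exprn_ge0.
have S0 : (0 <= S)%E by apply: nneseries_ge0 => m _ _; rewrite lee_fin w0.
have Sfin : S \is a fin_num by rewrite ge0_fin_numE.
have M0 : 0 <= fine S by exact: fine_ge0.
have DM m : `|g m.+1 - g m| <= Num.sqrt (fine S) * 2^-1 ^+ m.
  have wm : 4 ^+ m * (g m.+1 - g m) ^+ 2 <= fine S.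
    rewrite -lee_fin fineK//.
    have h : (\sum_(0 <= i < m.+1) (4 ^+ i * (g i.+1 - g i) ^+ 2)%:E <= S)%E.
      by apply: nneseries_lim_ge => n _ _; rewrite lee_fin.
    apply: le_trans h.
    by rewrite big_nat_recr//= leeDr// sume_ge0// => n _; rewrite lee_fin.
  rewrite -(ger0_norm (exprn_ge0 m (ltW _ : 0 <= 2^-1 :> R)))//.
  rewrite -!sqrtr_sqr -sqrtrM// ler_sqrt ?mulr_ge0 ?sqr_ge0//.
  rewrite -exprM mulnC exprM !exprVn ler_pdivlMr ?exprn_gt0//.
  by rewrite mulrC -natrX.
have -> : g = (fun n => g 0%N + series (telescope g) n).
  by apply/funext => n; exact: eq_sum_telescope.
apply: is_cvgD; first exact: is_cvg_cst.
apply: normed_cvg; apply: (series_le_cvg _ _ DM) => [n|n|].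
- exact: normr_ge0.
- by rewrite mulr_ge0// exprn_ge0.
- by apply: is_cvg_geometric_series; rewrite ger0_norm// invf_lt1// ltr1n.
Qed.

Section fatou_bound.
Context d (T : measurableType d) (R : realType).
Variable mu : {measure set T -> \bar R}.

Lemma fatou_le (D : set T) (f_ : nat -> T -> R) (f : T -> R) (c : \bar R) N :
  measurable D ->
  (forall n, measurable_fun D (f_ n)) -> measurable_fun D f ->
  (forall n x, D x -> 0 <= f_ n x) ->
  {ae mu, forall x, D x -> f_ n x @[n --> \oo] --> f x} ->
  (forall n, (N <= n)%N -> \int[mu]_(x in D) (f_ n x)%:E <= c)%E ->
  (\int[mu]_(x in D) (f x)%:E <= c)%E.
Proof.
move=> mD mf_ mf f0 ff fc.
pose g n x := (f_ (n + N)%N x)%:E.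
have mg n : measurable_fun D (g n) by exact/measurable_EFinP.
rewrite (@ae_eq_integral _ _ _ mu D (fun x => limn_einf (g ^~ x)))//.
- apply: le_trans (fatou mu mD mg _) _.
    by move=> n x Dx; rewrite lee_fin f0.
  rewrite limn_einf_lim; apply: lime_le; first exact: is_cvg_einfs.
  apply: nearW => n; apply: le_trans (fc (n + N)%N _); last by rewrite leq_addl.
  by apply: ereal_inf_lbound; exists n => /=.
- exact/measurable_EFinP.
- rewrite (_ : (fun x => _) = fun x => (- limn_esup ((fun n x => - g n x) ^~ x))%E)//.
  apply: measurableT_comp => //; apply: measurable_fun_limn_esup => n.
  exact: measurableT_comp.
- apply: filterS ff => x fx Dx.
  have /cvg_limn_einf_sup[->//] : g n x @[n --> \oo] --> (f x)%:E.
  apply: cvg_EFin; first exact: nearW.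
  by rewrite /comp /g /= (cvg_shiftn N (f_ ^~ x)); exact: fx.
Qed.

Lemma L2_complete (f_ : nat -> L2 mu) :
  (forall e, 0 < e -> exists N, forall i j, (N <= i)%N -> (N <= j)%N ->
     L2_inner (f_ i - f_ j) (f_ i - f_ j) < e) ->
  exists (f : L2 mu) (phi : nat -> nat),
    [/\ forall k, (k <= phi k)%N,
        {ae mu, forall x, f_ (phi m) x @[m --> \oo] --> f x} &
        forall e, 0 < e -> exists N, forall k, (N <= k)%N ->
          L2_inner (f_ k - f) (f_ k - f) <= e].
Proof.
move=> Cf.
have /choice[N_ NP] (m : nat) : exists N, forall i j, (N <= i)%N -> (N <= j)%N ->
    L2_inner (f_ i - f_ j) (f_ i - f_ j) < (8^-1) ^+ m.
  by apply: Cf; rewrite exprn_gt0// invr_gt0.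
pose phi m := (\max_(i < m.+1) N_ i + m)%N.
have phiN m : (N_ m <= phi m)%N.
  by apply: leq_trans (leq_addr _ _); exact: (leq_bigmax (ord_max : 'I_m.+1)).
have phiNS m : (N_ m <= phi m.+1)%N.
  apply: leq_trans (leq_addr _ _).
  exact: (leq_bigmax (widen_ord (leqnSn m.+1) (ord_max : 'I_m.+1))).
have phi_ge m : (m <= phi m)%N by exact: leq_addl.
pose g m : T -> R := f_ (phi m).
pose D_ m x := g m.+1 x - g m x.
have mD m : measurable_fun setT (D_ m) by exact: measurable_funB.
have D2 m : (\int[mu]_x (D_ m x ^+ 2)%:E <= ((8^-1) ^+ m)%:E)%E.
  have := NP m _ _ (phiNS m) (phiN m); rewrite -lte_fin L2_inner_diag => /ltW.
  by [].
have S_lty : (\int[mu]_x (\sum_(0 <= m <oo) (4 ^+ m * D_ m x ^+ 2)%:E) < +oo)%E.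
  rewrite integral_nneseries//; last 2 first.
  - by move=> m; apply/measurable_EFinP; apply: measurable_funM => //; exact: measurable_funX.
  - by move=> m x _; rewrite lee_fin mulr_ge0 ?sqr_ge0// exprn_ge0.
  apply: (@nneseries_geometric_lty _ _ 1 2^-1) => //.
  - by rewrite invf_lt1// ltr1n.
  - move=> m; apply: integral_ge0 => x _.
    by rewrite lee_fin mulr_ge0 ?sqr_ge0// exprn_ge0.
  - move=> m; rewrite (_ : (fun x => _) = fun x => (4 ^+ m)%:E * (D_ m x ^+ 2)%:E)%E//.
    rewrite ge0_integralZl_EFin//; last 2 first.
    + by move=> x _; rewrite lee_fin sqr_ge0.
    + by apply/measurable_EFinP; exact: measurable_funX.
    apply: (@le_trans _ _ ((4 ^+ m)%:E * ((8^-1) ^+ m)%:E)%E).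
      by apply: lee_wpmul2l (D2 m); rewrite lee_fin exprn_ge0.
    rewrite -EFinM lee_fin -exprMn mul1r (_ : 4 / 8 = 2^-1 :> R)//.
    by rewrite (_ : 8 = 4 * 2 :> R) ?invfM ?mulrA ?divff ?mul1r// -natrM.
have cvgg : {ae mu, forall x, cvgn (g ^~ x)}.
  have /integrable_ae : mu.-integrable setT
      (fun x => \sum_(0 <= m <oo) (4 ^+ m * D_ m x ^+ 2)%:E)%E.
    apply/integrableP; split.
      apply: ge0_emeasurable_sum => [m x _ _|m _].
        by rewrite lee_fin mulr_ge0 ?sqr_ge0// exprn_ge0.
      by apply/measurable_EFinP; apply: measurable_funM => //; exact: measurable_funX.
    under eq_integral => x _.
      rewrite gee0_abs; last first.
        by apply: nneseries_ge0 => m _ _; rewrite lee_fin mulr_ge0 ?sqr_ge0// exprn_ge0.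
      over.
    exact: S_lty.
  move=> /(_ measurableT); apply: filterS => x /(_ I) Sfin.
  apply: cvg_weighted_increments; rewrite -ge0_fin_numE//.
  by apply: nneseries_ge0 => m _ _; rewrite lee_fin mulr_ge0 ?sqr_ge0// exprn_ge0.
pose f x := fine (limn_esup (fun m => (g m x)%:E)).
have mf : measurable_fun setT f.
  apply: measurableT_comp => //; apply: measurable_fun_limn_esup => m.
  by apply/measurable_EFinP.
have gf : {ae mu, forall x, g m x @[m --> \oo] --> f x}.
  apply: filterS cvgg => x /cvg_ex[l gl].
  suff -> : f x = l by [].
  have /cvg_limn_einf_sup[_ E] : (g m x)%:E @[m --> \oo] --> l%:E.
    by apply: cvg_EFin => //; exact: nearW.
  by rewrite /f E.
have fatou k N e : (forall i, (N <= i)%N -> L2_inner (f_ i - f_ k) (f_ i - f_ k) <= e) ->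
    (\int[mu]_x ((f_ k x - f x) ^+ 2)%:E <= e%:E)%E.
  move=> He; apply: (@fatou_le setT (fun m x => (f_ k x - g m x) ^+ 2) _ _ N) => //.
  - by move=> m; apply: measurable_funX; exact: measurable_funB.
  - by apply: measurable_funX; exact: measurable_funB.
  - by move=> m x _; exact: sqr_ge0.
  - apply: filterS gf => x gfx _.
    rewrite expr2; under eq_fun do rewrite expr2.
    by apply: cvgM; apply: cvgB => //; exact: cvg_cst.
  - move=> m Nm; rewrite (le_trans _ (_ : (L2_inner (f_ (phi m) - f_ k) (f_ (phi m) - f_ k))%:E <= _)%E)//.
      rewrite L2_inner_diag; under eq_integral do rewrite -sqrrN opprB.
      exact: lexx.
    by rewrite lee_fin He// (leq_trans Nm).
have f2 : (\int[mu]_x (f x ^+ 2)%:E < +oo)%E.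
  have [N NH] := Cf _ ltr01.
  have [h hE] : exists h : L2 mu, h = (fun x => f_ N x - f x) :> (T -> R).
    apply: L2_mk; first exact: measurable_funB.
    apply: le_lt_trans (fatou N N 1 _) _; last by rewrite ltry.
    by move=> i Ni; apply/ltW/NH.
  rewrite (_ : f = (f_ N - h : L2 mu)); first exact: L2_sqr_lty.
  by apply/funext => x; rewrite [RHS](_ : _ = f_ N x - h x)// hE opprB addrC subrK.
have [F FE] := L2_mk mf f2.
exists F, phi; split => //; first by rewrite FE.
move=> e e0; have [N NH] := Cf _ e0; exists N => k Nk.
rewrite -lee_fin L2_inner_diag (le_trans _ (fatou k N e _))//.
  by rewrite -FE.
by move=> i Ni; apply/ltW/NH.
Qed.

End fatou_bound.

(** * Closed forms and their operators *)

(* Discriminant form of Cauchy-Schwarz. *)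
Lemma discr_le (R : realType) (A L B : R) : 0 <= A -> 0 <= B ->
  (forall t, 0 <= A + t * (2 * L) + t ^+ 2 * B) -> L ^+ 2 <= A * B.
Proof.
move=> A0 B0 H; move: B0; rewrite le_eqVlt => /predU1P[B0|B0].
  rewrite -B0 mulr0; have [->|L0] := eqVneq L 0; first by rewrite expr0n.
  have := H (- (A + 1) / (2 * L)); rewrite -B0 mulr0 addr0 -mulrA mulVf ?mulf_neq0//.
  by rewrite mulr1; lra.
have E : (A + (- L / B) * (2 * L) + (- L / B) ^+ 2 * B) * B = A * B - L ^+ 2.
  by field; rewrite gt_eqF.
by have := H (- L / B); rewrite -(ler_pM2r B0) mul0r E subr_ge0.
Qed.

Section closed_forms.
Context d (T : measurableType d) (R : realType).
Variables (mu : {measure set T -> \bar R}) (D : set (L2 mu)).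
Variable a : L2 mu -> L2 mu -> R.
Hypotheses (aeD : ae_invariant_form D a) (bilD : bilinear_on D a).
Hypotheses (symD : symmetric_on D a) (nnD : nonneg_on D a).

Let D0 : D 0. Proof. by have [] := bilD. Qed.

Let Dlin c u v : D u -> D v -> D (c *: u + v).
Proof. by have [_ H _ _] := bilD; exact: H. Qed.

Let Dsub u v : D u -> D v -> D (u - v).
Proof. by move=> Du Dv; rewrite -scaleN1r addrC; exact: Dlin. Qed.

Definition tikhonov (lam : R) (u v : L2 mu) : R := lam * a u v + L2_inner u v.

Let tikC lam u v : D u -> D v -> tikhonov lam u v = tikhonov lam v u.
Proof. by move=> Du Dv; rewrite /tikhonov symD// L2_innerC. Qed.

Let tikl lam c u v w : D u -> D v -> D w ->
  tikhonov lam (c *: u + v) w = c * tikhonov lam u w + tikhonov lam v w.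
Proof.
move=> Du Dv Dw; rewrite /tikhonov L2_inner_linearl.
have [_ _ -> // _] := bilD; ring.
Qed.

Let tikr lam c u v w : D u -> D v -> D w ->
  tikhonov lam w (c *: u + v) = c * tikhonov lam w u + tikhonov lam w v.
Proof.
move=> Du Dv Dw; rewrite tikC//; last exact: Dlin.
by rewrite tikl// !(tikC _ Dw).
Qed.

Let tik_ge0 lam u : 0 <= lam -> D u -> 0 <= tikhonov lam u u.
Proof. by move=> l0 Du; rewrite addr_ge0 ?L2_inner_ge0// mulr_ge0// nnD. Qed.

Let tik_CS lam u v : 0 <= lam -> D u -> D v ->
  tikhonov lam u v ^+ 2 <= tikhonov lam u u * tikhonov lam v v.
Proof.
move=> l0 Du Dv; apply: discr_le; [exact: tik_ge0..|] => t.
have := tik_ge0 l0 (Dlin t Dv Du).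
rewrite tikl ?tikr//; last exact: Dlin.
by rewrite (tikC _ Dv Du); congr (_ <= _); ring.
Qed.

Lemma form_norm_lt u (e : R) : 0 < e -> D u ->
  (form_norm a u < e) = (a u u + L2_inner u u < e ^+ 2).
Proof.
move=> e0 Du; rewrite /form_norm L2_norm_sqr.
have h : 0 <= a u u + L2_inner u u by rewrite addr_ge0 ?nnD ?L2_inner_ge0.
rewrite -[in RHS](sqr_sqrtr h) ltr_pXn2r// nnegrE ?sqrtr_ge0//; exact: ltW.
Qed.

Hypothesis clD : closed_form D a.

Let gap_le (m p q z : R) : m <= z -> 2 * p + 2 * q - 4 * z <= 2 * ((p - m) + (q - m)).
Proof. by move=> mz; lra. Qed.

(* The solution minimises [lam * a v v + |v - f|^2] over [D]. *)
Lemma resolvent_exists (lam : R) (f : L2 mu) : 0 < lam ->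
  exists2 u, D u & forall w, D w -> lam * a u w + L2_inner u w = L2_inner f w.
Proof.
move=> l0; have l0' := ltW l0.
pose J v := lam * a v v + L2_inner (v - f) (v - f).
have J0 v : D v -> 0 <= J v by move=> Dv; rewrite addr_ge0 ?L2_inner_ge0// mulr_ge0// nnD.
have JE v : J v = tikhonov lam v v - 2 * L2_inner f v + L2_inner f f.
  rewrite /J /tikhonov -scaleN1r addrC [v + _]addrC.
  rewrite !(L2_inner_linearl, L2_inner_linearr) (L2_innerC v f); ring.
pose S := [set J v | v in D].
have lbS : has_lbound S by exists 0 => _ [v Dv <-]; exact: J0.
have S0 : S !=set0 by exists (J 0), 0.
pose m := inf S.
have mJ v : D v -> m <= J v by move=> Dv; apply: ge_inf => //; exists v.
have /choice[v_ vP] (k : nat) : exists v, D v /\ J v < m + k.+1%:R^-1.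
  have /inf_adherent : (0:R) < k.+1%:R^-1 by rewrite invr_gt0.
  by move=> /(_ S (conj S0 lbS))[_ [v Dv <-] ?]; exists v.
have Dv k : D (v_ k) by exact: (vP k).1.
have Jexp u w t : D u -> D w -> J (t *: w + u) =
    J u + t * (2 * (tikhonov lam u w - L2_inner f w)) + t ^+ 2 * tikhonov lam w w.
  move=> Du Dw; rewrite !JE tikl ?tikr//; last exact: Dlin.
  rewrite (tikC _ Dw Du) L2_inner_linearr; ring.
have dist u w : D u -> D w -> tikhonov lam (w - u) (w - u) <=
    2 * ((J u - m) + (J w - m)).
  move=> Du Dw; have Dd := Dsub Dw Du.
  have := Jexp u (w - u) 1 Du Dd; have := Jexp u (w - u) (2^-1) Du Dd.
  have := mJ _ (Dlin (2^-1) Dd Du).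
  rewrite scale1r subrK.
  set X := tikhonov lam u (w - u) - _; set Y := tikhonov _ _ _; set Z := J (_ + _).
  move=> mZ ZE JwE; have <- : 2 * J u + 2 * J w - 4 * Z = Y by rewrite ZE JwE; field.
  exact: gap_le.
have tikn k j : tikhonov lam (v_ k - v_ j) (v_ k - v_ j) <= 2 * (k.+1%:R^-1 + j.+1%:R^-1).
  apply: (le_trans (dist _ _ (Dv _) (Dv _))).
  by rewrite ler_pM2l// addrC lerD// lerBlDl ltW//; exact: (vP _).2.
pose K := Num.max lam 1; pose l1 := Num.min lam 1.
have l10 : 0 < l1 by rewrite lt_min l0 ltr01.
have tik_ge u : D u -> l1 * (a u u + L2_inner u u) <= tikhonov lam u u.
  move=> Du; rewrite /tikhonov mulrDr lerD//.
    by rewrite ler_wpM2r ?nnD// ge_min lexx.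
  by rewrite ler_piMl ?L2_inner_ge0// ge_min lexx orbT.
have K0 : 0 < K by rewrite lt_max l0.
have tik_le u : D u -> tikhonov lam u u <= K * (a u u + L2_inner u u).
  move=> Du; rewrite /tikhonov mulrDr lerD//.
    by rewrite ler_wpM2r ?nnD// le_max lexx.
  by rewrite ler_peMl ?L2_inner_ge0// le_max lexx orbT.
have inv_small (e : R) : 0 < e -> exists N, forall k, (N <= k)%N -> k.+1%:R^-1 < e.
  move=> e0; exists (Num.truncn e^-1) => k Nk.
  rewrite invf_plt ?posrE// (lt_le_trans (truncnS_gt _))// ler_nat.
  by rewrite ltnS.
have [//||u Du ucvg] := clD (w_ := v_).
  move=> e e0.
  have [|N NP] := inv_small (l1 * e ^+ 2 / 4).
    by rewrite divr_gt0// mulr_gt0// exprn_gt0.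
  exists N => i j Ni Nj; rewrite form_norm_lt//; last exact: Dsub.
  rewrite -(ltr_pM2l l10).
  apply: le_lt_trans (tik_ge _ (Dsub (Dv _) (Dv _))) _.
  apply: le_lt_trans (tikn _ _) _.
  by move: (NP _ Ni) (NP _ Nj); move: (i.+1%:R^-1) (j.+1%:R^-1) => p q; lra.
exists u => // w Dw.
pose L := tikhonov lam u w - L2_inner f w.
suff : L = 0 by rewrite /L /tikhonov => /eqP; rewrite subr_eq0 => /eqP.
apply/eqP; rewrite -sqrf_eq0 -normr_le0 ger0_norm ?sqr_ge0//.
apply/ler_addgt0Pl => e e0; rewrite addr0.
pose B := tikhonov lam w w.
have B0 : 0 <= B by exact: tik_ge0.
pose dl := e / (2 * (1 + B) * (1 + K)).
have dl0 : 0 < dl by rewrite divr_gt0// !mulr_gt0//; lra.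
have [N1 N1P] := inv_small _ dl0.
have /cvgrPdist_lt/(_ (Num.sqrt dl)) : form_norm a (v_ k - u) @[k --> \oo] --> 0 by exact: ucvg.
rewrite sqrtr_gt0 => /(_ dl0)[N2 _ N2P].
pose k := maxn N1 N2.
have Lk : (tikhonov lam (v_ k) w - L2_inner f w) ^+ 2 <= dl * B.
  apply: le_trans (_ : _ <= (J (v_ k) - m) * B) _.
    apply: discr_le => //; first by rewrite subr_ge0 mJ.
    move=> t; have := mJ _ (Dlin t Dw (Dv k)); rewrite Jexp//; rewrite -/B; lra.
  rewrite ler_wpM2r//; move: (vP k).2 (N1P k (leq_maxl _ _)).
  by move: (k.+1%:R^-1) => p; lra.
have Lu : (tikhonov lam (v_ k - u) w) ^+ 2 <= K * dl * B.
  apply: le_trans (tik_CS l0' (Dsub (Dv k) Du) Dw) _; rewrite ler_wpM2r//.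
  apply: le_trans (tik_le _ (Dsub (Dv k) Du)) _; rewrite ler_wpM2l//; first exact: ltW.
  have := N2P k (leq_maxr _ _); rewrite /= sub0r normrN.
  rewrite ger0_norm ?sqrtr_ge0// form_norm_lt ?sqrtr_gt0//; last exact: Dsub.
  by rewrite sqr_sqrtr ?(ltW dl0)// => /ltW.
have LE : L = (tikhonov lam (v_ k) w - L2_inner f w) - tikhonov lam (v_ k - u) w.
  rewrite /L (_ : v_ k - u = -1 *: u + v_ k); last by rewrite scaleN1r addrC.
  rewrite tikl//; ring.
have e_eq : 2 * (dl * B + K * dl * B) <= e.
  rewrite (_ : 2 * _ = e * (B / (1 + B))); last first.
    by rewrite /dl; field; do ?[apply/andP; split]; rewrite gt_eqF//; lra.
  by apply: ler_piMr; [exact: ltW|rewrite ler_pdivrMr; lra].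
apply: le_trans e_eq; rewrite LE.
set X := _ - L2_inner f w in Lk *; set Y := tikhonov _ _ _ in Lu *.
have := sqr_ge0 (X + Y); nra.
Qed.

Hypothesis ddD : densely_defined D.

Let A := associated_operator D a.

Lemma associated_operator_dense : densely_defined (operator_domain A).
Proof.
move=> f e e0.
have [v Dv vf] := ddD f (e := e / 2) (divr_gt0 e0 (ltr0n _ 2)).
pose lam := (e / 2) ^+ 2 / (a v v + 1).
have av0 : 0 <= a v v by exact: nnD.
have e20 : 0 < (e / 2) ^+ 2 by rewrite exprn_gt0// divr_gt0.
have l0 : 0 < lam by rewrite divr_gt0//; lra.
have [u Du uP] := resolvent_exists v l0.
exists u.
  have [g gE] : exists g : L2 mu, g = lam^-1 *: (v - u) by exists (lam^-1 *: (v - u)).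
  exists g; split=> // w Dw; rewrite gE -[lam^-1 *: _]addr0 L2_inner_linearl.
  rewrite (_ : v - u = -1 *: u + v); last by rewrite scaleN1r addrC.
  rewrite L2_inner_linearl -uP//.
  have -> : L2_inner (0 : L2 mu) w = 0.
    by have := L2_inner_linearl 1 0 0 w; rewrite scaler0 addr0 mul1r; lra.
  by rewrite addr0 mulN1r addrC addrK mulKf// gt_eqF.
have uv : L2_norm (v - u) < e / 2.
  rewrite -(@ltr_pXn2r _ 2)// ?nnegrE ?L2_norm_ge0 ?divr_ge0 1?ltW// L2_norm_sqr.
  have vuE : v - u = -1 *: u + v by rewrite scaleN1r addrC.
  have E : lam * a u (v - u) = L2_inner (v - u) (v - u).
    rewrite [X in _ = L2_inner X _]vuE L2_inner_linearl -(uP _ (Dsub Dv Du)); ring.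
  rewrite -E vuE.
  have [_ _ _ ->//] := bilD.
  have := nnD (Dlin (- 2) Du Dv).
  have [_ _ lL lR] := bilD.
  rewrite lL// ?lR//; last exact: Dlin.
  rewrite (symD Dv Du) => q0.
  apply: (@le_lt_trans _ _ (lam * (a v v / 4))).
    by rewrite ler_pM2l//; nra.
  rewrite /lam mulrAC ltr_pdivrMr; last by lra.
  by rewrite -subr_gt0; nra.
rewrite (_ : f - u = (f - v) + (v - u)); last by rewrite addrA subrK.
apply: le_lt_trans (ler_LnormD _ _) _.
by rewrite (splitr e) ltrD.
Qed.

Lemma dense_orthogonal (h : L2 mu) :
  (forall v, D v -> L2_inner h v = 0) -> h = 0 %[ae mu].
Proof.
move=> hD; apply: L2_inner_eq0; apply/eqP; rewrite eq_le L2_inner_ge0 andbT.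
apply/ler_addgt0Pl => e e0; rewrite addr0.
have [|v Dv hv] := ddD h (e := Num.sqrt e); first by rewrite sqrtr_gt0.
have hE : L2_inner h (h - v) = L2_inner h h.
  rewrite (_ : h - v = -1 *: v + h); last by rewrite scaleN1r addrC.
  by rewrite L2_inner_linearr hD// mulr0 add0r.
have : L2_inner h (h - v) ^+ 2 <= L2_inner h h * L2_inner (h - v) (h - v).
  apply: discr_le; [exact: L2_inner_ge0..|] => t.
  have := L2_inner_ge0 (t *: (h - v) + h).
  rewrite !(L2_inner_linearl, L2_inner_linearr) (L2_innerC (h - v) h).
  by congr (_ <= _); ring.
rewrite hE -L2_norm_sqr; have := L2_norm_ge0 h; rewrite le_eqVlt => /predU1P[<- _|h0].
  by rewrite expr0n/= ltW.
rewrite expr2 ler_pM2l ?exprn_gt0// => /le_trans; apply.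
rewrite -L2_norm_sqr -[leRHS](sqr_sqrtr (ltW e0)).
by rewrite ler_pXn2r// ?nnegrE ?L2_norm_ge0 ?sqrtr_ge0// ltW.
Qed.

Lemma associated_operator_selfadjoint : selfadjoint A.
Proof.
have subE (u v : L2 mu) : u - v = -1 *: v + u by rewrite scaleN1r addrC.
split; first exact: associated_operator_dense.
- move=> u f g [Du fP] [_ gP].
  have : f - g = 0 %[ae mu].
    apply: dense_orthogonal => v Dv.
    by rewrite subE L2_inner_linearl -fP// -gP//; ring.
  by apply: filterS => x /(_ I) fg _; apply/eqP; rewrite -subr_eq0; exact/eqP.
- move=> v g; split=> [[Dv vg] u f [Du uf]|vg].
    by rewrite -uf// L2_innerC -vg// symD.
  have [w Dw wP] := resolvent_exists (v + g) (@ltr01 R).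
  have vw h : L2_inner h v = L2_inner h w.
    have [u Du uP] := resolvent_exists h (@ltr01 R).
    have Auh : A u (h - u).
      split=> // z Dz; rewrite subE L2_inner_linearl -uP//; ring.
    have := vg _ _ Auh; rewrite subE L2_inner_linearl => vgE.
    rewrite -(uP _ Dw) symD// L2_innerC (L2_innerC u) (wP _ Du).
    rewrite -[v in v + g]scale1r L2_inner_linearl.
    by rewrite (L2_innerC v u) (L2_innerC g u) (L2_innerC v h); lra.
  have vw_ae : w = v %[ae mu].
    have : L2_inner (v - w) (v - w) = 0.
      by rewrite [X in L2_inner _ X]subE L2_inner_linearr -vw; ring.
    move/L2_inner_eq0; apply: filterS => x /(_ I) E _.
    by apply/eqP; rewrite eq_sym -subr_eq0; exact/eqP.
  have [Dv avw] := aeD vw_ae Dw.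
  split=> // z Dz; rewrite -(avw _ Dz).1.
  have := wP _ Dz; rewrite -[v in v + g]scale1r L2_inner_linearl.
  by rewrite (L2_inner_ae z vw_ae); lra.
Qed.

End closed_forms.

(** * The fractional kernel *)

Section layers.
Context d (T : measurableType d) (R : realType).
Variable mu : {measure set T -> \bar R}.

Lemma layers_lty (D : set T) (h : T -> R) (F : nat -> set T) (c : nat -> R) (K q : R) :
  measurable D -> measurable_fun D h -> (forall n, measurable (F n)) ->
  D `<=` \bigcup_n F n ->
  (forall x, D x -> 0 <= h x) -> (forall n, 0 <= c n) ->
  (forall n x, D x -> F n x -> h x <= c n) ->
  0 <= q -> q < 1 ->
  (forall n, (c n)%:E * mu (F n) <= (K * q ^+ n)%:E)%E ->
  (\int[mu]_(x in D) (h x)%:E < +oo)%E.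
Proof.
move=> mD mh mF DF h0 c0 hc q0 q1 cK.
have m1 n : measurable_fun D (fun x => (c n)%:E * (\1_(F n) x)%:E)%E.
  by apply/measurable_EFinP; apply: measurable_funM => //; exact: measurable_indic.
have p1 n x : (0 <= (c n)%:E * (\1_(F n) x)%:E)%E by rewrite mule_ge0// lee_fin.
apply: (@le_lt_trans _ _
  (\int[mu]_(x in D) \sum_(0 <= n <oo) ((c n)%:E * (\1_(F n) x)%:E))%E).
  apply: ge0_le_integral => //.
  - exact/measurable_EFinP.
  - exact: ge0_emeasurable_sum.
  - move=> x Dx; have [n _ Fx] := DF _ Dx.
    have := @nneseries_lim_ge R (fun n => (c n)%:E * (\1_(F n) x)%:E)%E xpredT 0%N n.+1.
    move=> /(_ (fun k _ _ => p1 k x)); apply: le_trans.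
    rewrite big_nat_recr//= indicE mem_set// mule1.
    apply: (@le_trans _ _ (0 + (c n)%:E)%E); first by rewrite add0e lee_fin hc.
    by rewrite leeD2r// sume_ge0.
rewrite integral_nneseries//.
apply: (@nneseries_geometric_lty _ _ K q) => //.
  by move=> n; apply: integral_ge0 => x _; exact: p1.
move=> n; rewrite ge0_integralZl_EFin//; last first.
  by apply/measurable_EFinP; exact: measurable_indic.
apply: le_trans (cK n); rewrite lee_wpmul2l ?lee_fin//.
by rewrite integral_indic// measureIl.
Qed.

Let half2_powR (b r al : R) : 0 < b -> b / 2 <= r -> r <= 2 * b ->
  r `^ al <= 2 `^ `|al| * b `^ al.
Proof.
move=> b0 br rb; have r0 : 0 < r by apply: lt_le_trans br; rewrite divr_gt0.
have [a0|a0] := leP 0 al.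
  rewrite ger0_norm// -powRM ?(ltW b0)//.
  by rewrite ge0_ler_powR// nnegrE ?mulr_ge0// ltW.
rewrite ltr0_norm// -[in r `^ _](opprK al) -[in b `^ _](opprK al).
have na0 : 0 <= - al by rewrite oppr_ge0 ltW.
rewrite (powRN r) (powRN b) -ler_pdivrMr ?invr_gt0 ?powR_gt0// invrK mulrC.
rewrite ler_pdivrMr ?powR_gt0// -powRM ?(ltW r0)//.
rewrite ge0_ler_powR ?nnegrE ?(ltW b0) ?mulr_ge0 ?(ltW r0)//.
by rewrite mulrC -ler_pdivrMr.
Qed.

(* [sg] is [-1] for shells shrinking to [rho = 0] and [1] for shells growing to
   infinity. *)
Lemma dyadic_lty (D : set T) (h rho : T -> R) (C M al de sg : R) :
  measurable D -> measurable_fun D h -> measurable_fun setT rho ->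
  0 <= C -> 0 <= M ->
  (forall x, D x -> 0 <= h x) ->
  (forall x, D x -> rho x = 0 -> h x = 0) ->
  (forall x, D x -> 0 < rho x -> h x <= C * rho x `^ al) ->
  (forall r : R, (0 < r)%R -> mu (D `&` [set x | (rho x <= r)%R]) <= (M * r `^ de)%:E)%E ->
  (forall x, D x -> rho x = 0 \/ exists k : nat,
     2 `^ (sg * k%:R) / 2 <= rho x <= 2 * 2 `^ (sg * k%:R)) ->
  sg * (al + de) < 0 ->
  (\int[mu]_(x in D) (h x)%:E < +oo)%E.
Proof.
move=> mD mh mrho C0 M0 h0 hrho0 hC muM cover sgn.
pose b k : R := 2 `^ (sg * k%:R).
have b0 k : 0 < b k by rewrite powR_gt0.
pose S k : set (measurableTypeR R) := [set 0] `|` `[b k / 2, 2 * b k].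
pose F k := D `&` rho @^-1` S k.
have mF k : measurable (F k).
  apply: measurableI => //; rewrite -[X in measurable X]setTI; apply: mrho => //.
  exact: measurableU.
apply: (@layers_lty D h F (fun k => C * (2 `^ `|al| * b k `^ al))
    (C * 2 `^ `|al| * (M * 2 `^ de)) (2 `^ (sg * (al + de)))) => //.
- move=> x Dx; have [r0|[k kP]] := cover x Dx; first by exists 0%N => //; split => //; left.
  by exists k => //; split => //; right; rewrite /= in_itv.
- by move=> k; rewrite !mulr_ge0// powR_ge0.
- move=> k x Dx [_ [/= r0|/=]]; first by rewrite hrho0// !mulr_ge0// powR_ge0.
  rewrite in_itv/= => /andP[r1 r2].
  have r0 : 0 < rho x by apply: lt_le_trans r1; rewrite divr_gt0.
  by rewrite (le_trans (hC _ Dx r0))// ler_wpM2l// half2_powR.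
- rewrite /powR pnatr_eq0/= -[ltRHS]expR0 ltr_expR.
  by rewrite nmulr_rlt0// ln_gt0// ltr1n.
- move=> k.
  apply: (@le_trans _ _ ((C * (2 `^ `|al| * b k `^ al))%:E * (M * (2 * b k) `^ de)%:E)%E).
    rewrite lee_wpmul2l ?lee_fin ?mulr_ge0 ?powR_ge0//.
    apply: le_trans (muM _ _); last by rewrite mulr_gt0.
    rewrite le_measure ?inE//.
      apply: measurableI => //.
      rewrite (_ : [set x | _] = setT `&` rho @^-1` `]-oo, 2 * b k]%classic).
        by apply: mrho => //; exact: measurable_itv.
      by rewrite setTI; apply/seteqP; split=> x /=; rewrite in_itv.
    move=> x [Dx [/= r0|/= b1]]; split => //=; first by rewrite r0 mulr_ge0// ltW.
    by move: b1; rewrite in_itv/= => /andP[].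
  have E : (2 `^ (sg * (al + de))) ^+ k = b k `^ al * b k `^ de.
    rewrite -powR_mulrn ?powR_ge0// /b -!powRrM -powRD.
      by congr (_ `^ _); ring.
    by apply/implyP; rewrite pnatr_eq0.
  by rewrite -EFinM lee_fin E powRM ?(ltW (b0 k))// le_eqVlt; apply/orP; left; apply/eqP; ring.
Qed.

Lemma dyadic_infty (t : R) : 1 <= t ->
  exists k : nat, 2 `^ (1 * k%:R) / 2 <= t <= 2 * 2 `^ (1 * k%:R).
Proof.
move=> t1; have t0 : 0 <= t by exact: le_trans t1.
have m0 : (0 < Num.truncn t)%N by rewrite truncn_gt0.
exists (trunc_log 2 (Num.truncn t)); rewrite mul1r powR_mulrn//.
have /andP[h1 h2] := trunc_log_bounds (isT : (1 < 2)%N) m0.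
have /andP[h3 h4] := truncn_itv t0.
move: h1 h2; set k := trunc_log _ _ => h1 h2; apply/andP; split.
  rewrite ler_pdivrMr// (@le_trans _ _ t)//; last by rewrite ler_peMr// ler1n.
  by apply: le_trans h3; rewrite -natrX ler_nat.
rewrite -exprS (le_trans (ltW h4))// -natrX ler_nat.
by [].
Qed.

Lemma dyadic_near0 (t : R) : 0 < t -> t <= 1 ->
  exists k : nat, 2 `^ (-1 * k%:R) / 2 <= t <= 2 * 2 `^ (-1 * k%:R).
Proof.
move=> t0 t1; have [|k /andP[k1 k2]] := @dyadic_infty t^-1; first by rewrite invf_ge1.
have p0 : 0 < 2 `^ k%:R :> R by rewrite powR_gt0.
exists k; move: k1 k2; rewrite mul1r mulN1r powRN => k1 k2; apply/andP; split.
  by rewrite -invfM mulrC -[leRHS]invrK lef_pV2// posrE ?invr_gt0// mulr_gt0.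
rewrite ler_pdivlMr//; move: k1; rewrite -[t^-1]div1r ler_pdivlMr//; lra.
Qed.

End layers.

Section euclidean.
Context (R : realType) (n : nat).
Implicit Types x y z : 'rV[R]_n.
Local Notation leb := (lebesgue_rV R n).

Lemma dotv_ge0 x : 0 <= dotv x x.
Proof. by apply: sumr_ge0 => i _; rewrite -expr2 sqr_ge0. Qed.

Lemma enorm_ge0 x : 0 <= enorm x.
Proof. exact: sqrtr_ge0. Qed.

Lemma enormN x : enorm (- x) = enorm x.
Proof.
by rewrite /enorm /dotv; congr Num.sqrt; apply: eq_bigr => i _; rewrite mxE mulrNN.
Qed.

Lemma coord_le_enorm x i : `|x ord0 i| <= enorm x.
Proof.
rewrite -sqrtr_sqr ler_sqrt ?dotv_ge0// /dotv (bigD1 i)//= -expr2 lerDl.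
by apply: sumr_ge0 => j _; rewrite -expr2 sqr_ge0.
Qed.

Lemma norm_le_enorm x : `|x| <= enorm x.
Proof.
rewrite [leLHS]/Num.norm/= mx_normrE; apply/bigmax_leP; split; first exact: enorm_ge0.
by move=> -[i j] _ /=; rewrite (ord1 i) coord_le_enorm.
Qed.

Lemma norm_gt0_coord x (r : R) : 0 < r -> (forall i, `|x ord0 i| <= r) <-> `|x| <= r.
Proof.
move=> r0; rewrite [X in _ <-> is_true (X <= _)]/Num.norm/= mx_normrE; split.
  by move=> H; apply/bigmax_leP; split; [exact: ltW|move=> -[i j] _/=; rewrite (ord1 i)].
by move=> /bigmax_leP[_ H] i; exact: (H (ord0, i)).
Qed.

Lemma measurable_coord d (T : measurableType d) (f : T -> 'rV[R]_n) i :
  measurable_fun setT f -> measurable_fun setT (fun t => f t ord0 i).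
Proof. by move=> mf; apply: (measurableT_comp (measurable_coord_rV i)). Qed.

Lemma measurable_fun_rVB d (T : measurableType d) (f g : T -> 'rV[R]_n) :
  measurable_fun setT f -> measurable_fun setT g ->
  measurable_fun setT (fun t => f t - g t).
Proof.
move=> mf mg; apply: measurable_fun_rVP => i; under eq_fun do rewrite !mxE.
by apply: measurable_funB; exact: measurable_coord.
Qed.

Lemma measurable_enorm : measurable_fun setT (@enorm R n).
Proof.
rewrite /enorm (_ : (fun x => _) = (fun t => t `^ 2^-1) \o (fun x => dotv x x)); last first.
  by apply/funext => x /=; rewrite powR12_sqrt// dotv_ge0.
apply: measurableT_comp; first exact: measurable_powR.
by rewrite /dotv; apply: measurable_sum => i; apply: measurable_funM; exact: measurable_coord_rV.
Qed.

Lemma measurable_frac_kernel s d (T : measurableType d) (f g : T -> 'rV[R]_n) :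
  measurable_fun setT f -> measurable_fun setT g ->
  measurable_fun setT (fun t => frac_kernel s (f t) (g t)).
Proof.
move=> mf mg; rewrite /frac_kernel; under eq_fun do rewrite -powRN.
apply: (measurableT_comp (measurable_powR _)).
apply: (measurableT_comp measurable_enorm).
exact: measurable_fun_rVB.
Qed.

Lemma continuous_measurable_rV (f : 'rV[R]_n -> R) :
  continuous f -> measurable_fun setT f.
Proof.
move=> cf; apply: (measurability _ (RGenOInfty.measurableE R)) => _ [_ [r ->] <-].
rewrite setTI; apply: open_measurable_rV.
by apply: open_comp => [x _|]; [exact: cf|exact: interval_open].
Qed.

Lemma measurable_norm_rV : measurable_fun setT (fun x : 'rV[R]_n => `|x|).
Proof. by apply: continuous_measurable_rV; exact: norm_continuous. Qed.

Lemma lebesgue_cube (r : R) : 0 < r ->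
  leb [set x | `|x| <= r] = ((2 * r) ^+ n)%:E.
Proof.
move=> r0.
have -> : [set x : 'rV[R]_n | `|x| <= r] =
    [set x | forall i, (`[- r, r]%classic : set (measurableTypeR R)) (x ord0 i)].
  apply/seteqP; split=> x /=.
    by move=> /norm_gt0_coord-/(_ r0) H i; rewrite in_itv/= -ler_norml.
  by move=> H; apply/norm_gt0_coord => // i; have := H i; rewrite in_itv/= ler_norml.
rewrite (@lebesgue_rV_box R n (fun=> `[- r, r]%classic))//.
rewrite (eq_bigr (fun=> (2 * r)%:E)) => [|i _].
  by rewrite prodEFin prodr_const card_ord.
rewrite lebesgue_measure_itv/= lte_fin gtrN// -EFinB opprK; congr EFin; ring.
Qed.

Lemma frac_kernel_ge0 s x y : 0 <= frac_kernel s x y.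
Proof. by rewrite invr_ge0 powR_ge0. Qed.

Lemma frac_kernelC s x y : frac_kernel s x y = frac_kernel s y x.
Proof. by rewrite /frac_kernel -enormN opprB. Qed.

Lemma frac_kernel_le s x y (r : R) : 0 <= n%:R + 2 * s -> 0 < r -> r <= `|x - y| ->
  frac_kernel s x y <= r `^ (- (n%:R + 2 * s)).
Proof.
move=> p0 r0 rxy; have e0 : 0 < enorm (x - y) by apply: lt_le_trans (norm_le_enorm _); exact: lt_le_trans rxy.
rewrite powRN lef_pV2 ?posrE ?powR_gt0//.
apply: ge0_ler_powR; rewrite ?nnegrE ?enorm_ge0 ?(ltW r0)//.
exact: le_trans rxy (norm_le_enorm _).
Qed.

Lemma lipschitz_kernel_lty s (L : R) : (0 < n)%N -> 0 < s -> s < 1 -> 0 <= L ->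
  (\int[leb]_z (Num.min 1 (L * `|z|) ^+ 2 * frac_kernel s z 0)%:E < +oo)%E.
Proof.
move=> n0 s0 s1 L0.
pose p := n%:R + 2 * s.
have p0 : 0 < p by rewrite addr_gt0 ?ltr0n// mulr_gt0.
pose h z := Num.min 1 (L * `|z|) ^+ 2 * frac_kernel s z 0.
have mh : measurable_fun setT h.
  apply: measurable_funM.
    apply: measurable_funX; apply: measurable_minr => //.
    by apply: measurable_funM => //; exact: measurable_norm_rV.
  exact: measurable_frac_kernel.
have h0 z : 0 <= h z by rewrite mulr_ge0 ?sqr_ge0 ?frac_kernel_ge0.
have mB (P : R -> Prop) : measurable [set t : measurableTypeR R | P t] -> measurable [set z : 'rV[R]_n | P `|z|].
  by move=> mP; rewrite -[X in measurable X]setTI; apply: measurable_norm_rV.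
pose A : set 'rV[R]_n := [set z | `|z| <= 1].
have mA : measurable A by apply: (mB (fun t => t <= 1)); rewrite -set_itvNyc; exact: measurable_itv.
have cube r : 0 < r -> (leb [set z | (`|z| <= r)%R] <= (2 ^+ n * r `^ n%:R)%:E)%E.
  by move=> r0; rewrite lebesgue_cube// exprMn powR_mulrn// ltW.
have cubeI (B : set 'rV[R]_n) r : measurable B -> 0 < r ->
    (leb (B `&` [set z | (`|z| <= r)%R]) <= (2 ^+ n * r `^ n%:R)%:E)%E.
  move=> mB' r0; apply: le_trans (cube _ r0); apply: measureIr => //.
  by apply: (mB (fun t => t <= r)); rewrite -set_itvNyc; exact: measurable_itv.
have kz z : 0 < `|z| -> frac_kernel s z 0 <= `|z| `^ (- p).
  by move=> z0; rewrite frac_kernel_le ?subr0// ltW.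
rewrite -(setUv A) ge0_integral_setU//; last 4 first.
- exact: measurableC.
- by apply/measurable_EFinP; exact: measurable_funTS.
- by move=> z _; rewrite lee_fin h0.
- by apply/disj_set2P; rewrite setICr.
rewrite lte_add_pinfty//.
- apply: (@dyadic_lty _ _ _ leb A h (fun z => `|z|) (L ^+ 2) (2 ^+ n) (2 - p) n%:R (-1)) => //.
  + exact: measurable_funTS.
  + exact: measurable_norm_rV.
  + exact: sqr_ge0.
  + by move=> z _ z0; rewrite /h z0 mulr0 min_r// expr0n mul0r.
  + move=> z _ z0; rewrite /h powRD ?(gt_eqF z0) ?implybT//.
    rewrite mulrA ler_pM ?sqr_ge0 ?frac_kernel_ge0//; last exact: kz.
    rewrite powR_mulrn// -exprMn ler_pXn2r ?nnegrE ?ge_min ?lexx ?orbT//.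
      by rewrite le_min ler01 mulr_ge0.
    by rewrite mulr_ge0.
  + by move=> r r0; exact: cubeI.
  + move=> z Az; have := normr_ge0 z; rewrite le_eqVlt => /predU1P[<-|z0]; first by left.
    by right; exact: dyadic_near0.
  + by rewrite /p; lra.
- apply: (@dyadic_lty _ _ _ leb (~` A) h (fun z => `|z|) 1 (2 ^+ n) (- p) n%:R 1) => //.
  + exact: measurableC.
  + exact: measurable_funTS.
  + exact: measurable_norm_rV.
  + by move=> z _ z0; rewrite /h z0 mulr0 min_r// expr0n mul0r.
  + move=> z _ z0; rewrite /h ler_pM ?sqr_ge0 ?frac_kernel_ge0//; last exact: kz.
    by rewrite expr_le1 ?ge_min ?lexx// le_min ler01 mulr_ge0.
  + by move=> r r0; apply: cubeI => //; exact: measurableC.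
  + move=> z /negP; rewrite -ltNge => /ltW z1; right; exact: dyadic_infty.
  + by rewrite /p; lra.
Qed.

End euclidean.

(** * The normalisation constant *)

Section gamma.
Context (R : realType).
Local Notation mu := (@lebesgue_measure R).

Let g (t r : R) := r `^ (t - 1) * expR (- r).

Let mg t : measurable_fun setT (g t).
Proof.
apply: measurable_funM; first exact: measurable_powR.
by apply: measurableT_comp => //; exact: measurableT_comp.
Qed.

Let g_ge0 t r : 0 <= g t r.
Proof. by rewrite mulr_ge0 ?powR_ge0 ?expR_ge0. Qed.

Let exp_decay (t r : R) : 0 < t -> 1 <= r ->
  g t r <= (Num.truncn (t + 1)).+1%:R ^+ (Num.truncn (t + 1)).+1 * r `^ (-2).
Proof.
move=> t0 r1; set m := (Num.truncn (t + 1)).+1.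
have r0 : 0 < r by exact: lt_le_trans r1.
have m0 : 0 < m%:R :> R by rewrite ltr0n.
rewrite -[leLHS](mulfK (lt0r_neq0 (powR_gt0 2 r0))) -powRN ler_wpM2r ?powR_ge0//.
rewrite /g mulrAC -powRD ?(gt_eqF r0) ?implybT//.
rewrite expRN ler_pdivrMr ?expR_gt0//.
apply: (@le_trans _ _ (r `^ m%:R)).
  by rewrite ler_powR// (_ : t - 1 + 2 = t + 1); [exact/ltW/truncnS_gt|ring].
rewrite powR_mulrn ?(ltW r0)// -[r in r ^+ m](mulfVK (lt0r_neq0 m0)) mulrC exprMn.
rewrite ler_pM2l ?exprn_gt0//.
apply: (@le_trans _ _ (expR (r / m%:R) ^+ m)).
  rewrite ler_pXn2r ?nnegrE ?expR_ge0 ?divr_ge0 ?(ltW r0)//.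
  by apply: le_trans (expR_ge1Dx _); rewrite lerDr.
by rewrite -expRM_natl -mulrC divfK// gt_eqF.
Qed.

Let cover_itv : [set` `]0, 1]] `|` [set` `]1, +oo[] = [set` `]0, +oo[] :> set R.
Proof. by rewrite -itv_bndbnd_setU// bnd_simp. Qed.

Lemma Gamma_lty (t : R) : 0 < t ->
  (\int[mu]_(r in `]0%R, +oo[) (r `^ (t - 1) * expR (- r))%:E < +oo)%E.
Proof.
move=> t0; rewrite -/(g t) -cover_itv.
have mgD D : measurable_fun D (EFin \o g t) by apply/measurable_EFinP; exact: measurable_funTS.
have itv0 (r : R) : 0 < r -> mu `[0, r]%classic = r%:E.
  by move=> r0; rewrite lebesgue_measure_itv/= lte_fin r0 oppr0 adde0.
have mr (r : R) : measurable [set x : measurableTypeR R | x <= r].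
  by rewrite -set_itvNyc; exact: measurable_itv.
have muD (D : set (measurableTypeR R)) r : measurable D -> D `<=` [set x | 0 <= x] -> 0 < r ->
    (mu (D `&` [set x | (x <= r)%R]) <= (1 * r `^ 1)%:E)%E.
  move=> mD D0 r0; rewrite mul1r powRr1 ?(ltW r0)// -itv0//.
  apply: le_measure; rewrite ?inE//; first exact: measurableI.
  by move=> x [/D0/= x0 /= xr]; rewrite /= in_itv/= x0.
rewrite ge0_integral_setU//.
- rewrite lte_add_pinfty//.
  + apply: (@dyadic_lty _ _ _ mu `]0, 1]%classic (g t) id 1 1 (t - 1) 1 (-1)) => //.
    * exact: (measurable_funTS (mg t)).
    * by move=> x; rewrite /= in_itv/= => /andP[x0 _] xE; rewrite xE ltxx in x0.
    * by move=> x _ x0; rewrite mul1r ler_piMr ?powR_ge0// -expR0 ler_expR oppr_le0 ltW.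
    * move=> r r0; apply: muD => // x; rewrite /= in_itv/= => /andP[/ltW]//.
    * by move=> x; rewrite /= in_itv/= => /andP[x0 x1]; right; exact: dyadic_near0.
    * lra.
  + apply: (@dyadic_lty _ _ _ mu `]1, +oo[%classic (g t) id
      ((Num.truncn (t + 1)).+1%:R ^+ (Num.truncn (t + 1)).+1) 1 (-2) 1 1) => //.
    * exact: (measurable_funTS (mg t)).
    * by move=> x; rewrite /= in_itv/= andbT => x1 xE; move: x1; rewrite xE ltNge ler01.
    * by move=> x; rewrite /= in_itv/= andbT => /ltW x1 _; exact: exp_decay.
    * move=> r r0; apply: muD => // x; rewrite /= in_itv/= andbT => x1.
      by rewrite ltW// (lt_trans ltr01).
    * by move=> x; rewrite /= in_itv/= andbT => /ltW x1; right; exact: dyadic_infty.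
- exact: mgD.
- by move=> x _; rewrite lee_fin; exact: g_ge0.
- apply/disj_setPS => x [/=]; rewrite !in_itv/= => /andP[_ x1]; rewrite andbT.
  by rewrite ltNge x1.
Qed.

Lemma Gamma_gt0 (t : R) : 0 < t -> 0 < Gamma t.
Proof.
move=> t0; have G_lty := Gamma_lty t0.
have G0 : (0 <= \int[mu]_(r in `]0%R, +oo[) (g t r)%:E)%E.
  by apply: integral_ge0 => r _; rewrite lee_fin.
rewrite /Gamma /Rintegral fine_gt0// G_lty andbT lt_neqAle G0 andbT.
apply/negP => /eqP G_eq0.
pose D : set (measurableTypeR R) := `]0, +oo[%classic.
have mD : measurable D by exact: measurable_itv.
have mgD : measurable_fun D (EFin \o g t).
  by apply/measurable_EFinP; exact: (measurable_funTS (mg t)).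
have [|N [mN N0 DN]] := (ae_eq_integral_abs mu mD mgD).1.
  rewrite [RHS]G_eq0; apply: eq_integral => r _; rewrite gee0_abs//.
  by rewrite lee_fin.
have : (mu `]0%R, +oo[%classic <= mu N)%E.
  apply: le_measure; rewrite ?inE// => r /= r0; apply: DN => /= /(_ r0) [].
  move: r0; rewrite in_itv/= andbT => r0; apply/eqP; rewrite gt_eqF//.
  by rewrite mulr_gt0 ?powR_gt0 ?expR_gt0.
by rewrite N0 lebesgue_measure_itv/= ltry.
Qed.

Lemma Cns_gt0 (n : nat) (s : R) : 0 < s -> s < 1 -> 0 < Cns n s.
Proof.
move=> s0 s1; rewrite /Cns divr_gt0// !mulr_gt0 ?powR_gt0 ?pi_gt0// Gamma_gt0//.
  by rewrite divr_gt0// ltr_wpDr// mulr_gt0.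
by rewrite subr_gt0.
Qed.

End gamma.

(** * Translation invariance and the boundary *)

Section translation.
Context (R : realType).

Let shift1 (a : R) : measurableTypeR R -> measurableTypeR R := fun x => x + a.

Let measurable_shift1 a : measurable_fun setT (shift1 a).
Proof. by apply: measurable_funD. Qed.

Lemma lebesgue_measure_shift (a : R) (A : set (measurableTypeR R)) : measurable A ->
  lebesgue_measure ((fun x : measurableTypeR R => x + a) @^-1` A) = lebesgue_measure A.
Proof.
move=> mA; rewrite -[LHS]/(pushforward lebesgue_measure (shift1 a) A).
apply/esym/lebesgue_measure_unique => //= _ [[b c]] _ <-.
rewrite /pushforward (_ : _ @^-1` _ = `](b - a), (c - a)]%classic); last first.
  by apply/seteqP; split=> x /=; rewrite !in_itv/= ltrBlDr lerBrDr.
rewrite !lebesgue_measure_itv/= !lte_fin ltrD2r; case: ifPn => // _.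
by rewrite -!EFinB; congr EFin; ring.
Qed.

Lemma lebesgue_rV_shift n (v : 'rV[R]_n) (A : set 'rV[R]_n) : measurable A ->
  lebesgue_rV R n ((fun x => x + v) @^-1` A) = lebesgue_rV R n A.
Proof.
elim: n v A => [v A mA|n IH v A mA].
  by congr (lebesgue_rV _ _ _); apply/funext => x; rewrite /preimage/= [x + v]thinmx0 [x in RHS]thinmx0.
pose sh (p : measurableTypeR R * 'rV[R]_n) : measurableTypeR R * 'rV[R]_n :=
  (shift1 (v ord0 ord0) p.1, p.2 + \row_i v ord0 (lift ord0 i)).
have msh : measurable_fun setT sh.
  apply: measurable_fun_pair => /=.
    exact: (measurableT_comp (@measurable_shift1 _)).
  apply: measurable_fun_rVP => i; under eq_fun do rewrite mxE.
  by apply: measurable_funD => //; apply: measurable_coord; exact: measurable_snd.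
have mc B : measurable B -> measurable (@cons_rV R n @^-1` B).
  by move=> mB; rewrite -[X in measurable X]setTI; exact: measurable_cons_rV.
rewrite /= /lebesgue_rV_step /pushforward.
rewrite (_ : _ @^-1` _ = sh @^-1` (@cons_rV R n @^-1` A)); last first.
  apply/funext => -[b w]; rewrite /preimage/=; congr (A _).
  apply/rowP => i; rewrite mxE /=; case: (unliftP ord0 i) => [j|] ->.
    by rewrite !cons_rVS !mxE.
  by rewrite !cons_rV0.
rewrite -[LHS]/(pushforward (lebesgue_measure \x lebesgue_rV R n)%E sh (@cons_rV R n @^-1` A)).
apply/esym/product_measure_unique => //; last exact: mc.
move=> B C mB mC; rewrite /= /pushforward.
rewrite (_ : _ @^-1` _ = (shift1 (v ord0 ord0) @^-1` B) `*` ((fun x => x + \row_i v ord0 (lift ord0 i)) @^-1` C)) //.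
have mB' : measurable (shift1 (v ord0 ord0) @^-1` B).
  by rewrite -[X in measurable X]setTI; exact: measurable_shift1.
have mC' : measurable ((fun x : 'rV[R]_n => x + \row_i v ord0 (lift ord0 i)) @^-1` C).
  rewrite -[X in measurable X]setTI.
  suff : measurable_fun setT (fun x : 'rV[R]_n => x + \row_i v ord0 (lift ord0 i)) by apply.
  apply: measurable_fun_rVP => i; under eq_fun do rewrite mxE.
  by apply: measurable_funD => //; exact: measurable_coord_rV.
rewrite product_measure1E//; congr (_ * _)%E; last exact: IH.
exact: lebesgue_measure_shift.
Qed.

End translation.

Section translated_integral.
Context (R : realType) (n : nat).
Local Notation leb := (lebesgue_rV R n).

Lemma measurable_shift_rV (v : 'rV[R]_n) : measurable_fun setT (fun x : 'rV[R]_n => x + v).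
Proof.
apply: measurable_fun_rVP => i; under eq_fun do rewrite mxE.
by apply: measurable_funD => //; exact: measurable_coord_rV.
Qed.

Lemma ge0_integral_shift (v : 'rV[R]_n) (f : 'rV[R]_n -> \bar R) :
  measurable_fun setT f -> (forall x, 0 <= f x)%E ->
  (\int[leb]_x f (x + v)%R = \int[leb]_x f x)%E.
Proof.
move=> mf f0.
transitivity (\int[pushforward leb (fun x : 'rV[R]_n => x + v)%R]_x f x)%E.
  by rewrite ge0_integral_pushforward//; exact: measurable_shift_rV.
apply: eq_measure_integral; first exact: measurable_shift_rV.
by move=> mv A mA _; exact: lebesgue_rV_shift.
Qed.

Lemma negligible_graph (e : 'rV[R]_n) (phi : 'rV[R]_n -> R) :
  measurable_fun setT phi -> (forall x t, phi (x + t *: e) = phi x + t) ->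
  leb [set x | phi x = 0] = 0%E.
Proof.
move=> mphi phiE.
pose A : set ('rV[R]_n * measurableTypeR R) := [set z | phi z.1 + z.2 = 0].
have mA : measurable A.
  have mf : measurable_fun setT (fun z : 'rV[R]_n * measurableTypeR R => phi z.1 + z.2).
    apply: measurable_funD; last exact: measurable_snd.
    exact: (measurableT_comp mphi measurable_fst).
  by rewrite -[X in measurable X]setTI; exact: (mf measurableT [set 0]).
have mG : measurable [set x | phi x = 0].
  by rewrite -[X in measurable X]setTI; exact: (mphi measurableT [set 0]).
have mI : measurable_fun setT (fun z => (\1_A z)%:E : \bar R).
  by apply/measurable_EFinP; exact: measurable_indic.
have H : (0 = \int[@lebesgue_measure R]_y leb [set x | phi x = 0%R])%E.
  transitivity (\int[leb]_x \int[@lebesgue_measure R]_y (\1_A (x, y))%:E)%E.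
    rewrite [RHS]integral0_eq// => x _.
    rewrite (_ : (fun y => _) = (fun y : R => (\1_[set (- phi x)] y)%:E)).
      by rewrite integral_indic// setIT; exact: lebesgue_measure_set1.
    apply/funext => y; rewrite !indicE; congr ((nat_of_bool _)%:R%:E).
    apply/idP/idP; rewrite !inE /A/=; first by move/eqP; rewrite addrC addr_eq0 => /eqP.
    by move=> ->; rewrite addrN.
  rewrite (fubini_tonelli (fun z => (\1_A z)%:E) mI); last by move=> z; rewrite lee_fin.
  apply: eq_integral => t _.
  have mGt : measurable ((fun x : 'rV[R]_n => x + t *: e) @^-1` [set x | phi x = 0]).
    by rewrite -[X in measurable X]setTI; exact: measurable_shift_rV.
  rewrite -(lebesgue_rV_shift (t *: e) mG) -[X in leb X]setIT -integral_indic//.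
  apply: eq_integral => x _; rewrite !indicE; congr ((nat_of_bool _)%:R%:E).
  by apply/idP/idP; rewrite !inE /A/= phiE.
have muT : @lebesgue_measure R [set: R] = +oo%E.
  by rewrite -set_itvNyy lebesgue_measure_itv.
have /esym/eqP : (0 = leb [set x | phi x = 0%R] * @lebesgue_measure R [set: R])%E.
  by rewrite -integral_cst.
by rewrite mule_eq0 muT orbF => /eqP.
Qed.

Lemma dotvDl (x y z : 'rV[R]_n) : dotv (x + y) z = dotv x z + dotv y z.
Proof. by rewrite /dotv -big_split/=; apply: eq_bigr => i _; rewrite mxE mulrDl. Qed.

Lemma dotvZl a (x y : 'rV[R]_n) : dotv (a *: x) y = a * dotv x y.
Proof. by rewrite /dotv mulr_sumr; apply: eq_bigr => i _; rewrite mxE mulrA. Qed.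

Lemma dotvC (x y : 'rV[R]_n) : dotv x y = dotv y x.
Proof. by apply: eq_bigr => i _; rewrite mulrC. Qed.

Lemma dotvB (x y z : 'rV[R]_n) : dotv (x - y) z = dotv x z - dotv y z.
Proof. by rewrite dotvDl -scaleN1r dotvZl mulN1r. Qed.

Lemma enorm1_dotv (e : 'rV[R]_n) : enorm e = 1 -> dotv e e = 1.
Proof. by move=> e1; rewrite -(sqr_sqrtr (dotv_ge0 e)) -/(enorm e) e1 expr1n. Qed.

Lemma enorm_proj (e x : 'rV[R]_n) : enorm e = 1 ->
  enorm (x - dotv x e *: e) <= enorm x.
Proof.
move=> /enorm1_dotv e1; rewrite ler_sqrt ?dotv_ge0//.
rewrite dotvB dotvZl ![dotv _ (x - _)]dotvC !dotvB !dotvZl e1 (dotvC e x) mulr1 subrr mulr0 subr0.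
by rewrite gerBl -expr2 sqr_ge0.
Qed.

Lemma dotv_le_norm (x e : 'rV[R]_n) : enorm e = 1 -> `|dotv x e| <= n%:R * `|x|.
Proof.
move=> e1; rewrite (le_trans (ler_norm_sum _ _ _))//.
rewrite (_ : n%:R * `|x| = \sum_(i < n) `|x|); last by rewrite sumr_const card_ord mulr_natl.
apply: ler_sum => i _; rewrite normrM -[leRHS]mulr1 ler_pM//.
  by rewrite [leRHS]/Num.norm/= mx_normrE; apply/bigmax_geP; right; exists (ord0, i).
by rewrite -e1 coord_le_enorm.
Qed.

Lemma enorm_le_norm (x : 'rV[R]_n) : enorm x <= n%:R * `|x|.
Proof.
rewrite -(@ler_pXn2r _ 2)// ?nnegrE ?enorm_ge0 ?mulr_ge0// sqr_sqrtr ?dotv_ge0//.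
apply: (@le_trans _ _ (\sum_(i < n) `|x| ^+ 2)).
  apply: ler_sum => i _; rewrite -expr2 -real_normK ?num_real// ler_pXn2r ?nnegrE//.
  by rewrite [leRHS]/Num.norm/= mx_normrE; apply/bigmax_geP; right; exists (ord0, i).
rewrite sumr_const card_ord exprMn -[leLHS]mulr_natl ler_wpM2r ?sqr_ge0//.
by rewrite -natrX ler_nat; case: (posnP n) => [->//|n0]; rewrite expnS expn1 leq_pmull.
Qed.

Lemma lipschitz_continuous_rV (f : 'rV[R]_n -> R) (K : R) :
  (forall x y, `|f x - f y| <= K * `|x - y|) -> continuous f.
Proof.
move=> fK x; have FF : Filter (nbhs x) by exact: nbhs_filter.
apply/cvgrPdist_lt => e e0.
have K0 : 0 < `|K| + 1 by rewrite ltr_wpDl.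
suff : nbhs x [set y | `|f x - f y| < e] by [].
apply/nbhs_ballP; exists (e / (`|K| + 1)) => /=; first exact: divr_gt0.
move=> y; rewrite -ball_normE /= => xy; apply: (le_lt_trans (fK x y)).
apply: (@le_lt_trans _ _ ((`|K| + 1) * `|x - y|)).
  by rewrite ler_wpM2r// (le_trans (ler_norm K))// lerDl.
by rewrite mulrC -ltr_pdivlMr.
Qed.

Lemma coord_continuous_rV i : continuous (fun z : 'rV[R]_n => z ord0 i).
Proof.
apply: (@lipschitz_continuous_rV _ 1) => y z.
rewrite mul1r (_ : y ord0 i - z ord0 i = (y - z) ord0 i) ?mxE//.
rewrite [leRHS]/Num.norm/= mx_normrE; apply/bigmax_geP; right; exists (ord0, i) => //=.
by rewrite !mxE.
Qed.

Lemma continuous_enorm : continuous (@enorm R n).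
Proof.
move=> x; apply: continuous_comp; last exact: sqrt_continuous.
rewrite /dotv; apply: continuous_big; first exact: add_continuous.
by move=> i _ z; apply: continuousM; exact: coord_continuous_rV.
Qed.

Lemma compact_negligible (K : set 'rV[R]_n) : compact K ->
  (forall p, K p -> exists2 U, nbhs p U & leb.-negligible (K `&` U)) ->
  leb.-negligible K.
Proof.
move=> cK loc; apply: contrapT => NK.
pose F : set_system 'rV[R]_n := [set A | leb.-negligible (K `\` A)].
have FF : ProperFilter F.
  split; first by rewrite /F /= setD0.
  split.
  - by rewrite /F /= setDT; exact: negligible_set0.
  - by move=> A B FA FB; rewrite /F /= setDIr; exact: negligibleU.
  - move=> A B AB; apply: negligibleS; exact: setDS.
have [|p [Kp clp]] := cK F FF.
  by rewrite /F /= setDv; exact: negligible_set0.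
have [U pU KU] := loc _ Kp.
have [|x [/= nUx Ux]] := clp (~` U) U _ pU; last exact: nUx.
by rewrite /F /= setDE setCK.
Qed.

End translated_integral.

Section lipschitz_boundary.
Context (R : realType) (n : nat) (Om : set 'rV[R]_n).
Local Notation leb := (lebesgue_rV R n).

Lemma lipschitz_boundary_null : open Om -> bounded_set Om ->
  lipschitz_boundary Om -> leb (closure Om `\` Om) = 0%E.
Proof.
move=> oOm bOm lip.
have mB : measurable (closure Om `\` Om).
  apply: measurableD; last exact: open_measurable_rV.
  rewrite -[closure Om]setCK; apply: measurableC; apply: open_measurable_rV.
  by apply: closed_openC; exact: closed_closure.
apply: measure_negligible => //; apply: compact_negligible.
  have clB : bounded_set (closure Om `\` Om).
    have [M [Mr MO]] := bOm; exists (M + 1); split; first by rewrite realD.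
    move=> N MN x [clx _].
    have : closed [set x : 'rV[R]_n | `|x| <= N].
      rewrite (_ : [set _ | _] = (fun x : 'rV[R]_n => `|x|) @^-1` [set t | t <= N])//.
      by apply: closed_comp; [move=> y _; exact: norm_continuous|exact: closed_le].
    apply; apply: closure_subset clx => y Oy; apply: MO => //.
    by apply: le_lt_trans MN; rewrite lerDl.
  apply: bounded_closed_compact => //.
  rewrite setDE; apply: closedI; first exact: closed_closure.
  exact: open_closedC.
move=> p Bp.
have [|r [L [e [g [r0 e1 gL gE]]]]] := lip p.
  by rewrite (interior_id Om).1.
pose P (x : 'rV[R]_n) := x - dotv x e *: e.
have Pe x : dotv (P x) e = 0 by rewrite dotvB dotvZl enorm1_dotv// mulr1 subrr.
pose phi x := dotv x e - g (P x).
have cphi : continuous phi.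
  apply: (@lipschitz_continuous_rV R n phi (n%:R + `|L| * n%:R)) => x y.
  rewrite (_ : phi x - phi y = dotv (x - y) e + (g (P y) - g (P x))); last first.
    by rewrite /phi dotvB; ring.
  rewrite mulrDl (le_trans (ler_normD _ _))// lerD//; first exact: dotv_le_norm.
  rewrite (le_trans (gL _ _ (Pe _) (Pe _)))// -mulrA.
  rewrite (_ : P y - P x = - ((x - y) - dotv (x - y) e *: e)); last first.
    by rewrite /P dotvB scalerBl; apply/rowP => i; rewrite !mxE; ring.
  rewrite enormN; apply: (@le_trans _ _ (`|L| * enorm (x - y - dotv (x - y) e *: e))).
    by rewrite ler_wpM2r ?enorm_ge0// ler_norm.
  rewrite ler_wpM2l//; apply: le_trans (enorm_le_norm _); exact: enorm_proj.
pose U : set 'rV[R]_n := [set x | enorm (x - p) < r].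
have oU : open U.
  rewrite (_ : U = (fun x => enorm (x - p)) @^-1` [set t | t < r])//.
  apply: open_comp => [x _|]; last exact: open_lt.
  apply: continuous_comp; last exact: continuous_enorm.
  by apply: (continuousB (f := id) (g := cst p)); [exact: cvg_id|exact: cst_continuous].
exists U.
  apply: open_nbhs_nbhs; split => //.
  by rewrite /U /= subrr /enorm /dotv big1 ?sqrtr0// => i _; rewrite mxE mul0r.
have G0 : leb [set x | phi x = 0] = 0%E.
  apply: (@negligible_graph R n e); first exact: continuous_measurable_rV.
  move=> x t; rewrite /phi dotvDl dotvZl enorm1_dotv// mulr1.
  rewrite (_ : P (x + t *: e) = P x); first by rewrite addrAC.
  by rewrite /P dotvDl dotvZl enorm1_dotv// mulr1 scalerDl opprD addrACA subrr addr0.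
apply: (@negligibleS _ _ _ leb [set x | phi x = 0]); last first.
  apply/negligibleP => //; rewrite -[X in measurable X]setTI.
  exact: (continuous_measurable_rV cphi measurableT (measurable_set1 0)).
move=> x [[clx nOx] Ux]; apply/eqP; rewrite eq_le !leNgt; apply/andP; split; apply/negP.
  by move=> phx; apply/nOx/(gE _ Ux); rewrite -subr_gt0.
move=> phx; have [|y [Oy [/= Uy phy]]] := clx (U `&` [set y | phi y < 0]).
  apply: open_nbhs_nbhs; split; last by split.
  apply: openI => //.
  rewrite (_ : [set y | _] = phi @^-1` [set t | t < 0])//.
  by apply: open_comp => [z _|]; [exact: cphi|exact: open_lt].
by have /(gE _ Uy) := Oy; rewrite -subr_gt0 -/(phi y) ltNge ltW.
Qed.

End lipschitz_boundary.

(** * Integrals over rectangles and restricted measures *)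

Section rectangle_fubini.
Context d1 d2 (T1 : measurableType d1) (T2 : measurableType d2) (R : realType).
Variables (m1 : {sigma_finite_measure set T1 -> \bar R})
  (m2 : {sigma_finite_measure set T2 -> \bar R}).
Variables (A : set T1) (B : set T2).
Hypotheses (mA : measurable A) (mB : measurable B).

Let mAB : measurable (A `*` B). Proof. exact: measurableX. Qed.

Let patch_inner2 (f : T1 * T2 -> \bar R) x :
  (\int[m2]_y (f \_ (A `*` B)) (x, y) =
   ((fun x => \int[m2]_(y in B) f (x, y)) \_ A) x)%E.
Proof.
rewrite patchE; case: ifPn => xA.
  rewrite [RHS]integral_mkcond; apply: eq_integral => y _; rewrite !patchE.
  by rewrite in_setX/= xA.
by apply: integral0_eq => y _; rewrite patchE in_setX/= (negbTE xA).
Qed.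

Let patch_inner1 (f : T1 * T2 -> \bar R) y :
  (\int[m1]_x (f \_ (A `*` B)) (x, y) =
   ((fun y => \int[m1]_(x in A) f (x, y)) \_ B) y)%E.
Proof.
rewrite patchE; case: ifPn => yB.
  rewrite [RHS]integral_mkcond; apply: eq_integral => x _; rewrite !patchE.
  by rewrite in_setX/= yB andbT.
by apply: integral0_eq => x _; rewrite patchE in_setX/= (negbTE yB) andbF.
Qed.

Section tonelli.
Variable f : T1 * T2 -> \bar R.
Hypotheses (mf : measurable_fun setT f) (f0 : forall z, (0 <= f z)%E).

Let mfp : measurable_fun setT (f \_ (A `*` B)).
Proof. by apply/(measurable_restrictT _ mAB); exact: measurable_funTS. Qed.

Let fp0 z : (0 <= (f \_ (A `*` B)) z)%E.
Proof. by rewrite patchE; case: ifP. Qed.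

Lemma rectangle_tonelli1 :
  (\int[m1 \x m2]_(z in A `*` B) f z = \int[m1]_(x in A) \int[m2]_(y in B) f (x, y))%E.
Proof.
rewrite integral_mkcond (fubini_tonelli1 _ mfp fp0) [RHS]integral_mkcond.
by apply: eq_integral => x _; exact: patch_inner2.
Qed.

Lemma rectangle_tonelli2 :
  (\int[m1 \x m2]_(z in A `*` B) f z = \int[m2]_(y in B) \int[m1]_(x in A) f (x, y))%E.
Proof.
rewrite integral_mkcond (fubini_tonelli2 _ mfp fp0) [RHS]integral_mkcond.
by apply: eq_integral => y _; exact: patch_inner1.
Qed.

End tonelli.

Section fubini.
Variable f : T1 * T2 -> R.
Hypothesis intf : (m1 \x m2)%E.-integrable (A `*` B) (EFin \o f).

Let intp : (m1 \x m2)%E.-integrable setT ((EFin \o f) \_ (A `*` B)).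
Proof. exact: (integrable_mkcond _ mAB).1 intf. Qed.

Lemma rectangle_fubini1 :
  \int[(m1 \x m2)%E]_(z in A `*` B) f z =
  \int[m1]_(x in A) \int[m2]_(y in B) f (x, y).
Proof.
rewrite /Rintegral; congr fine.
rewrite integral_mkcond -integral12_prod_meas1// [RHS]integral_mkcond.
apply: ae_eq_integral => //.
- exact: (measurable_fubini_F intp).
- rewrite (_ : _ \_ A = EFin \o (fun x => fine (fubini_F m2 ((EFin \o f) \_ (A `*` B)) x))).
    apply/measurable_EFinP; apply: measurableT_comp => //; exact: (measurable_fubini_F intp).
  apply/funext => x /=; rewrite /fubini_F patch_inner2 !patchE.
  by case: ifP.
- have := ae_integrable1 intp; apply: filterS => x intx _.
  rewrite -[LHS]fineK; last exact: integrable_fin_num.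
  by rewrite /fubini_F patch_inner2 !patchE; case: ifP.
Qed.

Lemma rectangle_fubini2 :
  \int[(m1 \x m2)%E]_(z in A `*` B) f z =
  \int[m2]_(y in B) \int[m1]_(x in A) f (x, y).
Proof.
rewrite /Rintegral; congr fine.
rewrite integral_mkcond -integral21_prod_meas1// [RHS]integral_mkcond.
apply: ae_eq_integral => //.
- exact: (measurable_fubini_G intp).
- rewrite (_ : _ \_ B = EFin \o (fun x => fine (fubini_G m1 ((EFin \o f) \_ (A `*` B)) x))).
    apply/measurable_EFinP; apply: measurableT_comp => //; exact: (measurable_fubini_G intp).
  apply/funext => y /=; rewrite /fubini_G patch_inner1 !patchE.
  by case: ifP.
- have := ae_integrable2 intp; apply: filterS => y inty _.
  rewrite -[LHS]fineK; last exact: integrable_fin_num.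
  by rewrite /fubini_G patch_inner1 !patchE; case: ifP.
Qed.

End fubini.

End rectangle_fubini.

Section restricted_measure.
Context d (T : measurableType d) (R : realType).
Variables (mu : {measure set T -> \bar R}) (D : set T) (mD : measurable D).
Local Notation muD := (mrestr mu mD).

Lemma ge0_integral_mrestr (f : T -> \bar R) : measurable_fun setT f ->
  (forall x, 0 <= f x)%E -> (\int[muD]_x f x = \int[mu]_(x in D) f x)%E.
Proof.
move=> mf f0.
rewrite (@ge0_negligible_integral _ _ _ muD setT (~` D))//; last 2 first.
- exact: measurableC.
- by rewrite /= /mrestr setICl measure0.
rewrite setTD setCK; apply: eq_measure_integral => A mA AD.
by rewrite /= /mrestr setIidl.
Qed.

Lemma Rintegral_mrestr (f : T -> R) : measurable_fun setT f ->
  \int[muD]_x f x = \int[mu]_(x in D) f x.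
Proof.
move=> mf; rewrite /Rintegral; congr fine.
rewrite integralE [RHS]integralE; congr (_ - _)%E; apply: ge0_integral_mrestr => //.
- by apply: measurable_funepos; exact/measurable_EFinP.
- by apply: measurable_funeneg; exact/measurable_EFinP.
Qed.

Lemma ae_mrestr (P : T -> Prop) :
  {ae muD, forall x, P x} <-> {ae mu, forall x, D x -> P x}.
Proof.
split=> -[N [mN N0 PN]].
  exists (N `&` D); split; [exact: measurableI|exact: N0|].
  move=> x /= /not_implyP[Dx nPx]; split => //; exact: PN.
exists (N `|` ~` D); split.
- by apply: measurableU => //; exact: measurableC.
- rewrite /= /mrestr setIUl setICl setU0; apply/eqP; rewrite -measure_le0 -N0.
  by apply: le_measure; rewrite ?inE//; exact: measurableI.
- move=> x /= nPx; have [Dx|nDx] := pselect (D x); last by right.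
  by left; apply: PN => /= /(_ Dx).
Qed.

End restricted_measure.

(** * The Neumann extension *)

Section weighted_squares.
Context d (T : measurableType d) (R : realType).
Variables (mu : {measure set T -> \bar R}) (D : set T).
Hypothesis mD : measurable D.

Lemma sqr_lin_weight_le (f g w : T -> R) (c : R) :
  measurable_fun D f -> measurable_fun D g -> measurable_fun D w ->
  (forall x, D x -> 0 <= w x) ->
  (\int[mu]_(x in D) ((c * f x + g x) ^+ 2 * w x)%:E <=
   (2 * c ^+ 2)%:E * \int[mu]_(x in D) (f x ^+ 2 * w x)%:E +
   2%:E * \int[mu]_(x in D) (g x ^+ 2 * w x)%:E)%E.
Proof.
move=> mf mg mw w0.
have mh (h : T -> R) : measurable_fun D h ->
    measurable_fun D (fun x => (h x ^+ 2 * w x)%:E).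
  by move=> mh; apply/measurable_EFinP; apply: measurable_funM => //; exact: measurable_funX.
have h0 (h : T -> R) x : D x -> (0 <= (h x ^+ 2 * w x)%:E)%E.
  by move=> Dx; rewrite lee_fin mulr_ge0// ?sqr_ge0// w0.
have c20 : 0 <= 2 * c ^+ 2 by rewrite mulr_ge0 ?sqr_ge0.
rewrite -!ge0_integralZl_EFin//; [|by move=> x Dx; exact: h0|exact: mh|by move=> x Dx; exact: h0|exact: mh].
rewrite -ge0_integralD//; last 4 first.
- by move=> x Dx; rewrite mule_ge0 ?lee_fin// -lee_fin h0.
- by apply: measurable_funeM; exact: mh.
- by move=> x Dx; rewrite mule_ge0 ?lee_fin// -lee_fin h0.
- by apply: measurable_funeM; exact: mh.
apply: ge0_le_integral => //.
- by move=> x Dx; apply: (h0 (fun x => c * f x + g x)).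
- apply: (mh (fun x => c * f x + g x)); apply: measurable_funD => //.
  exact: measurable_funM.
- by apply: emeasurable_funD; apply: measurable_funeM; exact: mh.
- move=> x Dx; rewrite -!EFinM -EFinD lee_fin !mulrA -mulrDl ler_wpM2r ?w0//.
  by have := sqr_ge0 (c * f x - g x); nra.
Qed.

Lemma sqr_lin_weight_lty (f g w : T -> R) (c : R) :
  measurable_fun D f -> measurable_fun D g -> measurable_fun D w ->
  (forall x, D x -> 0 <= w x) ->
  (\int[mu]_(x in D) (f x ^+ 2 * w x)%:E < +oo)%E ->
  (\int[mu]_(x in D) (g x ^+ 2 * w x)%:E < +oo)%E ->
  (\int[mu]_(x in D) ((c * f x + g x) ^+ 2 * w x)%:E < +oo)%E.
Proof.
move=> mf mg mw w0 f2 g2; apply: le_lt_trans (sqr_lin_weight_le c mf mg mw w0) _.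
by rewrite lte_add_pinfty// lte_mul_pinfty// lee_fin// mulr_ge0 ?sqr_ge0.
Qed.

Lemma sqr_lin_le (f g : T -> R) (c : R) : measurable_fun D f -> measurable_fun D g ->
  (\int[mu]_(x in D) ((c * f x + g x) ^+ 2)%:E <=
   (2 * c ^+ 2)%:E * \int[mu]_(x in D) (f x ^+ 2)%:E +
   2%:E * \int[mu]_(x in D) (g x ^+ 2)%:E)%E.
Proof.
move=> mf mg.
have E (h : T -> R) : (\int[mu]_(x in D) (h x ^+ 2)%:E =
    \int[mu]_(x in D) (h x ^+ 2 * (cst 1 x))%:E)%E.
  by apply: eq_integral => x _; rewrite mulr1.
by rewrite (E f) (E g) (E (fun x => c * f x + g x)); exact: sqr_lin_weight_le.
Qed.

Lemma sqr_lin_lty (f g : T -> R) (c : R) :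
  measurable_fun D f -> measurable_fun D g ->
  (\int[mu]_(x in D) (f x ^+ 2)%:E < +oo)%E ->
  (\int[mu]_(x in D) (g x ^+ 2)%:E < +oo)%E ->
  (\int[mu]_(x in D) ((c * f x + g x) ^+ 2)%:E < +oo)%E.
Proof.
move=> mf mg f2 g2; apply: le_lt_trans (sqr_lin_le c mf mg) _.
by rewrite lte_add_pinfty// lte_mul_pinfty// lee_fin// mulr_ge0 ?sqr_ge0.
Qed.

End weighted_squares.

Section neumann_extension.
Context (R : realType) (n : nat) (s : R) (Om : set 'rV[R]_n).
Hypotheses (s0 : 0 < s) (mOm : measurable Om) (bOm : bounded_set Om).
Implicit Types (x y : 'rV[R]_n) (u v f : 'rV[R]_n -> R).
Local Notation leb := (lebesgue_rV R n).
Local Notation k := (frac_kernel s).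
Local Notation ext := (neumann_ext s Om).

Lemma bounded_lebesgue_lty : (leb Om < +oo)%E.
Proof.
have [M [Mr MO]] := bOm.
have M0 : 0 < `|M| + 1 by rewrite ltr_wpDl.
apply: (@le_lt_trans _ _ (leb [set x | `|x| <= `|M| + 1])).
  apply: le_measure; rewrite ?inE//.
    rewrite -[X in measurable X]setTI.
    apply: (measurable_norm_rV measurableT (Y := [set t | t <= `|M| + 1])).
    by rewrite -set_itvNyc; exact: measurable_itv.
  by move=> x Ox; apply: (MO (`|M| + 1)) => //; rewrite (le_lt_trans (ler_norm M))// ltrDl.
by rewrite lebesgue_cube// ltry.
Qed.

Lemma measurable_kernel y : measurable_fun setT (k y).
Proof. exact: measurable_frac_kernel. Qed.

Lemma kernel_far y : ~ closure Om y ->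
  exists2 C : R, 0 <= C & forall x, Om x -> k y x <= C.
Proof.
move=> /existsNP[B /not_implyP[nB /set0P/negP/negPn/eqP OB]].
have /nbhs_ballP[r /= r0 rB] := nB.
exists (r `^ (- (n%:R + 2 * s))); first exact: powR_ge0.
move=> x Ox; apply: frac_kernel_le => //; first by rewrite addr_ge0 ?ler0n// mulr_ge0// ltW.
rewrite leNgt; apply/negP => yx.
suff : (Om `&` B) x by rewrite OB.
by split => //; apply: rB; rewrite -ball_normE.
Qed.

Lemma kernel_weight_lty y u : ~ closure Om y -> measurable_fun setT u ->
  (\int[leb]_(x in Om) (u x ^+ 2)%:E < +oo)%E ->
  (\int[leb]_(x in Om) (u x ^+ 2 * k y x)%:E < +oo)%E.
Proof.
move=> /kernel_far[C C0 kC] mu u2.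
have mu2 : measurable_fun Om (fun x => (u x ^+ 2)%:E).
  by apply/measurable_EFinP; apply: measurable_funX; exact: measurable_funTS.
apply: (@le_lt_trans _ _ (\int[leb]_(x in Om) (C%:E * (u x ^+ 2)%:E))%E).
  apply: ge0_le_integral => //.
  - by move=> x _; rewrite lee_fin mulr_ge0 ?sqr_ge0 ?frac_kernel_ge0.
  - apply/measurable_EFinP; apply: measurable_funM; first exact/measurable_EFinP.
    exact: (measurable_funTS (measurable_kernel y)).
  - exact: measurable_funeM.
  - by move=> x Ox; rewrite -EFinM lee_fin mulrC ler_wpM2r ?sqr_ge0 ?kC.
rewrite ge0_integralZl_EFin//; last by move=> x _; rewrite lee_fin sqr_ge0.
by rewrite lte_mul_pinfty ?lee_fin.
Qed.

Let m1 : measurable_fun setT (cst 1 : 'rV[R]_n -> R).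
Proof. exact: measurable_cst. Qed.

Lemma one_sqr_lty : (\int[leb]_(x in Om) ((cst 1 x : R) ^+ 2)%:E < +oo)%E.
Proof.
under eq_integral do rewrite /= expr1n.
by rewrite integral_cst// mul1e bounded_lebesgue_lty.
Qed.

Lemma kernel_integrable2 y u v : ~ closure Om y ->
  measurable_fun setT u -> measurable_fun setT v ->
  (\int[leb]_(x in Om) (u x ^+ 2)%:E < +oo)%E ->
  (\int[leb]_(x in Om) (v x ^+ 2)%:E < +oo)%E ->
  leb.-integrable Om (fun x => (u x * v x * k y x)%:E).
Proof.
move=> yO mu mv u2 v2; apply: integrable_mul_weight => //.
- exact: measurable_funTS.
- exact: measurable_funTS.
- exact: (measurable_funTS (measurable_kernel y)).
- by move=> x _; exact: frac_kernel_ge0.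
- exact: kernel_weight_lty.
- exact: kernel_weight_lty.
Qed.

Lemma kernel_integrable1 y u : ~ closure Om y -> measurable_fun setT u ->
  (\int[leb]_(x in Om) (u x ^+ 2)%:E < +oo)%E ->
  leb.-integrable Om (fun x => (u x * k y x)%:E).
Proof.
move=> yO mu u2.
have := kernel_integrable2 yO mu m1 u2 one_sqr_lty.
by congr (integrable _ _ _); apply/funext => x /=; rewrite mulr1.
Qed.

Lemma kernel_integrable0 y : ~ closure Om y -> leb.-integrable Om (fun x => (k y x)%:E).
Proof.
move=> yO; have := kernel_integrable1 yO m1 one_sqr_lty.
by congr (integrable _ _ _); apply/funext => x /=; rewrite mul1r.
Qed.

Lemma neumann_ext_in u x : Om x -> ext u x = u x.
Proof. by move=> Ox; rewrite /neumann_ext mem_set. Qed.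

Lemma neumann_ext_bd u x : ~ Om x -> closure Om x -> ext u x = 0.
Proof. by move=> nOx cx; rewrite /neumann_ext memNset// mem_set. Qed.

Lemma neumann_ext_out u x : ~ closure Om x ->
  ext u x = (\int[leb]_(y in Om) k x y)^-1 * \int[leb]_(y in Om) (u y * k x y).
Proof.
move=> nx; rewrite /neumann_ext memNset; last by move=> /subset_closure.
by rewrite memNset.
Qed.

(* The case of a null weight, where the extension is [0^-1 * _ = 0], is harmless. *)
Lemma neumann_ext_mean u y : ~ closure Om y -> measurable_fun setT u ->
  (\int[leb]_(x in Om) (u x ^+ 2)%:E < +oo)%E ->
  ext u y * \int[leb]_(x in Om) k y x = \int[leb]_(x in Om) (u x * k y x).
Proof.
move=> yO mu u2; rewrite neumann_ext_out// mulrAC.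
have [r0|r0] := eqVneq (\int[leb]_(x in Om) k y x) 0; last by rewrite mulVf// mul1r.
rewrite r0 mulr0 mul0r.
have ik := kernel_integrable0 yO; have iuk := kernel_integrable1 yO mu u2.
have k0 : (\int[leb]_(x in Om) `|(k y x)%:E| = 0)%E.
  under eq_integral do rewrite gee0_abs ?lee_fin ?frac_kernel_ge0//.
  by rewrite -[LHS]fineK ?integrable_fin_num//; congr EFin.
rewrite /Rintegral (@ae_eq_integral _ _ _ leb Om (cst 0%E)) ?integral0//.
- exact: measurable_int iuk.
- have [+ _] := ae_eq_integral_abs leb mOm (measurable_int _ ik).
  move=> /(_ k0); apply: filterS => x kx Ox.
  by have [->] := kx Ox; rewrite mulr0.
Qed.

Lemma neumann_ext_flux u y : ~ closure Om y -> measurable_fun setT u ->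
  (\int[leb]_(x in Om) (u x ^+ 2)%:E < +oo)%E ->
  \int[leb]_(x in Om) ((u x - ext u y) * k y x) = 0.
Proof.
move=> yO mu u2.
have ik := kernel_integrable0 yO; have iuk := kernel_integrable1 yO mu u2.
under eq_Rintegral do rewrite mulrBl.
rewrite RintegralB//; last exact: (integrableZl mOm (ext u y) ik).
by rewrite RintegralZl// neumann_ext_mean// subrr.
Qed.

Lemma neumann_ext_min u y (c : R) : ~ closure Om y -> measurable_fun setT u ->
  (\int[leb]_(x in Om) (u x ^+ 2)%:E < +oo)%E ->
  (\int[leb]_(x in Om) ((u x - ext u y) ^+ 2 * k y x)%:E <=
   \int[leb]_(x in Om) ((u x - c) ^+ 2 * k y x)%:E)%E.
Proof.
move=> yO mu u2; set m := ext u y.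
have ik := kernel_integrable0 yO; have iuk := kernel_integrable1 yO mu u2.
have mum : measurable_fun setT (fun x => u x - m) by exact: measurable_funB.
have um2 : (\int[leb]_(x in Om) ((u x - m) ^+ 2)%:E < +oo)%E.
  have := sqr_lin_lty mOm (- m) (measurable_funTS m1) (measurable_funTS mu) one_sqr_lty u2.
  by under eq_integral do rewrite mulr1 addrC.
have im2 := kernel_integrable2 yO mum mum um2 um2.
have im1 := kernel_integrable1 yO mum um2.
have -> : (\int[leb]_(x in Om) ((u x - c) ^+ 2 * k y x)%:E)%E =
  (\int[leb]_(x in Om) (((u x - m) * (u x - m) * k y x)%:E +
     ((2 * (m - c))%:E * ((u x - m) * k y x)%:E + ((m - c) ^+ 2)%:E * (k y x)%:E)))%E.
  apply: eq_integral => x _; rewrite -!EFinM -!EFinD; congr EFin; ring.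
rewrite integralD//; last by apply: integrableD => //; exact: integrableZl.
rewrite integralD//; [|exact: integrableZl..].
rewrite !integralZl//.
have -> : (\int[leb]_(x in Om) ((u x - m) * k y x)%:E = 0)%E.
  by rewrite -[LHS]fineK ?integrable_fin_num//; congr EFin; exact: neumann_ext_flux.
rewrite mule0 add0e.
rewrite [leLHS](_ : _ = \int[leb]_(x in Om) ((u x - m) * (u x - m) * k y x)%:E)%E; last first.
  by apply: eq_integral => x _; rewrite expr2.
rewrite leeDl// mule_ge0 ?lee_fin ?sqr_ge0//.
by apply: integral_ge0 => x _; rewrite lee_fin frac_kernel_ge0.
Qed.

End neumann_extension.

Section parameter_measurability.
Context d1 d2 (T1 : measurableType d1) (T2 : measurableType d2) (R : realType).
Variable m2 : {sigma_finite_measure set T2 -> \bar R}.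

Lemma measurable_fun_Rintegral (A : set T2) (f : T1 * T2 -> R) : measurable A ->
  measurable_fun setT f ->
  measurable_fun setT (fun x => \int[m2]_(y in A) f (x, y)).
Proof.
move=> mA mf; apply: measurableT_comp => //.
pose g (z : T1 * T2) : \bar R := (f z * \1_A z.2)%:E.
have mg : measurable_fun setT g.
  apply/measurable_EFinP; apply: measurable_funM => //.
  apply: (@measurableT_comp _ _ _ _ _ _ (\1_A : T2 -> R) _ snd).
    exact: measurable_indic.
  exact: measurable_snd.
rewrite (_ : (fun x => _) =
    (fun x => (\int[m2]_y g^\+ (x, y) - \int[m2]_y g^\- (x, y))%E)).
  apply: emeasurable_funB; apply: measurable_fun_fubini_tonelli_F => //.
  - exact: measurable_funepos.
  - exact: measurable_funeneg.
apply/funext => x; transitivity (\int[m2]_y g (x, y))%E.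
  rewrite integral_mkcond; apply: eq_integral => y _.
  by rewrite patchE /g indicE/=; case: ifP => _; rewrite ?mulr1 ?mulr0.
rewrite [LHS]integralE; under eq_integral do rewrite funepos_comp/=.
by under [X in (_ - X = _)%E]eq_integral do rewrite funeneg_comp/=.
Qed.

Lemma measurable_mem (A : set T1) : measurable A -> measurable_fun setT (fun x => x \in A).
Proof.
move=> mA; apply: (measurable_fun_bool true); rewrite setTI.
by rewrite (_ : _ @^-1` _ = A)//; apply/seteqP; split=> x; [exact: set_mem|exact: mem_set].
Qed.

End parameter_measurability.

Section extension_map.
Context (R : realType) (n : nat) (s : R) (Om : set 'rV[R]_n).
Hypotheses (s0 : 0 < s) (oOm : open Om) (bOm : bounded_set Om).
Implicit Types (x y : 'rV[R]_n) (u v f : 'rV[R]_n -> R).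
Local Notation leb := (lebesgue_rV R n).
Local Notation k := (frac_kernel s).
Local Notation ext := (neumann_ext s Om).

Let mOm : measurable Om. Proof. exact: open_measurable_rV. Qed.

Lemma measurable_closure_rV : measurable (closure Om).
Proof.
rewrite -[closure Om]setCK; apply: measurableC; apply: open_measurable_rV.
by apply: closed_openC; exact: closed_closure.
Qed.

Lemma measurable_neumann_ext u : measurable_fun setT u -> measurable_fun setT (ext u).
Proof.
move=> mu; rewrite /neumann_ext.
apply: measurable_fun_ifT => //; first exact: measurable_mem.
apply: measurable_fun_ifT => //; first exact: (measurable_mem measurable_closure_rV).
have mk : measurable_fun setT (fun z : 'rV[R]_n * 'rV[R]_n => k z.1 z.2).
  exact: measurable_frac_kernel.
apply: measurable_funM.
  rewrite (_ : (fun x => _) = (fun x => (\int[leb]_(y in Om) k x y) `^ (-1))); last first.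
    apply/funext => x; rewrite powR_inv1//.
    by apply: Rintegral_ge0 => y _; exact: frac_kernel_ge0.
  apply: (measurableT_comp (measurable_powR _)).
  exact: (@measurable_fun_Rintegral _ _ _ _ _ _ Om (fun z => k z.1 z.2)).
apply: (@measurable_fun_Rintegral _ _ _ _ _ _ Om (fun z => u z.2 * k z.1 z.2)) => //.
by apply: measurable_funM => //; exact: (measurableT_comp mu measurable_snd).
Qed.

Lemma neumann_ext_linear u v c x : measurable_fun setT u -> measurable_fun setT v ->
  (\int[leb]_(x in Om) (u x ^+ 2)%:E < +oo)%E ->
  (\int[leb]_(x in Om) (v x ^+ 2)%:E < +oo)%E ->
  ext (fun x => c * u x + v x) x = c * ext u x + ext v x.
Proof.
move=> mu mv u2 v2; have [Ox|nOx] := pselect (Om x); first by rewrite !neumann_ext_in.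
have [cx|ncx] := pselect (closure Om x); first by rewrite !neumann_ext_bd// mulr0 addr0.
rewrite !neumann_ext_out//.
have iu := kernel_integrable1 s0 mOm bOm ncx mu u2.
have iv := kernel_integrable1 s0 mOm bOm ncx mv v2.
have -> : \int[leb]_(y in Om) ((c * u y + v y) * k x y) =
    c * \int[leb]_(y in Om) (u y * k x y) + \int[leb]_(y in Om) (v y * k x y).
  rewrite -RintegralZl// -RintegralD//; last exact: (integrableZl mOm c iu).
  by apply: eq_Rintegral => y _; rewrite mulrDl mulrA.
ring.
Qed.

Lemma neumann_ext_ae u v : measurable_fun setT u -> measurable_fun setT v ->
  (\int[leb]_(x in Om) (u x ^+ 2)%:E < +oo)%E ->
  (\int[leb]_(x in Om) (v x ^+ 2)%:E < +oo)%E ->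
  {ae leb, forall x, Om x -> u x = v x} -> {ae leb, forall x, ext u x = ext v x}.
Proof.
move=> mu mv u2 v2 uv; apply: filterS (uv) => x uvx.
have [Ox|nOx] := pselect (Om x); first by rewrite !neumann_ext_in// uvx.
have [cx|ncx] := pselect (closure Om x); first by rewrite !neumann_ext_bd.
rewrite !neumann_ext_out//; congr (_ * fine _).
apply: ae_eq_integral => //.
- exact: measurable_int (kernel_integrable1 s0 mOm bOm ncx mu u2).
- exact: measurable_int (kernel_integrable1 s0 mOm bOm ncx mv v2).
- by apply: filterS uv => y uvy Oy; rewrite uvy.
Qed.

(* Outside the closure of [Om] the extension depends continuously on [u] in
   L^2(Om), so it passes to pointwise limits there without subsequences. *)
Lemma neumann_ext_cvg (u_ : nat -> 'rV[R]_n -> R) u x :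
  (forall j, measurable_fun setT (u_ j)) -> measurable_fun setT u ->
  (forall j, \int[leb]_(y in Om) (u_ j y ^+ 2)%:E < +oo)%E ->
  (\int[leb]_(y in Om) (u y ^+ 2)%:E < +oo)%E ->
  (forall e, 0 < e -> exists N, forall j, (N <= j)%N ->
     (\int[leb]_(y in Om) ((u_ j y - u y) ^+ 2)%:E <= e%:E)%E) ->
  ~ Om x -> ext (u_ j) x @[j --> \oo] --> ext u x.
Proof.
move=> mu_ mu u_2 u2 cvgu nOx.
have [cx|ncx] := pselect (closure Om x).
  rewrite neumann_ext_bd//; under eq_fun do rewrite neumann_ext_bd//.
  exact: cvg_cst.
rewrite neumann_ext_out//; under eq_fun do rewrite neumann_ext_out//.
apply: cvgM; first exact: cvg_cst.
have [C C0 kC] := kernel_far s0 ncx.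
pose I := fine (leb Om).
have I0 : 0 <= I by exact: fine_ge0.
have Ofin : leb Om = I%:E.
  by rewrite /I fineK// ge0_fin_numE// (bounded_lebesgue_lty mOm bOm).
apply/cvgrPdist_le => e e0.
(* [|h| <= t + h^2 / t] with [t] small turns L^2 bounds into L^1 bounds. *)
have C10 : 0 < C + 1 by rewrite ltr_wpDl.
have I10 : 0 < I + 1 by rewrite ltr_wpDl.
pose t := e / (2 * (C + 1) * (I + 1)).
have t0 : 0 < t by apply: divr_gt0 => //; rewrite !mulr_gt0.
have [|N NP] := cvgu (t * e / (2 * (C + 1))).
  by apply: divr_gt0; apply: mulr_gt0.
exists N => // j /= Nj.
pose h y := u y - u_ j y.
have mh : measurable_fun setT h by exact: measurable_funB.
have h2 : (\int[leb]_(y in Om) (h y ^+ 2)%:E <= (t * e / (2 * (C + 1)))%:E)%E.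
  apply: le_trans (NP j Nj); under eq_integral do rewrite /h -sqrrN opprB.
  exact: lexx.
have iuk := kernel_integrable1 s0 mOm bOm ncx mu u2.
have iujk := kernel_integrable1 s0 mOm bOm ncx (mu_ j) (u_2 j).
rewrite -RintegralB//.
have ihk : leb.-integrable Om (EFin \o (fun y => u y * k x y - u_ j y * k x y)).
  exact: (integrableB mOm iuk iujk).
apply: le_trans (le_normr_Rintegral mOm ihk) _.
rewrite -lee_fin /Rintegral fineK; last first.
  by apply: integrable_fin_num => //; exact: integrable_norm ihk.
have mh2 : measurable_fun Om (fun y => (h y ^+ 2)%:E).
  by apply/measurable_EFinP; apply: measurable_funX; exact: measurable_funTS.
apply: (@le_trans _ _ (\int[leb]_(y in Om) ((C * t)%:E + (C / t)%:E * (h y ^+ 2)%:E))%E).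
  apply: ge0_le_integral => //.
  - apply/measurable_EFinP; apply: measurableT_comp => //.
    by apply/measurable_EFinP; exact: (measurable_int _ ihk).
  - by apply: emeasurable_funD => //; exact: measurable_funeM.
  - move=> y Oy; rewrite -EFinM -EFinD lee_fin -mulrBl normrM -/(h y).
    rewrite (ger0_norm (frac_kernel_ge0 _ _ _)) mulrC.
    apply: (@le_trans _ _ (C * `|h y|)); first by rewrite ler_wpM2r// kC.
    rewrite -mulrA -mulrDr ler_wpM2l//.
    rewrite -(ler_pM2l t0) mulrDr mulVKf ?gt_eqF//.
    rewrite -(real_normK (num_real (h y))); move: (normr_ge0 (h y)).
    by move: `|h y| => a a0; have := sqr_ge0 (a - t); nra.
rewrite ge0_integralD//; last 3 first.
- by move=> y _; rewrite lee_fin mulr_ge0// ltW.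
- by move=> y _; rewrite mule_ge0 ?lee_fin ?sqr_ge0// divr_ge0// ltW.
- exact: measurable_funeM.
have -> : (\int[leb]_(_ in Om) (C * t)%:E = (C * t)%:E * I%:E)%E.
  by rewrite -Ofin; exact: integral_cst.
have Ct0 : 0 <= C / t by rewrite divr_ge0// ltW.
rewrite ge0_integralZl_EFin//; last by move=> y _; rewrite lee_fin sqr_ge0.
apply: (@le_trans _ _ ((C * t)%:E * I%:E + (C / t)%:E * (t * e / (2 * (C + 1)))%:E)%E).
  by rewrite leeD2l// lee_wpmul2l// lee_fin divr_ge0// ltW.
rewrite -!EFinM -EFinD lee_fin.
have -> : C * t * I = e / 2 * (C / (C + 1)) * (I / (I + 1)).
  rewrite /t; field; do ?[apply/andP; split]; rewrite gt_eqF//; lra.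
have -> : C / t * (t * e / (2 * (C + 1))) = e / 2 * (C / (C + 1)).
  field; do ?[apply/andP; split]; rewrite gt_eqF//; lra.
have C1 : 0 <= C / (C + 1) <= 1 by rewrite divr_ge0 ?ler_pdivrMr//=; lra.
have I1 : 0 <= I / (I + 1) <= 1 by rewrite divr_ge0 ?ler_pdivrMr//=; lra.
move: C1 I1; move: (C / (C + 1)) (I / (I + 1)) => a b /andP[a0 a1] /andP[b0 b1].
have : a * b <= 1 by nra.
have e20 : 0 <= e / 2 by rewrite divr_ge0// ltW.
by move=> ab; rewrite -mulrA; nra.
Qed.

End extension_map.

(** * The Gagliardo energy *)

Section sobolev.
Context (R : realType) (n : nat) (s : R) (Om : set 'rV[R]_n).
Hypotheses (s0 : 0 < s) (oOm : open Om) (bOm : bounded_set Om).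
Hypothesis bd0 : lebesgue_rV R n (closure Om `\` Om) = 0%E.
Implicit Types (x y : 'rV[R]_n) (u v w f : 'rV[R]_n -> R).
Local Notation leb := (lebesgue_rV R n).
Local Notation leb2 := (lebesgue_rV R n \x lebesgue_rV R n)%E.
Local Notation k := (frac_kernel s).
Local Notation ext := (neumann_ext s Om).
Local Notation Z := (~` (~` Om `*` ~` Om)).

Let mOm : measurable Om. Proof. exact: open_measurable_rV. Qed.
Let mOmC : measurable (~` Om). Proof. exact: measurableC. Qed.

Lemma cross_measurable : measurable (Z : set ('rV[R]_n * 'rV[R]_n)).
Proof. by apply: measurableC; exact: measurableX. Qed.

Let mZ := cross_measurable.

Let Z_split : Z = (Om `*` Om) `|` ((Om `*` ~` Om) `|` (~` Om `*` Om)).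
Proof.
apply/seteqP; split=> -[x y] /=.
  move=> /not_andP[] /contrapT Oz.
    by have [Oy|Oy] := pselect (Om y); [left|right; left].
  by have [Ox|Ox] := pselect (Om x); [left|right; right].
by move=> [[Ox Oy]|[[Ox Oy]|[Ox Oy]]] [nx ny]; [exact: nx|exact: nx|exact: ny].
Qed.

Let disj1 : [disjoint (Om `*` Om) & (Om `*` ~` Om) `|` (~` Om `*` Om)].
Proof. by apply/disj_setPS => -[x y] /= [[Ox Oy] [[_ nOy]|[nOx _]]]. Qed.

Let disj2 : [disjoint (Om `*` ~` Om) & (~` Om `*` Om)].
Proof. by apply/disj_setPS => -[x y] /= [[Ox Oy] [nOx _]]. Qed.

Lemma cross_tonelli (f : 'rV[R]_n * 'rV[R]_n -> \bar R) : measurable_fun setT f ->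
  (forall z, 0 <= f z)%E -> (forall x y, f (x, y) = f (y, x)) ->
  (\int[leb2]_(z in Z) f z = \int[leb2]_(z in Om `*` Om) f z +
    (\int[leb]_(y in ~` Om) \int[leb]_(x in Om) f (x, y) +
     \int[leb]_(y in ~` Om) \int[leb]_(x in Om) f (x, y)))%E.
Proof.
move=> mf f0 fC; rewrite Z_split ge0_integral_setU//; last 3 first.
- exact: measurableX.
- by apply: measurableU; exact: measurableX.
- exact: measurable_funTS.
congr (_ + _)%E; rewrite ge0_integral_setU//; last 3 first.
- exact: measurableX.
- exact: measurableX.
- exact: measurable_funTS.
rewrite (rectangle_tonelli2 leb leb mOm mOmC mf f0) (rectangle_tonelli1 leb leb mOmC mOm mf f0).
congr (_ + _)%E.
by apply: eq_integral => y _; apply: eq_integral => x _; rewrite fC.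
Qed.

Definition gagliardo_integrand u v (z : 'rV[R]_n * 'rV[R]_n) : R :=
  (u z.1 - u z.2) * (v z.1 - v z.2) * k z.1 z.2.

Local Notation gag := gagliardo_integrand.

Let mdiff u : measurable_fun setT u ->
  measurable_fun setT (fun z : 'rV[R]_n * 'rV[R]_n => u z.1 - u z.2).
Proof.
move=> mu; apply: measurable_funB.
  exact: (measurableT_comp mu measurable_fst).
exact: (measurableT_comp mu measurable_snd).
Qed.

Let mk2 : measurable_fun setT (fun z : 'rV[R]_n * 'rV[R]_n => k z.1 z.2).
Proof. exact: measurable_frac_kernel. Qed.

Lemma measurable_gagliardo u v : measurable_fun setT u -> measurable_fun setT v ->
  measurable_fun setT (gag u v).
Proof.
by move=> mu mv; apply: measurable_funM => //; apply: measurable_funM; exact: mdiff.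
Qed.

Let mgag2 u : measurable_fun setT u ->
  measurable_fun setT (fun z : 'rV[R]_n * 'rV[R]_n =>
    ((u z.1 - u z.2) ^+ 2 * k z.1 z.2)%:E).
Proof.
move=> mu; apply/measurable_EFinP; apply: measurable_funM => //.
by apply: measurable_funX; exact: mdiff.
Qed.

Let gag2_ge0 u (z : 'rV[R]_n * 'rV[R]_n) :
  (0 <= ((u z.1 - u z.2) ^+ 2 * k z.1 z.2)%:E)%E.
Proof. by rewrite lee_fin mulr_ge0 ?sqr_ge0 ?frac_kernel_ge0. Qed.

Lemma sobolev_OmP u : sobolev_Om s Om u <->
  [/\ measurable_fun setT u, (\int[leb]_(x in Om) (u x ^+ 2)%:E < +oo)%E &
    (\int[leb2]_(z in Z) ((u z.1 - u z.2) ^+ 2 * k z.1 z.2)%:E < +oo)%E].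
Proof.
have I1 : (0 <= \int[leb]_(x in Om) (u x ^+ 2)%:E)%E.
  by apply: integral_ge0 => x _; rewrite lee_fin sqr_ge0.
have I2 : (0 <= \int[leb2]_(z in Z) ((u z.1 - u z.2) ^+ 2 * k z.1 z.2)%:E)%E.
  by apply: integral_ge0 => z _; exact: gag2_ge0.
split=> [[mu H]|[mu H1 H2]]; last by split => //; exact: lte_add_pinfty.
split => //.
- by apply: le_lt_trans H; rewrite leeDl.
- by apply: le_lt_trans H; rewrite leeDr.
Qed.

Lemma sobolev_neumann_ext v : sobolev_Om s Om v -> sobolev_Om s Om (ext v).
Proof.
move=> /sobolev_OmP[mv v2 Gv]; apply/sobolev_OmP.
have mev := measurable_neumann_ext s oOm mv.
split => //.
  rewrite (_ : (\int[leb]_(x in Om) _)%E = (\int[leb]_(x in Om) (v x ^+ 2)%:E)%E)//.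
  by apply: eq_integral => x; rewrite inE => Ox; rewrite neumann_ext_in.
apply: le_lt_trans Gv.
have sym u x y : ((u x - u y) ^+ 2 * k x y)%:E = ((u y - u x) ^+ 2 * k y x)%:E.
  by rewrite frac_kernelC -sqrrN opprB.
have mEG u : measurable_fun setT u -> measurable_fun setT (fun y =>
    \int[leb]_(x in Om) ((u x - u y) ^+ 2 * k x y)%:E)%E.
  move=> mu; pose f (z : 'rV[R]_n * 'rV[R]_n) := ((u z.1 - u z.2) ^+ 2 * k z.1 z.2)%:E.
  have mOT : measurable (Om `*` [set: 'rV[R]_n]) by exact: measurableX.
  rewrite (_ : (fun y => _) = (fun y => \int[leb]_x (f \_ (Om `*` setT)) (x, y))%E).
    apply: measurable_fun_fubini_tonelli_G => [|z].
      by apply/(measurable_restrictT _ mOT); exact: measurable_funTS (mgag2 mu).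
    by rewrite patchE; case: ifP => // _; exact: gag2_ge0.
  apply/funext => y; rewrite integral_mkcond; apply: eq_integral => x _.
  by rewrite !patchE in_setX/= in_setT andbT.
rewrite (cross_tonelli (mgag2 mev) (gag2_ge0 (ext v)) (sym (ext v))).
rewrite (cross_tonelli (mgag2 mv) (gag2_ge0 v) (sym v)).
have le_out : (\int[leb]_(y in ~` Om) \int[leb]_(x in Om) ((ext v x - ext v y) ^+ 2 * k x y)%:E <=
    \int[leb]_(y in ~` Om) \int[leb]_(x in Om) ((v x - v y) ^+ 2 * k x y)%:E)%E.
  apply: ae_ge0_le_integral => //.
  - by move=> y _; apply: integral_ge0 => x _; exact: (gag2_ge0 (ext v) (x, y)).
  - exact: (measurable_funTS (mEG _ mev)).
  - by move=> y _; apply: integral_ge0 => x _; exact: (gag2_ge0 v (x, y)).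
  - exact: (measurable_funTS (mEG _ mv)).
  exists (closure Om `\` Om); split => //.
    by apply: measurableD => //; exact: measurable_closure_rV.
  move=> y /= /not_implyP[nOy H]; split => //; apply: contrapT => ncy; apply: H.
  have E1 : (\int[leb]_(x in Om) ((ext v x - ext v y) ^+ 2 * k x y)%:E =
      \int[leb]_(x in Om) ((v x - ext v y) ^+ 2 * k y x)%:E)%E.
    by apply: eq_integral => x /set_mem Ox; rewrite (neumann_ext_in s v Ox) (frac_kernelC s x).
  have E2 : (\int[leb]_(x in Om) ((v x - v y) ^+ 2 * k x y)%:E =
      \int[leb]_(x in Om) ((v x - v y) ^+ 2 * k y x)%:E)%E.
    by apply: eq_integral => x _; rewrite (frac_kernelC s x).
  have eq_le_eq (a b c e : \bar R) : a = b -> c = e -> (b <= e)%E -> (a <= c)%E.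
    by move=> -> ->.
  exact: (eq_le_eq _ _ _ _ E1 E2 (neumann_ext_min s0 mOm bOm (v y) ncy mv v2)).
apply: leeD; last exact: leeD.
rewrite le_eqVlt; apply/orP; left; apply/eqP; apply: eq_integral => -[x y].
by rewrite inE => -[/= Ox Oy]; rewrite !neumann_ext_in.
Qed.

Lemma gagliardo_integrable u v : sobolev_Om s Om u -> sobolev_Om s Om v ->
  leb2.-integrable Z (EFin \o gag u v).
Proof.
move=> /sobolev_OmP[mu _ Gu] /sobolev_OmP[mv _ Gv].
apply: (@integrable_mul_weight _ _ _ leb2 Z (fun z => u z.1 - u z.2)
  (fun z => v z.1 - v z.2) (fun z => k z.1 z.2)) => //.
- exact: (measurable_funTS (mdiff mu)).
- exact: (measurable_funTS (mdiff mv)).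
- exact: (measurable_funTS mk2).
- by move=> z _; exact: frac_kernel_ge0.
Qed.

Lemma gagliardo_integrandC u v x y : gag u v (x, y) = gag u v (y, x).
Proof. by rewrite /gagliardo_integrand/= (frac_kernelC s y); ring. Qed.

Let gag_integrable_rect (A B : set 'rV[R]_n) u v : measurable A -> measurable B ->
  A `*` B `<=` Z -> sobolev_Om s Om u -> sobolev_Om s Om v ->
  leb2.-integrable (A `*` B) (EFin \o gag u v).
Proof.
move=> mA mB AB Wu Wv; apply: integrableS (gagliardo_integrable Wu Wv) => //.
exact: measurableX.
Qed.

Let sub11 : Om `*` Om `<=` Z. Proof. by rewrite Z_split; exact: subsetUl. Qed.
Let sub10 : Om `*` ~` Om `<=` Z.
Proof. by rewrite Z_split => z Hz; right; left. Qed.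
Let sub01 : ~` Om `*` Om `<=` Z.
Proof. by rewrite Z_split => z Hz; right; right. Qed.

Lemma energyE u v : sobolev_Om s Om u -> sobolev_Om s Om v ->
  energy s Om u v = Cns n s / 2 * \int[leb2]_(z in Z) gag u v z.
Proof.
move=> Wu Wv.
have i11 := gag_integrable_rect mOm mOm sub11 Wu Wv.
have i10 := gag_integrable_rect mOm mOmC sub10 Wu Wv.
have i01 := gag_integrable_rect mOmC mOm sub01 Wu Wv.
rewrite /energy.
rewrite -[\int[leb]_(x in Om) \int[leb]_(y in Om) _](rectangle_fubini1 mOm mOm i11).
rewrite -[\int[leb]_(x in Om) \int[leb]_(y in ~` Om) _](rectangle_fubini1 mOm mOmC i10).
have m11 : measurable (Om `*` Om) by exact: measurableX.
have m10 : measurable (Om `*` ~` Om) by exact: measurableX.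
have m01 : measurable (~` Om `*` Om) by exact: measurableX.
have iZ := gagliardo_integrable Wu Wv; rewrite Z_split in iZ *.
have m2 : measurable ((Om `*` ~` Om) `|` (~` Om `*` Om)) by exact: measurableU.
have iZ2 : leb2.-integrable ((Om `*` ~` Om) `|` (~` Om `*` Om)) (EFin \o gag u v).
  by apply: integrableS iZ; [exact: measurableU|exact: m2|move=> z Hz; right].
rewrite (Rintegral_setU m11 m2 iZ disj1) (Rintegral_setU m10 m01 iZ2 disj2).
have -> : \int[leb2]_(z in ~` Om `*` Om) gag u v z = \int[leb2]_(z in Om `*` ~` Om) gag u v z.
  rewrite (rectangle_fubini1 mOmC mOm i01) (rectangle_fubini2 mOm mOmC i10).
  by apply: eq_Rintegral => x _; apply: eq_Rintegral => y _; exact: gagliardo_integrandC.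
by field.
Qed.

Lemma energy_neumann_ext_orth u h : measurable_fun setT u ->
  (\int[leb]_(x in Om) (u x ^+ 2)%:E < +oo)%E ->
  sobolev_Om s Om (ext u) -> sobolev_Om s Om h -> (forall x, Om x -> h x = 0) ->
  energy s Om (ext u) h = 0.
Proof.
move=> mu u2 Wu Wh h0; rewrite /energy.
have -> : \int[leb]_(x in Om) \int[leb]_(y in Om)
    ((ext u x - ext u y) * (h x - h y) * k x y) = 0.
  rewrite (eq_Rintegral _ (g := cst 0)) ?Rintegral_cst ?mul0r// => x; rewrite inE => Ox.
  rewrite (eq_Rintegral _ (g := cst 0)) ?Rintegral_cst ?mul0r// => y; rewrite inE => Oy.
  by rewrite (h0 _ Ox) (h0 _ Oy) (subrr 0) mulr0 mul0r.
have i10 := gag_integrable_rect mOm mOmC sub10 Wu Wh.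
rewrite -[\int[leb]_(x in Om) \int[leb]_(y in ~` Om) _](rectangle_fubini1 mOm mOmC i10).
rewrite (rectangle_fubini2 mOm mOmC i10).
have [mh _ _] := (sobolev_OmP h).1 Wh; have [meu _ _] := (sobolev_OmP (ext u)).1 Wu.
have -> : \int[leb]_(y in ~` Om) \int[leb]_(x in Om) gag (ext u) h (x, y) = 0; last by rewrite !mulr0 addr0.
rewrite {1}/Rintegral (@ae_eq_integral _ _ _ leb (~` Om) (cst 0%E)) ?integral0//.
  apply/measurable_EFinP; apply: measurable_funTS.
  under eq_fun do under eq_Rintegral do rewrite gagliardo_integrandC.
  exact: (@measurable_fun_Rintegral _ _ _ _ _ _ Om _ mOm (measurable_gagliardo meu mh)).
exists (closure Om `\` Om); split => //.
  by apply: measurableD => //; exact: measurable_closure_rV.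
move=> y /= /not_implyP[nOy H]; split => //; apply: contrapT => ncy; apply: H.
congr EFin.
have flux := neumann_ext_flux s0 mOm bOm ncy mu u2.
have i1 := kernel_integrable1 s0 mOm bOm ncy mu u2.
have i0 := kernel_integrable0 s0 mOm bOm ncy.
rewrite (eq_Rintegral _ (g := fun x => - h y * ((u x - ext u y) * k y x))); last first.
  move=> x; rewrite inE => Ox; rewrite /gagliardo_integrand/= (neumann_ext_in s u Ox) (h0 _ Ox).
  by rewrite (frac_kernelC s y); ring.
have int : leb.-integrable Om (EFin \o (fun x => (u x - ext u y) * k y x)).
  have -> : EFin \o (fun x => (u x - ext u y) * k y x) =
      ((fun x => (u x * k y x)%:E) \- (fun x => (ext u y)%:E * (k y x)%:E))%E.
    by apply/funext => x; rewrite /= mulrBl.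
  exact: (integrableB mOm i1 (integrableZl mOm (ext u y) i0)).
by rewrite (RintegralZl _ mOm int) flux mulr0.
Qed.

Lemma sobolev_lipschitz v (L : R) : (0 < n)%N -> s < 1 -> 0 <= L ->
  measurable_fun setT v -> (\int[leb]_(x in Om) (v x ^+ 2)%:E < +oo)%E ->
  (forall x y, `|v x - v y| <= Num.min 1 (L * `|x - y|)) ->
  sobolev_Om s Om v.
Proof.
move=> n0 s1 L0 mv v2 vL; apply/sobolev_OmP; split => //.
pose h (z : 'rV[R]_n) : \bar R := (Num.min 1 (L * `|z|) ^+ 2 * k z 0)%:E.
have I_lty : (\int[leb]_z h z < +oo)%E := lipschitz_kernel_lty n0 s0 s1 L0.
have mh : measurable_fun setT h.
  apply/measurable_EFinP; apply: measurable_funM; last exact: measurable_frac_kernel.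
  apply: measurable_funX; apply: measurable_minr; first exact: measurable_cst.
  by apply: measurable_funM; [exact: measurable_cst|exact: measurable_norm_rV].
have h0 z : (0 <= h z)%E by rewrite lee_fin mulr_ge0 ?sqr_ge0 ?frac_kernel_ge0.
pose M (z : 'rV[R]_n * 'rV[R]_n) := h (z.2 - z.1).
have mM : measurable_fun setT M.
  apply: (measurableT_comp mh); apply: measurable_fun_rVB; [exact: measurable_snd|exact: measurable_fst].
have M0 z : (0 <= M z)%E by exact: h0.
have MC x y : M (x, y) = M (y, x).
  have E : k (y - x) 0 = k (x - y) 0 by rewrite /frac_kernel !subr0 -[in LHS]enormN opprB.
  by rewrite /M /h/= E distrC.
have vM : (\int[leb2]_(z in Z) ((v z.1 - v z.2) ^+ 2 * k z.1 z.2)%:E <=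
    \int[leb2]_(z in Z) M z)%E.
  apply: ge0_le_integral.
  - exact: mZ.
  - by move=> z _; exact: gag2_ge0.
  - exact: (measurable_funTS (mgag2 mv)).
  - exact: (measurable_funTS mM).
  - move=> [x y] _; rewrite /M /h/= lee_fin.
    have -> : k (y - x) 0 = k x y by rewrite /frac_kernel subr0 -[in LHS]enormN opprB.
    apply: ler_wpM2r; first exact: frac_kernel_ge0.
    rewrite distrC -real_normK ?num_real// ler_pXn2r ?nnegrE//.
    by rewrite le_min ler01 mulr_ge0.
apply: le_lt_trans vM _; rewrite (cross_tonelli mM M0 MC) -(rectangle_tonelli2 leb leb mOm mOmC mM M0).
have big_lty : (\int[leb2]_(z in Om `*` setT) M z < +oo)%E.
  rewrite (rectangle_tonelli1 leb leb mOm measurableT mM M0).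
  rewrite (eq_integral (fun=> \int[leb]_z h z)%E); last first.
    by move=> x _; rewrite /M/=; exact: (@ge0_integral_shift R n (- x) h).
  have I0 : (0 <= \int[leb]_z h z)%E by exact: integral_ge0.
  rewrite integral_cst// lte_mul_pinfty// ?ge0_fin_numE//.
  exact: (bounded_lebesgue_lty mOm bOm).
have sub B : measurable B -> (\int[leb2]_(z in Om `*` B) M z < +oo)%E.
  move=> mB; apply: le_lt_trans big_lty; apply: ge0_subset_integral.
  - exact: measurableX.
  - exact: measurableX.
  - exact: (measurable_funTS mM).
  - by move=> z _; exact: M0.
  - by move=> [x y] [].
by rewrite lte_add_pinfty ?sub// lte_add_pinfty ?sub.
Qed.

End sobolev.

(** * Density in L^2 *)

Section L2_density.
Context d (T : measurableType d) (R : realType).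
Variables (mu : {measure set T -> \bar R}) (V : set (T -> R)).
Hypothesis mu_lty : (mu setT < +oo)%E.
Hypothesis VL2 : forall f, V f ->
  measurable_fun setT f /\ (\int[mu]_x (f x ^+ 2)%:E < +oo)%E.
Hypothesis V0 : V (cst 0).
Hypothesis Vlin : forall c f g, V f -> V g -> V (fun x => c * f x + g x).

Definition L2_adherent (f : T -> R) := measurable_fun setT f /\
  forall e, 0 < e -> exists2 g, V g & (\int[mu]_x ((f x - g x) ^+ 2)%:E <= e%:E)%E.

Lemma L2_adherent_sub f : V f -> L2_adherent f.
Proof.
move=> Vf; split=> [|e e0]; first by case: (VL2 Vf).
exists f => //; rewrite integral0_eq ?lee_fin ?ltW// => x _.
by rewrite subrr expr0n.
Qed.

Lemma L2_adherent_lin c f g : L2_adherent f -> L2_adherent g ->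
  L2_adherent (fun x => c * f x + g x).
Proof.
move=> [mf fV] [mg gV]; split.
  by apply: measurable_funD => //; exact: measurable_funM.
move=> e e0.
have c20 : 0 < c ^+ 2 + 1 by rewrite ltr_wpDl ?sqr_ge0.
have [|f' Vf' ff'] := fV (e / (4 * (c ^+ 2 + 1))).
  by rewrite divr_gt0// mulr_gt0.
have [|g' Vg' gg'] := gV (e / 4); first by rewrite divr_gt0.
exists (fun x => c * f' x + g' x); first exact: Vlin.
have [mf' _] := VL2 Vf'; have [mg' _] := VL2 Vg'.
rewrite (_ : (\int[mu]_x _)%E =
    (\int[mu]_x ((c * (f x - f' x) + (g x - g' x)) ^+ 2)%:E)%E); last first.
  by apply: eq_integral => x _; congr (EFin (_ ^+ 2)); ring.
have := @sqr_lin_le _ _ _ mu setT measurableT (fun x => f x - f' x) (fun x => g x - g' x) c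
  (measurable_funB mf mf') (measurable_funB mg mg').
move=> /le_trans; apply.
apply: (@le_trans _ _ ((2 * c ^+ 2)%:E * (e / (4 * (c ^+ 2 + 1)))%:E + 2%:E * (e / 4)%:E)%E).
  by apply: leeD; apply: lee_wpmul2l => //; rewrite lee_fin mulr_ge0 ?sqr_ge0.
rewrite -!EFinM -EFinD lee_fin.
have -> : 2 * c ^+ 2 * (e / (4 * (c ^+ 2 + 1))) = e / 2 * (c ^+ 2 / (c ^+ 2 + 1)).
  by field; rewrite gt_eqF.
have : c ^+ 2 / (c ^+ 2 + 1) <= 1 by rewrite ler_pdivrMr// mul1r lerDl.
by nra.
Qed.

Lemma L2_adherent_dominated (f_ : nat -> T -> R) (f g : T -> R) :
  (forall m, L2_adherent (f_ m)) -> measurable_fun setT f -> measurable_fun setT g ->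
  (\int[mu]_x (g x ^+ 2)%:E < +oo)%E ->
  (forall m x, `|f_ m x| <= g x) -> (forall x, f_ m x @[m --> \oo] --> f x) ->
  L2_adherent f.
Proof.
move=> af_ mf mg g2 fg ff; split => // e e0.
have g0 x : 0 <= g x by exact: le_trans (fg 0%N x).
have fleg x : `|f x| <= g x.
  have /cvg_norm fx := ff x.
  rewrite -(cvg_lim _ fx)//; apply: limr_le; first by apply/cvg_ex; exists `|f x|.
  by apply: nearW => m; exact: fg.
have mf_ m : measurable_fun setT (f_ m) by case: (af_ m).
have g2i : mu.-integrable setT (fun x => (g x ^+ 2)%:E).
  apply/integrableP; split; first by apply/measurable_EFinP; exact: measurable_funX.
  by under eq_integral do rewrite gee0_abs ?lee_fin ?sqr_ge0//.
pose u_ m x : \bar R := ((f x - f_ m x) ^+ 2)%:E.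
have mu_ m : measurable_fun setT (u_ m).
  by apply/measurable_EFinP; apply: measurable_funX; exact: measurable_funB.
have u_cvg : {ae mu, forall x, setT x -> u_ m x @[m --> \oo] --> (cst 0%E : T -> \bar R) x}.
  apply: aeW => x _; apply: cvg_EFin; first exact: nearW.
  rewrite (_ : 0 = (f x - f x) * (f x - f x)); last by rewrite subrr mulr0.
  rewrite /comp /u_ /=; under eq_fun do rewrite expr2.
  by apply: cvgM; apply: cvgB => //; exact: cvg_cst.
have u_dom : {ae mu, forall x m, setT x -> (`|u_ m x| <= 4%:E * (g x ^+ 2)%:E)%E}.
  apply: aeW => x m _; rewrite -EFinM gee0_abs ?lee_fin ?sqr_ge0//.
  have := fg m x; have := fleg x; rewrite !ler_norml => /andP[a1 a2] /andP[b1 b2].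
  by have := g0 x; nra.
have [_ _] := dominated_convergence measurableT mu_ (measurable_cst _) u_cvg
  (integrableZl measurableT 4 g2i) u_dom.
rewrite integral0 => /fine_cvgP[fin /cvgrPdist_lt/(_ (e / 4))].
rewrite divr_gt0// => /(_ isT) near2.
have [N _ NP] := filterI fin near2.
have [fN dN] := NP N (leqnn N).
have [_ /(_ (e / 4))] := af_ N; rewrite divr_gt0// => /(_ isT)[h Vh fh].
exists h => //; have [mh _] := VL2 Vh.
rewrite (_ : (\int[mu]_x _)%E =
    (\int[mu]_x ((1 * (f x - f_ N x) + (f_ N x - h x)) ^+ 2)%:E)%E); last first.
  by apply: eq_integral => x _; congr (EFin (_ ^+ 2)); ring.
have := @sqr_lin_le _ _ _ mu setT measurableT (fun x => f x - f_ N x)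
  (fun x => f_ N x - h x) 1 (measurable_funB mf (mf_ N)) (measurable_funB (mf_ N) mh).
move=> /le_trans; apply.
apply: (@le_trans _ _ ((2 * 1 ^+ 2)%:E * (e / 4)%:E + 2%:E * (e / 4)%:E)%E).
  apply: leeD; last exact: lee_wpmul2l.
  apply: lee_wpmul2l; first by rewrite lee_fin expr1n mulr1.
  rewrite -[leLHS]fineK// lee_fin; move: dN; rewrite /= sub0r normrN => /ltW.
  by apply: le_trans; exact: ler_norm.
by rewrite -!EFinM -EFinD lee_fin expr1n; lra.
Qed.

Lemma L2_adherent_cst c : V (cst 1) -> L2_adherent (cst c).
Proof.
move=> V1; apply: L2_adherent_sub.
have := Vlin c V1 V0; congr (V _).
by apply/funext => x /=; rewrite mulr1 addr0.
Qed.

Lemma L2_adherent_indic (G : set (set T)) : V (cst 1) -> setI_closed G ->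
  G `<=` measurable -> measurable `<=` <<s G >> ->
  (forall A, G A -> L2_adherent \1_A) ->
  forall A, measurable A -> L2_adherent \1_A.
Proof.
move=> V1 GI GM MG GV.
pose H := [set A : set T | measurable A /\ L2_adherent \1_A].
suff : <<s G >> `<=` H by move=> GH A mA; have [] := GH _ (MG _ mA).
apply: lambda_system_subset => //; last first.
  by move=> A GA; split; [exact: GM|exact: GV].
split=> //.
- split; first exact: measurableT.
  by rewrite indicT; exact: L2_adherent_cst.
- move=> A B BA [GA VA] [GB VB]; split; first exact: measurableD.
  rewrite (_ : \1_(A `\` B) = (fun x => -1 * \1_B x + \1_A x)).
    exact: L2_adherent_lin.
  apply/funext => x; rewrite !indicE in_setD.
  have [xB|xB] := boolP (x \in B); last by rewrite andbT mulr0 add0r.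
  by rewrite (mem_set (BA _ (set_mem xB))) mulr1 addrC subrr.
- move=> F ndF GF.
  have GU : measurable (\bigcup_i F i) by apply: bigcup_measurable => i _; case: (GF i).
  split => //.
  apply: (@L2_adherent_dominated (fun m => \1_(F m)) _ (cst 1)) => //.
  + by move=> m; case: (GF m).
  + by under eq_integral do rewrite expr1n; rewrite integral_cst// mul1e.
  + by move=> m x; rewrite indicE; case: (_ \in _); rewrite ?normr1 ?normr0.
  + move=> x; rewrite indicE; have [/set_mem[i _ Fix]|xF] := boolP (x \in \bigcup_i F i).
      apply: cvg_near_cst; exists i => // j /= ij.
      by rewrite indicE mem_set//; exact: (subsetPset _ _ (ndF _ _ ij)).
    apply: cvg_near_cst; apply: nearW => j; rewrite indicE memNset// => Fjx.
    by move/negP: xF; apply; apply: mem_set; exists j.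
Qed.

Import HBNNSimple.

Lemma L2_adherent_dense : (forall A, measurable A -> L2_adherent \1_A) ->
  forall f : T -> R, measurable_fun setT f -> (\int[mu]_x (f x ^+ 2)%:E < +oo)%E ->
  L2_adherent f.
Proof.
move=> VA.
have sumV I (r : seq I) (c : I -> R) (h : I -> T -> R) : (forall i, L2_adherent (h i)) ->
    L2_adherent (fun x => \sum_(i <- r) c i * h i x).
  move=> hV; elim: r => [|i r IH].
    under eq_fun do rewrite big_nil.
    exact: L2_adherent_sub.
  by under eq_fun do rewrite big_cons; exact: L2_adherent_lin.
have ge0 (f : T -> R) : measurable_fun setT f -> (\int[mu]_x (f x ^+ 2)%:E < +oo)%E ->
    (forall x, 0 <= f x) -> L2_adherent f.
  move=> mf f2 f0.
  have mEf : measurable_fun setT (EFin \o f) by exact/measurable_EFinP.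
  pose h := nnsfun_approx measurableT mEf.
  have fE0 x : setT x -> (0 <= (EFin \o f) x)%E by rewrite lee_fin.
  have hf x : h m x @[m --> \oo] --> f x.
    by have /fine_cvgP[] := @cvg_nnsfun_approx _ _ _ _ measurableT _ mEf fE0 x I.
  have hle m x : h m x <= f x.
    rewrite -(cvg_lim _ (hf x))//.
    apply: nondecreasing_cvgn_le; last by apply/cvg_ex; exists (f x); exact: hf.
    by move=> i j ij; exact: (lefP _ _ (nd_nnsfun_approx measurableT mEf ij)).
  apply: (@L2_adherent_dominated (fun m => h m) _ f) => //.
    move=> m; rewrite (_ : (h m : T -> R) = (fun x =>
        \sum_(y <- finmap.enum_fset (fset_set (range (h m)))) y * \1_(h m @^-1` [set y]) x)); last first.
      by apply/funext => x; rewrite fimfunE fsbig_finite.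
    apply: sumV => i; apply: VA.
    by rewrite -[X in measurable X]setTI; exact: measurable_funP.
  by move=> m x; rewrite ger0_norm.
move=> f mf f2.
have part (g : T -> R) : measurable_fun setT g -> (forall x, 0 <= g x <= `|f x|) -> L2_adherent g.
  move=> mg gf; apply: ge0 => //; last by move=> x; case/andP: (gf x).
  apply: le_lt_trans f2; apply: ge0_le_integral => //.
  - by move=> x _; rewrite lee_fin sqr_ge0.
  - by apply/measurable_EFinP; exact: measurable_funX.
  - by apply/measurable_EFinP; exact: measurable_funX.
  - move=> x _; have /andP[g0 gfx] := gf x.
    by rewrite lee_fin -[leRHS]real_normK ?num_real// ler_pXn2r ?nnegrE.
rewrite (_ : f = (fun x => -1 * Num.max (- f x) 0 + Num.max (f x) 0)).
  apply: L2_adherent_lin; apply: part.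
  - by apply: measurable_maxr => //; exact: measurableT_comp.
  - move=> x; rewrite le_max lexx orbT/= ge_max normr_ge0 andbT.
    by rewrite -normrN ler_norm.
  - exact: measurable_maxr.
  - by move=> x; rewrite le_max lexx orbT/= ge_max normr_ge0 andbT ler_norm.
apply/funext => x; rewrite mulN1r addrC; have /orP[f0|f0] := le_total 0 (f x).
  have fN0 : - f x <= 0 by rewrite oppr_le0.
  by rewrite (max_l f0) (max_r fN0) subr0.
have fN0 : 0 <= - f x by rewrite oppr_ge0.
by rewrite (max_r f0) (max_l fN0) sub0r opprK.
Qed.

End L2_density.

Section distance_to_complement.
Context (R : realType) (n : nat) (U : set 'rV[R]_n) (a : 'rV[R]_n).
Hypotheses (oU : open U) (nUa : ~ U a).
Implicit Types x y : 'rV[R]_n.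

Definition codist x : R := inf [set `|x - y| | y in ~` U].

Let lb x : has_lbound [set `|x - y| | y in ~` U].
Proof. by exists 0 => _ [y _ <-]. Qed.

Let nonempty x : [set `|x - y| | y in ~` U] !=set0.
Proof. by exists `|x - a|, a. Qed.

Lemma codist_le x y : ~ U y -> codist x <= `|x - y|.
Proof. by move=> nUy; apply: ge_inf; [exact: lb|exists y]. Qed.

Lemma codist_ge0 x : 0 <= codist x.
Proof. by apply: lb_le_inf; [exact: nonempty|move=> _ [y _ <-]]. Qed.

Lemma codist_out x : ~ U x -> codist x = 0.
Proof.
move=> nUx; apply/eqP; rewrite eq_le codist_ge0 andbT.
by have := codist_le x nUx; rewrite subrr normr0.
Qed.

Lemma codist_gt0 x : U x -> 0 < codist x.
Proof.
move=> Ux; have /nbhs_ballP[r /= r0 rU] : nbhs x U by exact: open_nbhs_nbhs.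
apply: (lt_le_trans r0); apply: lb_le_inf; first exact: nonempty.
move=> _ [y nUy <-]; rewrite leNgt; apply/negP => xy; apply: nUy; apply: rU.
by rewrite -ball_normE.
Qed.

Lemma codist_lipschitz x y : `|codist x - codist y| <= `|x - y|.
Proof.
have half p q : codist p <= `|p - q| + codist q.
  rewrite -lerBlDl; apply: lb_le_inf; first exact: nonempty.
  move=> _ [z nUz <-]; rewrite lerBlDl; apply: le_trans (codist_le p nUz) _.
  exact: ler_distD.
rewrite ler_norml lerBlDr half andbT lerBrDr addrC lerBlDr.
by rewrite distrC addrC half.
Qed.

Definition bump (m : nat) x : R := Num.min 1 (m%:R * codist x).

Lemma bump_ge0 m x : 0 <= bump m x.
Proof. by rewrite le_min ler01 mulr_ge0 ?codist_ge0. Qed.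

Lemma bump_le1 m x : bump m x <= 1.
Proof. by rewrite ge_min lexx. Qed.

Lemma bump_lipschitz m x y : `|bump m x - bump m y| <= Num.min 1 (m%:R * `|x - y|).
Proof.
have := bump_ge0 m x; have := bump_ge0 m y; have := bump_le1 m x; have := bump_le1 m y.
move=> y1 x1 y0 x0; rewrite le_min; apply/andP; split; first by rewrite ler_norml; lra.
have half p q : bump m p - bump m q <= m%:R * `|codist p - codist q|.
  rewrite /bump; have [q1|q1] := leP 1 (m%:R * codist q).
    rewrite (@le_trans _ _ 0)// ?mulr_ge0//.
    by rewrite subr_le0 ge_min lexx.
  apply: (@le_trans _ _ (m%:R * codist p - m%:R * codist q)).
    by rewrite lerD2r ge_min lexx orbT.
  by rewrite -mulrBr ler_wpM2l// ler_norm.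
apply: (@le_trans _ _ (m%:R * `|codist x - codist y|)); last first.
  by rewrite ler_wpM2l// codist_lipschitz.
rewrite ler_norml half andbT lerNl opprB distrC; exact: half.
Qed.

Lemma bump_cvg x : bump m x @[m --> \oo] --> (\1_U x : R).
Proof.
apply: cvg_near_cst; rewrite indicE; have [Ux|nUx] := pselect (U x); last first.
  by apply: nearW => m; rewrite memNset// /bump codist_out// mulr0 min_r.
exists (Num.truncn (codist x)^-1).+1 => // m /= mx.
rewrite mem_set//= /bump min_l//.
rewrite -ler_pdivrMr ?codist_gt0// div1r (le_trans (ltW (truncnS_gt _)))//.
by rewrite ler_nat.
Qed.

Lemma measurable_bump m : measurable_fun setT (bump m).
Proof.
apply: continuous_measurable_rV; apply: (@lipschitz_continuous_rV _ _ _ m%:R) => x y.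
by have := bump_lipschitz m x y; rewrite le_min => /andP[].
Qed.

End distance_to_complement.

Section rV_borel.
Context (R : realType) (n : nat).
Local Notation leb := (lebesgue_rV R n).

Lemma measurable_sub_open : (measurable : set (set 'rV[R]_n)) `<=` <<s [set U : set 'rV[R]_n | open U] >>.
Proof.
pose B := g_sigma_algebraType [set U : set 'rV[R]_n | open U].
have mid : measurable_fun [set: B] (fun x : B => x : 'rV[R]_n).
  apply: measurable_fun_rVP => i.
  apply: (measurability _ (RGenOInfty.measurableE R)) => _ [_ [r ->] <-].
  rewrite setTI; apply: sub_sigma_algebra => /=.
  apply: open_comp => [x _|]; last exact: interval_open.
  exact: coord_continuous_rV.
by move=> A mA; have := mid measurableT _ mA; rewrite setTI.
Qed.

Lemma ae_product (P : 'rV[R]_n -> Prop) : {ae leb, forall x, P x} ->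
  {ae (leb \x leb)%E, forall z, P z.1 /\ P z.2}.
Proof.
move=> [N [mN N0 PN]].
exists ((N `*` setT) `|` (setT `*` N)); split.
- by apply: measurableU; exact: measurableX.
- have N1 : (leb \x leb)%E (N `*` setT) = 0%E.
    by transitivity (leb N * leb setT)%E; [exact: product_measure1E|rewrite N0 mul0e].
  have N2 : (leb \x leb)%E (setT `*` N) = 0%E.
    by transitivity (leb setT * leb N)%E; [exact: product_measure1E|rewrite N0 mule0].
  by apply: null_set_setU => //; exact: measurableX.
- move=> [x y] /= /not_andP[nP|nP]; [left|right]; split => //; exact: PN.
Qed.

End rV_borel.

(** * The Neumann form *)

Section neumann_form_properties.
Context (R : realType) (n : nat) (s : R) (Om : set 'rV[R]_n).
Hypotheses (n0 : (0 < n)%N) (s0 : 0 < s) (s1 : s < 1).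
Hypotheses (oOm : open Om) (bOm : bounded_set Om).
Hypothesis bd0 : lebesgue_rV R n (closure Om `\` Om) = 0%E.
Variable mOm : measurable Om.
Local Notation leb := (lebesgue_rV R n).
Local Notation leb2 := (lebesgue_rV R n \x lebesgue_rV R n)%E.
Local Notation k := (frac_kernel s).
Local Notation ext := (neumann_ext s Om).
Local Notation Z := (~` (~` Om `*` ~` Om)).
Local Notation gag := (gagliardo_integrand s).
Local Notation mu := (lebesgue_on mOm).
Local Notation D := (neumann_domain s mOm).
Local Notation a := (neumann_form s mOm).

Let mZ : measurable (Z : set ('rV[R]_n * 'rV[R]_n)).
Proof. exact: cross_measurable. Qed.

Let c0 : R := Cns n s / 2.

Let c0_gt0 : 0 < c0. Proof. by rewrite divr_gt0// Cns_gt0. Qed.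

Let L2m (u : L2 mu) : measurable_fun setT (u : 'rV[R]_n -> R).
Proof. exact: L2_measurable. Qed.

Let mu_int (f : 'rV[R]_n -> R) : measurable_fun setT f ->
  (\int[mu]_x (f x ^+ 2)%:E = \int[leb]_(x in Om) (f x ^+ 2)%:E)%E.
Proof.
move=> mf; apply: ge0_integral_mrestr => [|x]; last by rewrite lee_fin sqr_ge0.
by apply/measurable_EFinP; exact: measurable_funX.
Qed.

Let L2lty (u : L2 mu) : (\int[leb]_(x in Om) (u x ^+ 2)%:E < +oo)%E.
Proof. by have := L2_sqr_lty u; rewrite (mu_int (L2m u)). Qed.

Let L2_inner_Om (u v : L2 mu) : L2_inner u v = \int[leb]_(x in Om) (u x * v x).
Proof. by apply: Rintegral_mrestr; apply: measurable_funM; exact: L2m. Qed.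

Let mdiff (u : 'rV[R]_n -> R) : measurable_fun setT u ->
  measurable_fun Z (fun z : 'rV[R]_n * 'rV[R]_n => u z.1 - u z.2).
Proof.
move=> mu_; apply: measurable_funTS; apply: measurable_funB.
  exact: (measurableT_comp mu_ measurable_fst).
exact: (measurableT_comp mu_ measurable_snd).
Qed.

Let mk2 : measurable_fun Z (fun z : 'rV[R]_n * 'rV[R]_n => k z.1 z.2).
Proof. by apply: measurable_funTS; exact: measurable_frac_kernel. Qed.

Lemma sobolev_lin c u v : sobolev_Om s Om u -> sobolev_Om s Om v ->
  sobolev_Om s Om (fun x => c * u x + v x).
Proof.
move=> /sobolev_OmP[mu_ u2 Gu] /sobolev_OmP[mv v2 Gv]; apply/sobolev_OmP; split.
- by apply: measurable_funD => //; exact: measurable_funM.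
- by apply: sqr_lin_lty => //; exact: measurable_funTS.
- have := sqr_lin_weight_lty mZ c (mdiff mu_) (mdiff mv) mk2
    (fun z _ => frac_kernel_ge0 s z.1 z.2) Gu Gv.
  congr (_ < _)%E; apply: eq_integral => z _.
  by congr ((_ ^+ 2 * _)%:E); ring.
Qed.

Let ae_gag (u u' v v' : 'rV[R]_n -> R) :
  {ae leb, forall x, u x = u' x} -> {ae leb, forall x, v x = v' x} ->
  {ae leb2, forall z, Z z -> gag u v z = gag u' v' z}.
Proof.
move=> /ae_product uu' /ae_product vv'; apply: filterS2 uu' vv' => z [u1 u2] [v1 v2] _.
by rewrite /gagliardo_integrand u1 u2 v1 v2.
Qed.

Lemma sobolev_ae u v : measurable_fun setT v -> {ae leb, forall x, u x = v x} ->
  sobolev_Om s Om u -> sobolev_Om s Om v.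
Proof.
move=> mv uv /sobolev_OmP[mu_ u2 Gu]; apply/sobolev_OmP; split => //.
  apply: le_lt_trans u2; rewrite le_eqVlt; apply/orP; left; apply/eqP.
  apply: ae_eq_integral => //.
  - by apply/measurable_EFinP; apply: measurable_funX; exact: measurable_funTS.
  - by apply/measurable_EFinP; apply: measurable_funX; exact: measurable_funTS.
  - by apply: filterS uv => x uvx _; rewrite uvx.
apply: le_lt_trans Gu; rewrite le_eqVlt; apply/orP; left; apply/eqP.
apply: ae_eq_integral.
- exact: mZ.
- by apply/measurable_EFinP; apply: measurable_funM => //; apply: measurable_funX; exact: mdiff.
- by apply/measurable_EFinP; apply: measurable_funM => //; apply: measurable_funX; exact: mdiff.
- by apply: filterS (ae_product uv) => z [u1 u2'] _; rewrite u1 u2'.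
Qed.

Let ext_lin c (u v : L2 mu) :
  ext (c *: u + v : L2 mu) = (fun x => c * ext u x + ext v x).
Proof.
apply/funext => x.
exact: (neumann_ext_linear s0 oOm bOm c x (L2m u) (L2m v) (L2lty u) (L2lty v)).
Qed.

Let formE u v : D u -> D v -> a u v = c0 * \int[leb2]_(z in Z) gag (ext u) (ext v) z.
Proof. exact: energyE. Qed.

Let gag_int u v : D u -> D v -> leb2.-integrable Z (EFin \o gag (ext u) (ext v)).
Proof. by move=> Du Dv; exact: (gagliardo_integrable oOm Du Dv). Qed.

Lemma neumann_form_ae : ae_invariant_form D a.
Proof.
move=> u v uv Du.
have extuv : {ae leb, forall x, ext u x = ext v x}.
  apply: (neumann_ext_ae s0 oOm bOm (L2m u) (L2m v) (L2lty u) (L2lty v)).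
  apply: (ae_mrestr leb mOm (fun x => u x = v x)).1.
  by apply: filterS uv => x /(_ I).
have Dv : D v.
  by apply: sobolev_ae extuv Du; exact: (measurable_neumann_ext s oOm (L2m v)).
split; first exact: Dv.
move=> w Dw; rewrite (formE Du Dw) (formE Dv Dw) (formE Dw Du) (formE Dw Dv).
have ext_w : {ae leb, forall x, ext w x = ext w x} by exact: aeW.
have Rint_ae (f g : 'rV[R]_n * 'rV[R]_n -> R) : leb2.-integrable Z (EFin \o f) ->
    leb2.-integrable Z (EFin \o g) -> {ae leb2, forall z, Z z -> f z = g z} ->
    \int[leb2]_(z in Z) f z = \int[leb2]_(z in Z) g z.
  move=> fi gi fg; rewrite /Rintegral; congr fine; apply: ae_eq_integral; first exact: mZ.
  - exact: measurable_int fi.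
  - exact: measurable_int gi.
  - by apply: filterS fg => z fgz Zz; rewrite (fgz Zz).
rewrite (Rint_ae _ _ (gag_int Du Dw) (gag_int Dv Dw) (ae_gag extuv ext_w)).
by rewrite (Rint_ae _ _ (gag_int Dw Du) (gag_int Dw Dv) (ae_gag ext_w extuv)).
Qed.

Let gagC (u v : 'rV[R]_n -> R) : gag u v = gag v u.
Proof. by apply/funext => z; rewrite /gagliardo_integrand (mulrC (u _ - _)). Qed.

Lemma neumann_form_sym : symmetric_on D a.
Proof. by move=> u v Du Dv; rewrite (formE Du Dv) (formE Dv Du) gagC. Qed.

Let gag_lin c (p q r : 'rV[R]_n -> R) z :
  gag (fun x => c * p x + q x) r z = c * gag p r z + gag q r z.
Proof. by rewrite /gagliardo_integrand; move: (k _ _) => K; ring. Qed.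

Let gag_ge0 (u : 'rV[R]_n -> R) z : 0 <= gag u u z.
Proof. by rewrite mulr_ge0 ?frac_kernel_ge0// -expr2 sqr_ge0. Qed.

Lemma neumann_form_ge0 : nonneg_on D a.
Proof.
move=> u Du; rewrite (formE Du Du); apply: mulr_ge0; first exact: ltW.
by apply: Rintegral_ge0 => z _; exact: gag_ge0.
Qed.

Lemma neumann_form_bilinear : bilinear_on D a.
Proof.
have D0 : D 0.
  rewrite /neumann_domain /= (_ : ext (0 : L2 mu) = cst 0).
    apply/sobolev_OmP; split; first exact: measurable_cst.
      by under eq_integral do rewrite expr0n; rewrite integral0.
    by under eq_integral do rewrite subrr expr0n mul0r; rewrite integral0.
  apply/funext => x; have := ext_lin (-1) 0 0 => /(congr1 (fun f => f x)) /=.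
  by rewrite scaler0 addr0 => ->; ring.
have Dlin c u v : D u -> D v -> D (c *: u + v).
  move=> Du Dv; change (sobolev_Om s Om (ext (c *: u + v : L2 mu))).
  rewrite (ext_lin c u v); exact: (sobolev_lin c Du Dv).
have linl c u v w : D u -> D v -> D w -> a (c *: u + v) w = c * a u w + a v w.
  move=> Du Dv Dw; have Duv := Dlin c _ _ Du Dv.
  rewrite (formE Duv Dw) (formE Du Dw) (formE Dv Dw) (ext_lin c u v).
  rewrite mulrCA -mulrDr; congr (_ * _).
  have iu := gag_int Du Dw; have iv := gag_int Dv Dw.
  rewrite -(RintegralZl c mZ iu) -(RintegralD mZ _ iv); last exact: (integrableZl mZ c iu).
  by apply: eq_Rintegral => z _; exact: gag_lin.
split; [exact: D0|exact: Dlin|exact: linl|] => c u v w Du Dv Dw.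
rewrite (neumann_form_sym Dw (Dlin c _ _ Du Dv)) (linl c _ _ _ Du Dv Dw).
by rewrite (neumann_form_sym Dw Du) (neumann_form_sym Dw Dv).
Qed.

Lemma neumann_form_dense : densely_defined D.
Proof.
pose V := [set v : 'rV[R]_n -> R | sobolev_Om s Om v].
have mu_lty : (mu setT < +oo)%E.
  by rewrite /= /mrestr setTI; exact: bounded_lebesgue_lty.
have VL2 v : V v -> measurable_fun setT v /\ (\int[mu]_x (v x ^+ 2)%:E < +oo)%E.
  by move=> /sobolev_OmP[mv v2 _]; split => //; rewrite mu_int.
have Vcst c : V (cst c).
  apply/sobolev_OmP; split; first exact: measurable_cst.
    have -> : (\int[leb]_(x in Om) ((cst c x : R) ^+ 2)%:E = (c ^+ 2)%:E * leb Om)%E.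
      exact: (integral_cst leb mOm (c ^+ 2)%:E).
    by rewrite lte_mul_pinfty ?lee_fin ?sqr_ge0//; exact: bounded_lebesgue_lty.
  by under eq_integral do rewrite subrr expr0n mul0r; rewrite integral0.
have Vlin c f g : V f -> V g -> V (fun x => c * f x + g x) by exact: sobolev_lin.
have open_adh U : open U -> L2_adherent mu V \1_U.
  move=> oU; have [UT|/existsNP[p nUp]] := pselect (forall x, U x).
    rewrite (_ : U = setT); last by apply/seteqP; split.
    by rewrite indicT; apply: L2_adherent_sub VL2 _ (Vcst 1).
  apply: (L2_adherent_dominated VL2 (f_ := bump U) (g := cst 1)).
  - move=> m; apply: (L2_adherent_sub VL2).
    apply: (@sobolev_lipschitz _ _ _ _ s0 oOm bOm (bump U m) m%:R) => //.
    + exact: (measurable_bump nUp).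
    + apply: le_lt_trans (bounded_lebesgue_lty mOm bOm).
      have <- : (\int[leb]_(x in Om) 1 = leb Om)%E.
        by rewrite -[RHS]mul1e; exact: (integral_cst leb mOm 1%E).
      apply: ge0_le_integral => //.
      * by move=> x _; rewrite lee_fin sqr_ge0.
      * apply/measurable_EFinP; apply: measurable_funX; apply: measurable_funTS.
        exact: (measurable_bump nUp).
      * move=> x _; rewrite lee_fin expr_le1 ?(bump_le1 U)//; exact: (bump_ge0 nUp).
    + exact: (bump_lipschitz nUp).
  - by apply: measurable_indic; exact: open_measurable_rV.
  - exact: measurable_cst.
  - have -> : (\int[mu]_x ((cst 1 x : R) ^+ 2)%:E = mu setT)%E; last exact: mu_lty.
    by under eq_integral do rewrite expr1n; rewrite -[RHS]mul1e; exact: (integral_cst mu measurableT 1%E).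
  - by move=> m x; rewrite ger0_norm ?(bump_ge0 nUp)// bump_le1.
  - by move=> x; exact: (bump_cvg oU nUp).
have indic_adh := @L2_adherent_indic _ _ _ mu V mu_lty VL2 (Vcst 0) Vlin
  [set U | open U] (Vcst 1) (@openI _) (@open_measurable_rV R n) (@measurable_sub_open R n) open_adh.
move=> f e e0.
have f2 : (\int[mu]_x (f x ^+ 2)%:E < +oo)%E by exact: L2_sqr_lty.
have [_ fV] := L2_adherent_dense VL2 (Vcst 0) Vlin indic_adh (L2m f) f2.
have [|v Vv fv] := fV ((e / 2) ^+ 2); first by rewrite exprn_gt0// divr_gt0.
have [mv v2] := VL2 _ Vv.
have [u uE] := L2_mk mv v2.
exists u; first by rewrite /neumann_domain /= uE; exact: sobolev_neumann_ext.
have : L2_norm (f - u) ^+ 2 <= (e / 2) ^+ 2.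
  by rewrite -lee_fin L2_norm_sqr L2_inner_diag; move: fv; rewrite -uE.
rewrite ler_pXn2r ?nnegrE ?L2_norm_ge0 ?divr_ge0 ?(ltW e0)// => /le_lt_trans; apply.
by rewrite ltr_pdivrMr// ltr_pMr// ltr1n.
Qed.

Let ext_sub (u v : L2 mu) x : ext (u - v : L2 mu) x = ext u x - ext v x.
Proof.
rewrite (_ : u - v = -1 *: v + u); last by rewrite scaleN1r addrC.
by rewrite ext_lin mulN1r addrC.
Qed.

Let gag_sq (u : 'rV[R]_n -> R) z : gag u u z = (u z.1 - u z.2) ^+ 2 * k z.1 z.2.
Proof. by rewrite /gagliardo_integrand expr2. Qed.

Let gag_EFin (u : L2 mu) : D u ->
  (\int[leb2]_(z in Z) ((ext u z.1 - ext u z.2) ^+ 2 * k z.1 z.2)%:E =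
   (\int[leb2]_(z in Z) gag (ext u) (ext u) z)%:E)%E.
Proof.
move=> Du; rewrite /Rintegral fineK.
  by apply: eq_integral => z _; rewrite gag_sq.
exact: (integrable_fin_num mZ (gag_int Du Du)).
Qed.

Let cvg_sqr_diff (b c l m K : R) (x_ y_ : nat -> R) :
  x_ r @[r --> \oo] --> l -> y_ r @[r --> \oo] --> m ->
  (b - x_ r - (c - y_ r)) ^+ 2 * K @[r --> \oo] --> (b - l - (c - m)) ^+ 2 * K.
Proof.
move=> xl ym; apply: cvgM; last exact: cvg_cst; rewrite expr2; under eq_fun do rewrite expr2.
have bc : b - x_ r - (c - y_ r) @[r --> \oo] --> b - l - (c - m).
  by apply: cvgB; apply: cvgB => //; exact: cvg_cst.
exact: (cvgM bc bc).
Qed.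

Lemma neumann_form_closed : closed_form D a.
Proof.
move=> w_ Dw Cw.
have [_ Dlin _ _] := neumann_form_bilinear.
have Dsub u v : D u -> D v -> D (u - v).
  move=> Du Dv; rewrite (_ : u - v = -1 *: v + u); last by rewrite scaleN1r addrC.
  exact: Dlin.
have a0 := neumann_form_ge0.
have CL2 e : 0 < e -> exists N, forall i j, (N <= i)%N -> (N <= j)%N ->
    L2_inner (w_ i - w_ j) (w_ i - w_ j) < e.
  move=> e0; have se0 : 0 < Num.sqrt e by rewrite sqrtr_gt0.
  have [N NP] := Cw _ se0; exists N => i j Ni Nj.
  have := NP i j Ni Nj; have Dij := Dsub _ _ (Dw i) (Dw j).
  rewrite (form_norm_lt a0 se0 Dij) sqr_sqrtr ?(ltW e0)//; apply: le_lt_trans.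
  by rewrite lerDr a0.
have CG e : 0 < e -> exists N, forall i j, (N <= i)%N -> (N <= j)%N ->
    \int[leb2]_(z in Z) gag (ext (w_ i - w_ j : L2 mu)) (ext (w_ i - w_ j : L2 mu)) z < e.
  move=> e0; have ce0 : 0 < c0 * e by rewrite mulr_gt0.
  have se0 : 0 < Num.sqrt (c0 * e) by rewrite sqrtr_gt0.
  have [N NP] := Cw _ se0; exists N => i j Ni Nj.
  have := NP i j Ni Nj; have Dij := Dsub _ _ (Dw i) (Dw j).
  rewrite (form_norm_lt a0 se0 Dij) sqr_sqrtr ?(ltW ce0)// (formE Dij Dij).
  move=> H; rewrite -(ltr_pM2l c0_gt0); apply: le_lt_trans H.
  by rewrite lerDl L2_inner_ge0.
have [f [phi [phi_ge w_f cvgL2]]] := L2_complete CL2.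
have ptw : {ae leb, forall x, ext (w_ (phi m)) x @[m --> \oo] --> ext f x}.
  have := (ae_mrestr leb mOm (fun x => w_ (phi m) x @[m --> \oo] --> f x)).1 w_f.
  apply: filterS => x wx; have [Ox|nOx] := pselect (Om x).
    rewrite (neumann_ext_in s f Ox).
    under eq_fun do rewrite (neumann_ext_in s _ Ox).
    exact: wx.
  apply: (@neumann_ext_cvg _ _ _ _ s0 oOm bOm (fun m => w_ (phi m)) f x).
  - by move=> m; exact: L2m.
  - exact: L2m.
  - by move=> m; exact: L2lty.
  - exact: L2lty.
  - move=> e e0; have [N NP] := cvgL2 e e0; exists N => m Nm.
    have := NP (phi m) (leq_trans Nm (phi_ge m)).
    by rewrite -lee_fin L2_inner_diag (mu_int (L2m _)).
  - exact: nOx.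
have fatou i N e : (forall j, (N <= j)%N ->
      \int[leb2]_(z in Z) gag (ext (w_ i - w_ j : L2 mu)) (ext (w_ i - w_ j : L2 mu)) z <= e) ->
    (\int[leb2]_(z in Z) ((ext (w_ i - f : L2 mu) z.1 - ext (w_ i - f : L2 mu) z.2) ^+ 2
       * k z.1 z.2)%:E <= e%:E)%E.
  move=> He.
  have msq (u : L2 mu) : measurable_fun Z (fun z : 'rV[R]_n * 'rV[R]_n =>
      (ext u z.1 - ext u z.2) ^+ 2 * k z.1 z.2).
    apply: measurable_funM => //; apply: measurable_funX; apply: mdiff.
    exact: (measurable_neumann_ext s oOm (L2m u)).
  apply: (@fatou_le _ _ _ leb2 Z (fun m z => (ext (w_ i - w_ (phi m) : L2 mu) z.1 -
    ext (w_ i - w_ (phi m) : L2 mu) z.2) ^+ 2 * k z.1 z.2) _ e%:E N).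
  - exact: mZ.
  - by move=> m; exact: msq.
  - exact: msq.
  - by move=> m z _; rewrite mulr_ge0 ?sqr_ge0 ?frac_kernel_ge0.
  - apply: filterS (ae_product ptw) => z [w1 w2] _.
    rewrite !ext_sub; under eq_fun do rewrite !ext_sub.
    exact: (@cvg_sqr_diff (ext (w_ i) z.1) (ext (w_ i) z.2) _ _ (k z.1 z.2) _ _ w1 w2).
  - move=> m Nm; rewrite (gag_EFin (Dsub _ _ (Dw i) (Dw (phi m)))) lee_fin.
    by apply: He; exact: leq_trans Nm (phi_ge m).
have Dwf i N e : (forall j, (N <= j)%N ->
      \int[leb2]_(z in Z) gag (ext (w_ i - w_ j : L2 mu)) (ext (w_ i - w_ j : L2 mu)) z <= e) ->
    D (w_ i - f).
  move=> He; change (sobolev_Om s Om (ext (w_ i - f : L2 mu))).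
  apply/sobolev_OmP; split.
  - exact: (measurable_neumann_ext s oOm (L2m (w_ i - f))).
  - have <- : (\int[leb]_(x in Om) ((w_ i - f : L2 mu) x ^+ 2)%:E =
        \int[leb]_(x in Om) (ext (w_ i - f : L2 mu) x ^+ 2)%:E)%E.
      by apply: eq_integral => x /set_mem Ox; rewrite (neumann_ext_in s _ Ox).
    exact: L2lty.
  - by apply: le_lt_trans (fatou _ _ _ He) _; rewrite ltry.
have Dk (e : R) : 0 < e -> exists N, forall i, (N <= i)%N -> D (w_ i - f) /\
    \int[leb2]_(z in Z) gag (ext (w_ i - f : L2 mu)) (ext (w_ i - f : L2 mu)) z <= e.
  move=> e0; have [N NP] := CG e e0; exists N => i Ni.
  have He j : (N <= j)%N ->
      \int[leb2]_(z in Z) gag (ext (w_ i - w_ j : L2 mu)) (ext (w_ i - w_ j : L2 mu)) z <= e.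
    by move=> Nj; apply/ltW/NP.
  have Di := Dwf _ _ _ He; split; first exact: Di.
  by rewrite -lee_fin -(gag_EFin Di); exact: (fatou _ _ _ He).
exists f.
  have [N NP] := Dk 1 ltr01; have [DN _] := NP N (leqnn N).
  by have := Dsub _ _ (Dw N) DN; rewrite (subKr (w_ N) f).
apply/cvgrPdist_lt => e e0.
have e40 : 0 < e ^+ 2 / 4 by rewrite divr_gt0// exprn_gt0.
have [N1 N1P] := Dk (e ^+ 2 / 4 / c0) (divr_gt0 e40 c0_gt0).
have [N2 N2P] := cvgL2 _ e40.
exists (maxn N1 N2) => // i /=; rewrite geq_max => /andP[i1 i2].
have [Di gi] := N1P i i1; have li := N2P i i2.
rewrite sub0r normrN ger0_norm ?sqrtr_ge0// (form_norm_lt a0 e0 Di) (formE Di Di).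
move: gi; rewrite ler_pdivlMr// mulrC => gi.
by apply: le_lt_trans (lerD gi li) _; have := exprn_gt0 2 e0; lra.
Qed.

Let energy_linr c p q r : sobolev_Om s Om p -> sobolev_Om s Om q -> sobolev_Om s Om r ->
  energy s Om r (fun x => c * p x + q x) = c * energy s Om r p + energy s Om r q.
Proof.
move=> Wp Wq Wr; have Wpq := sobolev_lin c Wp Wq.
rewrite (energyE oOm Wr Wpq) (energyE oOm Wr Wp) (energyE oOm Wr Wq).
rewrite mulrCA -mulrDr; congr (_ * _).
have ip := gagliardo_integrable oOm Wr Wp; have iq := gagliardo_integrable oOm Wr Wq.
rewrite -(RintegralZl c mZ ip) -(RintegralD mZ _ iq); last exact: (integrableZl mZ c ip).
by apply: eq_Rintegral => z _; rewrite !(gagC r) gag_lin.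
Qed.

Lemma neumann_weak_solutionP (u f : L2 mu) :
  associated_operator D a u f <-> neumann_weak_solution s Om f (ext u).
Proof.
split=> [[Du auf]|[Du weak]]; last first.
  split; first exact: Du.
  move=> v Dv; rewrite /neumann_form (weak _ Dv) L2_inner_Om.
  by apply: eq_Rintegral => x /set_mem Ox; rewrite (neumann_ext_in s v Ox).
split; first exact: Du.
move=> v Wv; have [mv v2 _] := (sobolev_OmP s Om v).1 Wv.
have [vL vE] : exists vL : L2 mu, vL = v :> ('rV[R]_n -> R).
  by apply: L2_mk => //; rewrite (mu_int mv).
have Wev := sobolev_neumann_ext s0 oOm bOm bd0 Wv.
have DvL : D vL by change (sobolev_Om s Om (ext vL)); rewrite vE.
have Wh := sobolev_lin (-1) Wev Wv.
have h0 x : Om x -> -1 * ext v x + v x = 0.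
  by move=> Ox; rewrite (neumann_ext_in s v Ox) mulN1r addNr.
have orth := energy_neumann_ext_orth s0 oOm bOm bd0 (L2m u) (L2lty u) Du Wh h0.
have := energy_linr 1 Wh Wev Du.
rewrite orth mulr0 add0r.
have -> : (fun x => 1 * (-1 * ext v x + v x) + ext v x) = v.
  by apply/funext => x; rewrite mul1r mulN1r addrC addrA subrr add0r.
move=> ->; rewrite -[in ext v]vE.
have := auf _ DvL; rewrite /neumann_form => ->.
by rewrite L2_inner_Om vE.
Qed.

End neumann_form_properties.

Unset Implicit Arguments.
Set Strict Implicit.
Set Printing Implicit Defensive.

Theorem theorem3p9 (R : realType) (n : nat) (s : R) (Om : set 'rV[R]_n)
    (oOm : open Om) :
  (0 < n)%N -> 0 < s -> s < 1 -> bounded_set Om -> lipschitz_boundary Om ->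
  let mOm := open_measurable_rV oOm in
  let D_N := neumann_domain s mOm in
  let a_N := neumann_form s mOm in
  let A_N := associated_operator D_N a_N in
  [/\ ae_invariant_form D_N a_N, bilinear_on D_N a_N,
      symmetric_on D_N a_N, nonneg_on D_N a_N &
      densely_defined D_N] /\
  closed_form D_N a_N /\
  selfadjoint A_N /\
  operator_domain A_N =
    [set u : L2 (lebesgue_on mOm) |
      sobolev_Om s Om (neumann_ext s Om u) /\
      exists f : L2 (lebesgue_on mOm),
        neumann_weak_solution s Om f (neumann_ext s Om u)] /\
  (forall u f : L2 (lebesgue_on mOm),
    A_N u f <-> neumann_weak_solution s Om f (neumann_ext s Om u)).
Proof.
move=> n0 s0 s1 bOm lip mOm D_N a_N A_N.
have bd0 := lipschitz_boundary_null oOm bOm lip.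
have formA : ae_invariant_form D_N a_N by exact: (neumann_form_ae s0).
have formB : bilinear_on D_N a_N by exact: neumann_form_bilinear.
have formS : symmetric_on D_N a_N by exact: neumann_form_sym.
have formP : nonneg_on D_N a_N by exact: neumann_form_ge0.
have formD : densely_defined D_N by exact: neumann_form_dense.
have formC : closed_form D_N a_N by exact: neumann_form_closed.
have weakP u f : A_N u f <-> neumann_weak_solution s Om f (neumann_ext s Om u).
  exact: neumann_weak_solutionP.
split; first by split.
split; first exact: formC.
split; first exact: associated_operator_selfadjoint.
split; last exact: weakP.
apply/seteqP; split=> [u [f /weakP uf]|u [_ [f /weakP uf]]]; last by exists f.
by split; [exact: uf.1|exists f].
Qed.
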